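(* The $L^1$-moment spectrum determines planar triangles. That is, let $D_1$ and $D_2$ be triangular domains in $\mathbb{R}^2$ with first exit times $\tau_{D_1}$ and $\tau_{D_2}$ of planar Brownian motion. If $$\int_{D_1}\mathbb{E}^x[\tau_{D_1}^k]\,dx=\int_{D_2}\mathbb{E}^x[\tau_{D_2}^k]\,dx\quad\text{for every integer }k\ge 1,$$ then $D_1$ and $D_2$ are isometric.
   Context: A triangular domain is the (bounded, open) interior of a nondegenerate triangle in $\mathbb{R}^2$. Two triangular domains are isometric if one is the image of the other under an isometry of the Euclidean plane. Let $X_t$ be Brownian motion in the plane, $\mathbb{P}^x$ the probability measure under which $X_t$ starts at $x$, and $\mathbb{E}^x$ the corresponding expectation. For a domain $D\subset\mathbb{R}^2$, the first exit time is $\tau_D=\inf\{t\ge 0: X_t\notin D\}$. The $L^1$-moment spectrum of $D$ is the sequence, indexed by the natural numbers $k\ge1$, of the $L^1$-norms over $D$ of the exit time moments, $\|\mathbb{E}^x[\tau_D^k]\|_1=\int_D\mathbb{E}^x[\tau_D^k]\,dx$. *)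

(* Defs.v *)
From HB Require Import structures.
From mathcomp Require Import all_boot all_order all_algebra.
From mathcomp Require Import all_classical all_reals all_analysis.

Set Implicit Arguments.
Unset Strict Implicit.
Unset Printing Implicit Defensive.

Import Order.TTheory GRing.Theory Num.Theory.
Import numFieldNormedType.Exports.

Local Open Scope classical_set_scope.
Local Open Scope ring_scope.

(* The plane is [R * R]: its product topology is the Euclidean one and its
   product sigma-algebra is the Borel one.  The norm the library puts on
   [R * R] is the sup norm, so the Euclidean distance is defined here. *)
Section plane_geometry.
Variable R : realType.
Implicit Types (p q a b c v : R * R) (D : set (R * R)).

Definition euclidean_dist p q : R :=
  Num.sqrt ((p.1 - q.1) ^+ 2 + (p.2 - q.2) ^+ 2).

(* A distance-preserving self-map of the plane is automatically bijective. *)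
Definition plane_isometry (f : R * R -> R * R) : Prop :=
  forall p q, euclidean_dist (f p) (f q) = euclidean_dist p q.

Definition isometric_domains D1 D2 : Prop :=
  exists2 f, plane_isometry f & D2 = f @` D1.

Definition affine_line p v : set (R * R) :=
  [set q | exists r : R, q = p + r *: v].

Definition collinear a b c : Prop :=
  exists p v, [/\ v != 0, affine_line p v a, affine_line p v b
                & affine_line p v c].

Definition closed_triangle a b c : set (R * R) :=
  [set q | exists r s t : R,
    [/\ 0 <= r, 0 <= s, 0 <= t, r + s + t = 1
      & q = r *: a + s *: b + t *: c]].

Definition triangular_domain D : Prop :=
  exists a b c, ~ collinear a b c /\ D = interior (closed_triangle a b c).

End plane_geometry.

Section brownian_motion.
Context {R : realType} {d : measure_display} {Omega : measurableType d}.
Implicit Types (P : probability Omega R) (X : R -> Omega -> R * R).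

(* Processes are indexed by [R], but only the times [t >= 0] matter. *)
Definition increment X (s t : R) : Omega -> R * R :=
  fun w => X t w - X s w.

(* Centered Gaussian law on the plane with covariance matrix [v] times the
   identity; the second parameter of [normal_prob] is a standard deviation. *)
Definition planar_gaussian (v : R) : set (R * R) -> \bar R :=
  (normal_prob 0 (Num.sqrt v) \x normal_prob 0 (Num.sqrt v))%E.

Definition independent_increments P X : Prop :=
  forall (n : nat) (t : nat -> R) (A : 'I_n -> set (R * R)),
    0 <= t 0%N -> (forall i, (i < n)%N -> t i <= t i.+1) ->
    (forall i, measurable (A i)) ->
    P (\bigcap_(i in [set: 'I_n]) (increment X (t i) (t i.+1) @^-1` A i)) =
    (\prod_(i < n) P (increment X (t i) (t i.+1) @^-1` A i))%E.

(* Standard planar Brownian motion, i.e. with generator half the Laplacian. *)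
Record planar_brownian_motion P X (x : R * R) : Prop := {
  bm_measurable : forall t, 0 <= t -> measurable_fun [set: Omega] (X t) ;
  bm_start : {ae P, forall w, X 0 w = x} ;
  bm_continuous :
    {ae P, forall w, {within `[0, +oo[, continuous (fun t => X t w)}} ;
  bm_gaussian : forall s t, 0 <= s -> s < t ->
    forall A, measurable A ->
      P (increment X s t @^-1` A) = planar_gaussian (t - s) A ;
  bm_independent : independent_increments P X
}.

(* The infimum of the empty set is [+oo]: a path that never leaves [D] has
   infinite exit time. *)
Definition exit_time X (D : set (R * R)) (w : Omega) : \bar R :=
  ereal_inf [set t%:E | t in [set t : R | 0 <= t /\ ~ D (X t w)]].

Definition exit_moment P X (D : set (R * R)) (k : nat) : \bar R :=
  (\int[P]_w (exit_time X D w ^+ k))%E.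

(* The integrand is nonnegative, so this is the L^1-norm over [D]. *)
Definition L1_exit_moment (P : R * R -> probability Omega R) X
    (D : set (R * R)) (k : nat) : \bar R :=
  (\int[lebesgue_measure \x lebesgue_measure]_(x in D)
     exit_moment (P x) X D k)%E.

End brownian_motion.

(* Main.v *)
Require Import Defs.
From HB Require Import structures.
From mathcomp Require Import all_boot all_order all_algebra.
From mathcomp Require Import all_classical all_reals all_analysis.
From mathcomp Require Import measurable_realfun.
From mathcomp Require Import ring lra.

(* Write the triangle as the set where the barycentric coordinates
   [c m - dot (v m) z] are positive, with [v] summing to zero.  A path started at
   [z] leaves before time [t] iff for some [m] the supremum of [dot (v m) B] up to
   [t] reaches the coordinate, so by Brownian scaling the exit time has the law of
   the square of the least ratio between the coordinates of [z] and the suprema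
   [S m] up to time [1].  Integrating over [z], the tail events become simplices
   whose size depends only on [Z = \sum_m S m], and the [k]-th moment equals
   [K k * area * E (Z ^- 2) ^+ k] with [K k] the same for all triangles.

   The variable [Z ^- 2] has an exponential moment, so the spectrum determines its
   law up to the mass, hence all [area * E (Z ^+ j)].  Now [v m] has length
   side/(2 area), so [j = 0] gives the area and [j = 1], where the mean of [Z] is
   proportional to the sum of the lengths of the [v m], gives the perimeter.  The
   even moments determine [E (expR (lam * Z ^+ 2))], which is finite iff
   [lam * |v m| ^+ 2 < 1/2] for all [m]; this gives the longest side.  By Heron's
   formula the area, the perimeter and the longest side determine the triangle. *)

(** The exit time is an infimum over all real times and paths are continuous only almost surely, so
    measurability is reached only through countably many times: suprema run over dyadic times,
    equality in law is tested on tail events, and a few integrals are compared without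
    measurability. The joint law of the three suprema is never computed. Only [Z] matters, through
    its mean, which is linear in the suprema, and through the exact exponent at which
    [expR (lam * Z ^+ 2)] stops being integrable. From below, [Z] dominates each [dot (v m)] of an
    increment. From above, three values at different times reduce to two independent increments
    along [v m]'s, because the [v m] sum to zero; hence no direction longer than the longest [v m]
    appears, and chaining costs only an arbitrarily small factor. The moments start at [k = 1] and
    the area is unknown, so the total mass is not given. The law weighted by [Z ^- 2] is determined
    instead, and integrating its Laplace transform against [s^(j/2)] brings back [Z ^+ j], including
    [j = 0]. *)

Set Implicit Arguments.
Unset Strict Implicit.
Unset Printing Implicit Defensive.

Import Order.TTheory GRing.Theory Num.Theory.
Import numFieldNormedType.Exports.

Local Open Scope classical_set_scope.
Local Open Scope ring_scope.

(** * Integrals and changes of variables *)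

Section integral_tools.
Local Open Scope ereal_scope.

Import HBNNSimple.

(* No measurability is assumed: the integral of a nonnegative function is a
   supremum over simple functions below it, and a simple function can be set
   to zero on a measurable null set. *)
Lemma ge0_ae_le_integral_nonmeasurable d (T : measurableType d) (R : realType)
    (mu : {measure set T -> \bar R}) (f g : T -> \bar R) :
  (forall x, 0 <= f x) -> (forall x, 0 <= g x) ->
  {ae mu, forall x, f x <= g x} ->
  \int[mu]_x f x <= \int[mu]_x g x.
Proof.
move=> f0 g0 [N [mN N0 fgN]].
rewrite !ge0_integralTE//; apply: ub_ereal_sup => _ [h hf <-].
have mNC : measurable (~` N) by exact: measurableC.
pose h' : {nnsfun T >-> R} := (h \* indic_nnsfun R mNC)%R.
have hh' : sintegral mu h = sintegral mu h'.
  rewrite -!integralT_nnsfun; apply: ge0_ae_eq_integral => //.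
  - by apply/measurable_EFinP; exact/measurable_funP.
  - by apply/measurable_EFinP; exact/measurable_funP.
  - by move=> x _; rewrite lee_fin.
  - by move=> x _; rewrite lee_fin.
  exists N; split => // x /= /not_implyP[_ hx]; apply: contrapT => Nx.
  apply: hx; rewrite /h' /=. rewrite mindicE mem_set ?mulr1//.
rewrite hh'; apply: ereal_sup_ubound; exists h' => //= x.
rewrite /= mindicE; case: (boolP (x \in ~` N)) => xN; last first.
  by rewrite mulr0.
rewrite mulr1; apply: (le_trans (hf x)).
move: xN; rewrite inE => xN; apply: contrapT => fgx; apply: xN.
exact: fgN.
Qed.

Lemma ge0_ae_eq_integral_nonmeasurable d (T : measurableType d) (R : realType)
    (mu : {measure set T -> \bar R}) (f g : T -> \bar R) :
  (forall x, 0 <= f x) -> (forall x, 0 <= g x) ->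
  {ae mu, forall x, f x = g x} ->
  \int[mu]_x f x = \int[mu]_x g x.
Proof.
move=> f0 g0 fg; apply/eqP; rewrite eq_le; apply/andP; split.
- by apply: ge0_ae_le_integral_nonmeasurable => //; apply: filterS fg => x ->.
- by apply: ge0_ae_le_integral_nonmeasurable => //; apply: filterS fg => x ->.
Qed.

(** The half-lines above [r] generate the Borel sets of the extended line and are stable under
    intersection, so equal tails force equal image measures. This turns equality in law, possibly
    between different spaces, into equality of moments. *)
Lemma eq_tail_integral d1 (T1 : measurableType d1) d2 (T2 : measurableType d2)
    (R : realType) (mu1 : {measure set T1 -> \bar R})
    (mu2 : {measure set T2 -> \bar R}) (D1 : set T1) (D2 : set T2)
    (f : T1 -> \bar R) (g : T2 -> \bar R) (h : \bar R -> \bar R) :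
  measurable D1 -> measurable D2 ->
  measurable_fun setT f -> measurable_fun setT g -> measurable_fun setT h ->
  (forall x, D1 x -> 0 <= f x) -> (forall x, D2 x -> 0 <= g x) ->
  (forall y, 0 <= h y) ->
  mu1 D1 < +oo -> mu1 D1 = mu2 D2 ->
  (forall r : R, (0 < r)%R -> mu1 (D1 `&` [set x | r%:E < f x]) =
                              mu2 (D2 `&` [set x | r%:E < g x])) ->
  \int[mu1]_(x in D1) h (f x) = \int[mu2]_(x in D2) h (g x).
Proof.
move=> mD1 mD2 mf mg mh f0 g0 h0 D1oo D12 Hpos.
(* Negative levels cut off nothing, and level [0] is the increasing limit of the levels
   [n.+1%:R^-1]. *)
have H (r : R) : mu1 (D1 `&` [set x | r%:E < f x]) =
                 mu2 (D2 `&` [set x | r%:E < g x]).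
  have [/Hpos//|r0] := ltP 0%R r; have {r0}[r0|->] : (r < 0)%R \/ r = 0%R.
    by move: r0; rewrite le_eqVlt => /predU1P[|]; [right|left].
    have E (T : Type) (A : set T) (k : T -> \bar R) : (forall x, A x -> 0 <= k x) ->
        A `&` [set x | r%:E < k x] = A.
      move=> k0; apply/setIidPl => z Az /=; apply: lt_le_trans (k0 z Az).
      by rewrite lte_fin.
    by rewrite !E.
  have cv d (T : measurableType d) (mu : {measure set T -> \bar R}) (A : set T)
      (k : T -> \bar R) : measurable A -> measurable_fun setT k ->
      mu (A `&` [set x | n.+1%:R^-1%:E < k x]) @[n --> \oo] -->
      mu (A `&` [set x | 0%R%:E < k x]).
    move=> mA mk.
    have mS r' : measurable (A `&` [set x | r'%:E < k x]).
      apply: measurableI => //.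
      rewrite (_ : [set x | _] = setT `&` k @^-1` `]r'%:E, +oo[); last first.
        by rewrite setTI; apply/seteqP; split => z /=; rewrite in_itv/= andbT.
      by apply: mk => //; exact: emeasurable_itv.
    have -> : A `&` [set x | 0%R%:E < k x] =
        \bigcup_n (A `&` [set x | n.+1%:R^-1%:E < k x]).
      apply/seteqP; split => [z [Az /= kz]|z [n _ [Az /= kz]]]; last first.
        by split => //=; apply: lt_trans kz; rewrite lte_fin invr_gt0 ltr0n.
      have [e e0 ekz] : exists2 e : R, (0 < e)%R & e%:E < k z.
        move: kz; case: (k z) => [s| |]//.
          rewrite lte_fin => s0; exists (s / 2)%R; first by rewrite divr_gt0.
          by rewrite lte_fin ltr_pdivrMr// ltr_pMr// ltr1n.
        by exists 1%R => //; rewrite ltry.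
      exists (Num.truncn e^-1) => //; split => //=; apply: le_lt_trans ekz.
      rewrite lee_fin -[leRHS]invrK lef_pV2 ?posrE ?invr_gt0 ?ltr0n//.
      have ei0 : (0 <= e^-1)%R by rewrite invr_ge0 ltW.
      by have /andP[_ /ltW] := truncn_itv ei0.
    apply: nondecreasing_cvg_mu => //; first exact: bigcupT_measurable.
    move=> n m nm; apply/subsetPset => z [Az /= kz]; split => //=.
    apply: le_lt_trans kz; rewrite lee_fin lef_pV2 ?posrE ?ltr0n// ler_nat.
    exact: nm.
  have h1 := cvg_lim (@ereal_hausdorff R) (cv _ _ mu1 _ _ mD1 mf).
  have h2 := cvg_lim (@ereal_hausdorff R) (cv _ _ mu2 _ _ mD2 mg).
  rewrite -h1 -h2; congr (lim _).
  have E : (fun n => mu1 (D1 `&` [set x | n.+1%:R^-1%:E < f x])) =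
           (fun n => mu2 (D2 `&` [set x | n.+1%:R^-1%:E < g x])).
    by apply/funext => n; apply: Hpos; rewrite invr_gt0 ltr0n.
  by rewrite E.
pose m1 := pushforward (mrestr mu1 mD1) f.
pose m2 := pushforward (mrestr mu2 mD2) g.
have m12 A : measurable A -> m1 A = m2 A.
  move=> mA.
  (* The whole line is joined to the half-lines so that the exhausting sequence can be constant. *)
  pose G := @ErealGenOInfty.G R `|` [set setT].
  apply: (measure_unique G (fun=> setT)).
  - transitivity <<s @ErealGenOInfty.G R>>.
      exact: ErealGenOInfty.measurableE.
    apply/seteqP; split.
      by apply: sub_smallest2r; [exact: smallest_sigma_algebra|left].
    apply: smallest_sub; first exact: smallest_sigma_algebra.
    move=> B [GB|->]; first exact: sub_sigma_algebra.
    exact: (@measurableT _ (g_sigma_algebraType (@ErealGenOInfty.G R))).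
  - move=> B C [[r ->]|->] [[s ->]|->].
    + left; exists (Num.max r s).
      apply/seteqP; split => x /=; rewrite !in_itv/= !andbT EFin_max gt_max.
        by move=> [-> ->].
      by move=> /andP[].
    + by rewrite setIT; left; exists r.
    + by rewrite setTI; left; exists s.
    + by rewrite setTI; right.
  - by move=> i; right.
  - by rewrite bigcup_const//; exists 0%N.
  - move=> _ [[r ->]|->].
      have E (T : Type) (k : T -> \bar R) (D : set T) :
          k @^-1` `]r%:E, +oo[ `&` D = D `&` [set x | r%:E < k x].
        by rewrite setIC; congr (_ `&` _); apply/seteqP; split => x /=;
          rewrite in_itv/= andbT.
      change (mu1 (f @^-1` `]r%:E, +oo[ `&` D1) =
              mu2 (g @^-1` `]r%:E, +oo[ `&` D2)).
      by rewrite !E H.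
    change (mu1 (f @^-1` setT `&` D1) = mu2 (g @^-1` setT `&` D2)).
    by rewrite !preimage_setT !setTI.
  - move=> _; change (mu1 (f @^-1` setT `&` D1) < +oo).
    by rewrite preimage_setT setTI.
  - exact: mA.
have E d (T : measurableType d) (mu : {measure set T -> \bar R}) (D : set T)
    (mD : measurable D) (k : T -> \bar R) : measurable_fun setT k ->
    \int[mu]_(x in D) h (k x) = \int[pushforward (mrestr mu mD) k]_y h y.
  move=> mk; rewrite (ge0_integral_pushforward mk)//.
  have mhk : measurable_fun setT (h \o k) by exact: measurableT_comp.
  transitivity (\int[mrestr mu mD]_x (h \o k) x); last by [].
  rewrite [RHS](ge0_negligible_integral (N := ~` D)) //.
  - rewrite setTD setCK; apply/esym/eq_measure_integral => A mA AD.
    by rewrite /= /mrestr setIidl.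
  - exact: measurableC.
  - by move=> x _; exact: h0.
  - by rewrite /= /mrestr/= setICl measure0.
rewrite (E _ _ _ _ mD1 f mf) (E _ _ _ _ mD2 g mg).
by apply: eq_measure_integral => A mA _; exact: m12.
Qed.

Lemma ae_eq_measure d (T : measurableType d) (R : realType)
    (mu : {measure set T -> \bar R}) (A B : set T) :
  measurable A -> measurable B -> {ae mu, forall x, A x <-> B x} -> mu A = mu B.
Proof.
move=> mA mB AB; rewrite -[A]setIT -[B]setIT -!integral_indic//.
apply: ge0_ae_eq_integral => //.
- by apply/measurable_EFinP; exact: measurable_indic.
- by apply/measurable_EFinP; exact: measurable_indic.
apply: filterS AB => x AB _; congr EFin; rewrite !indicE.
by congr (_ : bool)%:R; apply/idP/idP; rewrite !inE => /AB.
Qed.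

(** The absolute value makes this test function nonnegative on the whole extended line, as
    [eq_tail_integral] demands. *)
Lemma measurable_expe_abse (R : realType) (k : nat) :
  measurable_fun setT (fun y : \bar R => `|y| ^+ k).
Proof.
elim: k => [|k IH]; first by under eq_fun do rewrite expe0; exact: measurable_cst.
under eq_fun do rewrite expeS.
by apply: emeasurable_funM => //; exact: abse_measurable.
Qed.

End integral_tools.

Lemma measurable_invr (R : realType) : measurable_fun setT (@GRing.inv R).
Proof.
rewrite (_ : @GRing.inv R = fun x => x * (x ^+ 2) `^ (-1)).
  apply: measurable_funM => //.
  have sq : measurable_fun setT (fun x : R => x ^+ 2) by exact: measurable_funX.
  exact: (measurableT_comp (@measurable_powR R (-1)) sq).
apply/funext => x; rewrite powR_inv1 ?sqr_ge0//.
have [->|x0] := eqVneq x 0; first by rewrite invr0 mul0r.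
by rewrite expr2 invfM mulrA divff// mul1r.
Qed.

Lemma measurable_bigmax d (T : measurableType d) (R : realType) (I : Type)
    (r : seq I) (F : I -> T -> R) :
  (forall i, measurable_fun setT (F i)) ->
  measurable_fun setT (fun w => \big[Num.max/0]_(i <- r) F i w).
Proof.
move=> mF; elim: r => [|i r IH].
  rewrite (_ : (fun w => _) = cst 0); first exact: measurable_cst.
  by apply/funext => w; rewrite big_nil.
rewrite (_ : (fun w => _) = F i \max (fun w => \big[Num.max/0]_(j <- r) F j w)).
  exact: measurable_maxr.
by apply/funext => w; rewrite big_cons.
Qed.

Section affine_change_of_variables.
Variable R : realType.
Local Open Scope ereal_scope.

Local Notation mu := (@lebesgue_measure R).

Let measurable_affine (a b : R) : measurable_fun setT (fun x : R => a * x + b)%R.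
Proof. by apply: measurable_funD => //; exact: measurable_funM. Qed.

Lemma lebesgue_measure_affine_preimage (a b : R) (A : set R) : a != 0%R ->
  measurable A ->
  `|a|%:E * mu ((fun x : R => a * x + b)%R @^-1` A) = mu A.
Proof.
move=> a0 mA.
have na0 : (0 < `|a|)%R by rewrite normr_gt0.
pose f (x : measurableTypeR R) : measurableTypeR R := (a * x + b)%R.
have mf : measurable_fun setT f by exact: measurable_affine.
pose m' : {measure set (measurableTypeR R) -> \bar R} :=
  mscale (NngNum (ltW na0))
    (measure_function_pushforward__canonical__measure_function_Measure mu mf).
suff : forall X, measurable X -> mu X = m' X.
  by move=> /(_ A mA) ->.
move=> X mX; apply: lebesgue_measure_unique => // _ [[u v]/= uv <-].
rewrite /m' /mscale/= /pushforward.
rewrite lebesgue_measure_itv/=.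
have [a_gt0|a_lt0|/eqP] := ltgtP a 0%R; last by rewrite (negbTE a0).
- rewrite (_ : f @^-1` _ = `[((v - b) / a)%R, ((u - b) / a)%R[%classic); last first.
    apply/seteqP; split => x /=; rewrite /f !in_itv/=.
      move=> /andP[h1 h2]; rewrite ler_ndivrMr// ltr_ndivlMr//; apply/andP.
      by split; [rewrite lerBrDr mulrC|rewrite ltrBlDr mulrC].
    rewrite ler_ndivrMr// ltr_ndivlMr// lerBrDr ltrBlDr.
    by rewrite ![(x * a)%R]mulrC => /andP[-> ->].
  rewrite lebesgue_measure_itv/= !lte_fin ltr_nM2r ?invr_lt0// ltrD2r.
  case: ifPn => _; last by rewrite mule0.
  by rewrite -!EFinD -EFinM ltr0_norm//; congr EFin; field.
- rewrite (_ : f @^-1` _ = `]((u - b) / a)%R, ((v - b) / a)%R]%classic); last first.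
    apply/seteqP; split => x /=; rewrite /f !in_itv/=.
      move=> /andP[h1 h2]; rewrite ltr_pdivrMr// ler_pdivlMr//; apply/andP.
      by split; [rewrite ltrBlDr mulrC|rewrite lerBrDr mulrC].
    rewrite ltr_pdivrMr// ler_pdivlMr// lerBrDr ltrBlDr.
    by rewrite ![(x * a)%R]mulrC => /andP[-> ->].
  rewrite lebesgue_measure_itv/= !lte_fin ltr_pM2r ?invr_gt0// ltrD2r.
  case: ifPn => _; last by rewrite mule0.
  by rewrite -!EFinD -EFinM gtr0_norm//; congr EFin; field.
Qed.

Lemma integral_affine (a b : R) (F : R -> \bar R) : a != 0%R ->
  measurable_fun setT F -> (forall x, 0 <= F x) ->
  \int[mu]_x F x = `|a|%:E * \int[mu]_x F (a * x + b)%R.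
Proof.
move=> a0 mF F0.
pose f (x : measurableTypeR R) : measurableTypeR R := (a * x + b)%R.
have mf : measurable_fun setT f by exact: measurable_affine.
transitivity (`|a|%:E * \int[pushforward mu f]_x F x); last first.
  by rewrite (ge0_integral_pushforward mf).
have na0 : (0 <= `|a|)%R by [].
rewrite -(ge0_integral_mscale _ _ (NngNum na0))//.
by apply: eq_measure_integral => A mA _; apply/esym; exact: lebesgue_measure_affine_preimage.
Qed.

Definition affine_map (al be e ga de f : R) (z : R * R) : R * R :=
  (al * z.1 + be * z.2 + e, ga * z.1 + de * z.2 + f)%R.

Lemma measurable_affine_map (al be e ga de f : R) :
  measurable_fun setT (affine_map al be e ga de f).
Proof.
apply: measurable_fun_pair; apply: measurable_funD => //;
  apply: measurable_funD; exact: measurable_funM.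
Qed.

Let fubini1 F mF F0 := @fubini_tonelli1 _ _ _ _ R mu mu F mF F0.
Let fubini2 F mF F0 := @fubini_tonelli2 _ _ _ _ R mu mu F mF F0.
Let fubini12 F mF F0 := @fubini_tonelli _ _ _ _ R mu mu F mF F0.

(** Gaussian elimination: for fixed [y] the first output replaces [x], and for fixed first output
    [u] the second output is affine in [y]. Each substitution is one-dimensional, between two uses
    of Tonelli. *)
Let integral_plane_affine1 (al be e ga de f : R) (F : R * R -> \bar R) :
  al != 0%R -> (al * de - be * ga != 0)%R ->
  measurable_fun setT F -> (forall z, 0 <= F z) ->
  \int[mu \x mu]_z F z =
  `|al * de - be * ga|%:E *
  \int[mu \x mu]_z F (affine_map al be e ga de f z).
Proof.
move=> al0 det0 mF F0.
have mFL : measurable_fun setT (F \o affine_map al be e ga de f).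
  by apply: measurableT_comp => //; exact: measurable_affine_map.
(* The second pivot: the determinant is [al * c], and [c] is the slope in [y] of the second output
   once [x] is eliminated. *)
pose c := (de - ga * be / al)%R.
have c0 : c != 0%R.
  apply: contra_neq det0 => c0.
  rewrite (_ : (al * de - be * ga = al * c)%R); last by rewrite /c; field.
  by rewrite c0 mulr0.
have -> : (al * de - be * ga = al * c)%R by rewrite /c; field.
rewrite normrM EFinM.
have FL0 z : 0 <= (F \o affine_map al be e ga de f) z by exact: F0.
rewrite [X in _ = _ * X](fubini2 mFL FL0) /fubini_G/=.
pose H (y u : R) := F (u, c * y + (ga * (u - e) / al + f))%R.
have mH : measurable_fun setT (fun z : R * R => H z.2 z.1).
  apply: measurableT_comp => //; apply: measurable_fun_pair => //.
  apply: measurable_funD; first exact: measurable_funM.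
  apply: measurable_funD => //; apply: measurable_funM => //.
  by apply: measurable_funM => //; apply: measurable_funB.
have E y : `|al|%:E * \int[mu]_x F (affine_map al be e ga de f (x, y)) =
    \int[mu]_u H y u.
  rewrite [RHS](@integral_affine al (be * y + e)%R)//; first last.
  - by move=> x; exact: F0.
  - have : measurable_fun setT ((fun z : R * R => H z.2 z.1) \o (fun u => (u, y))).
      by apply: measurableT_comp => //; exact: measurable_fun_pair.
    by [].
  congr (_ * _); apply: eq_integral => x _; rewrite /H /affine_map/=.
  congr (F (_, _)); first by rewrite addrA.
  by rewrite /c; field.
have -> : `|al|%:E * `|c|%:E * \int[mu]_y \int[mu]_x F (affine_map al be e ga de f (x, y))
  = `|c|%:E * \int[mu]_y \int[mu]_u H y u.
  rewrite [`|al|%:E * _]muleC -muleA; congr (_ * _).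
  rewrite -ge0_integralZl//; first by apply: eq_integral => y _; exact: E.
  - exact: (@measurable_fun_fubini_tonelli_G _ _ _ _ _ mu _ mFL FL0).
  - by move=> y _; apply: integral_ge0 => x _; exact: F0.
have H0 : forall z : R * R, 0 <= H z.2 z.1 by move=> z; exact: F0.
transitivity (`|c|%:E * \int[mu]_u \int[mu]_y H y u); last first.
  by congr (_ * _); exact: (fubini12 mH H0).
rewrite -ge0_integralZl//; first last.
- by move=> y _; apply: integral_ge0 => x _; exact: F0.
- exact: (@measurable_fun_fubini_tonelli_F _ _ _ _ _ mu _ mH H0).
rewrite (fubini1 mF F0); apply: eq_integral => u _.
rewrite /fubini_F/= [LHS](@integral_affine c (ga * (u - e) / al + f)%R)//.
have : measurable_fun setT (F \o (fun v => (u, v))).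
  by apply: measurableT_comp => //; exact: measurable_fun_pair.
by [].
Qed.

Lemma integral_plane_affine (al be e ga de f : R) (F : R * R -> \bar R) :
  (al * de - be * ga != 0)%R ->
  measurable_fun setT F -> (forall z, 0 <= F z) ->
  \int[mu \x mu]_z F z =
  `|al * de - be * ga|%:E *
  \int[mu \x mu]_z F (affine_map al be e ga de f z).
Proof.
move=> det0 mF F0.
have [al0|al0] := eqVneq al 0%R; last exact: integral_plane_affine1.
have be0 : be != 0%R.
  by apply: contra_neq det0 => be0; rewrite al0 be0; ring.
(* With a zero first pivot the two columns are exchanged; [be] is then nonzero, and Tonelli undoes
   the exchange of variables. *)
rewrite (@integral_plane_affine1 be al e de ga f)//; last first.
  have -> : (be * ga - al * de = - (al * de - be * ga))%R by ring.
  by rewrite oppr_eq0.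
congr (_ * _).
  by rewrite -normrN; congr (`|_|%:E); ring.
have mFL a1 a2 a3 a4 a5 a6 :
    measurable_fun setT (F \o affine_map a1 a2 a3 a4 a5 a6).
  by apply: measurableT_comp => //; exact: measurable_affine_map.
have FL0 a1 a2 a3 a4 a5 a6 z : 0 <= (F \o affine_map a1 a2 a3 a4 a5 a6) z.
  exact: F0.
rewrite (fubini1 (mFL _ _ _ _ _ _) (FL0 _ _ _ _ _ _)).
rewrite (fubini2 (mFL _ _ _ _ _ _) (FL0 _ _ _ _ _ _)).
apply: eq_integral => x _; apply: eq_integral => y _.
by rewrite /= /affine_map/=; congr (F (_, _)); ring.
Qed.

End affine_change_of_variables.

(** * Planar Gaussian laws *)

Section density.
Local Open Scope ereal_scope.
Context d (T : measurableType d) (R : realType).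
Variables mu nu : {measure set T -> \bar R}.
Variable rho : T -> R.
Hypothesis mrho : measurable_fun setT rho.
Hypothesis rho0 : forall x, (0 <= rho x)%R.
Hypothesis nuE : forall A, measurable A -> nu A = \int[mu]_(x in A) (rho x)%:E.

Import HBNNSimple.

(** Checked on indicators and carried over by monotone limits of simple functions, for arbitrary
    measures. *)
Lemma ge0_integral_density (F : T -> \bar R) :
  measurable_fun setT F -> (forall x, 0 <= F x) ->
  \int[nu]_x F x = \int[mu]_x (F x * (rho x)%:E).
Proof.
move=> mF F0; pose h := nnsfun_approx measurableT mF.
have mrho' : measurable_fun setT (EFin \o rho) by exact/measurable_EFinP.
have -> : \int[nu]_x F x = lim (\int[nu]_x (EFin \o h n) x @[n --> \oo]).
  have fE x : F x = lim ((EFin \o h n) x @[n --> \oo]).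
    by apply/esym/cvg_lim => //; exact: cvg_nnsfun_approx.
  under eq_integral => x _ do rewrite fE.
  apply: monotone_convergence => //.
  - by move=> n; apply/measurable_EFinP; exact/measurable_funP.
  - by move=> n x Ex //=; rewrite lee_fin.
  - by move=> x Ex a b ab; rewrite lee_fin; exact/lefP/nd_nnsfun_approx.
have -> : \int[mu]_x (F x * (rho x)%:E) =
    lim (\int[mu]_x ((EFin \o h n) x * (rho x)%:E) @[n --> \oo]).
  have fg x : F x * (rho x)%:E = lim (((EFin \o h n) x * (rho x)%:E) @[n --> \oo]).
    by apply/esym/cvg_lim => //; apply: cvgeZr => //; exact: cvg_nnsfun_approx.
  under eq_integral => x _ do rewrite fg.
  apply: monotone_convergence => [//| | |].
  - by move=> n; apply/emeasurable_funM => //; exact/measurable_EFinP.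
  - by move=> n x Ex /=; rewrite mule_ge0 ?lee_fin.
  - by move=> x Ex a b ab/=; rewrite lee_wpmul2r ?lee_fin//; exact/lefP/nd_nnsfun_approx.
suff suf n : \int[mu]_x ((EFin \o h n) x * (rho x)%:E) =
    \int[nu]_x (EFin \o h n) x.
  by under [in RHS]eq_fun do rewrite suf.
transitivity (\int[nu]_x
   (\sum_(y \in range (h n)) (y * \1_(h n @^-1` [set y]) x)%:E)); last first.
  by apply: eq_integral => t tE; rewrite /= fimfunE -fsumEFin.
have indich m r : measurable_fun setT (fun x => (r * \1_(h m @^-1` [set r]) x)%:E).
  by apply: (measurable_comp measurableT) => //; exact: measurable_funM.
rewrite ge0_integral_fsum//; last by move=> m y Ey; exact: nnfun_muleindic_ge0.
transitivity (\int[mu]_x (\sum_(y \in range (h n))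
    (y * \1_(h n @^-1` [set y]) x)%:E * (rho x)%:E)).
  under [RHS]eq_integral => x xE.
    rewrite -ge0_mule_fsuml => [|y]; last exact: nnfun_muleindic_ge0.
    rewrite fsumEFin // -(fimfunE _ x); over.
  by [].
rewrite ge0_integral_fsum//; last 2 first.
  - by move=> y; apply: emeasurable_funM.
  - by move=> m y Ey; apply: mule_ge0; [exact: nnfun_muleindic_ge0|rewrite lee_fin].
apply: eq_fsbigr => r rhn.
under [RHS]eq_integral do rewrite EFinM.
rewrite integralZl_indic_nnsfun => //.
under eq_integral do rewrite EFinM -muleA.
rewrite ge0_integralZl//.
- under eq_integral do rewrite muleC.
  rewrite (eq_integral ((EFin \o rho) \_ (h n @^-1` [set r]))); last first.
    by move=> x xE; rewrite epatch_indic.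
  by rewrite -integral_mkcond -nuE// integral_indic// setIT.
- by apply: emeasurable_funM => //; exact/measurable_EFinP.
- by move=> t Et; rewrite mule_ge0 ?lee_fin.
- by move: rhn; rewrite inE => -[t _ <-]; rewrite lee_fin.
Qed.

End density.

Section planar_gaussian_theory.
Variable R : realType.
Local Open Scope ereal_scope.
Local Notation mu := (@lebesgue_measure R).
Local Notation npdf s := (@normal_pdf R 0 s).

(* Locking keeps unification from comparing Gaussian laws by unfolding them. *)
Definition gaussian_plane_law :
    R -> probability (measurableTypeR R * measurableTypeR R)%type R :=
  locked (fun v => (normal_prob (0 : R) (Num.sqrt v) \x
    normal_prob 0 (Num.sqrt v) :
    probability (measurableTypeR R * measurableTypeR R)%type R)).

Local Notation pg := gaussian_plane_law.

Lemma gaussian_plane_lawE (v : R) (A : set (R * R)) :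
  gaussian_plane_law v A = planar_gaussian v A.
Proof. by rewrite /gaussian_plane_law -lock. Qed.

Lemma integral_gaussian_plane_fubini (v : R) (F : R * R -> \bar R) :
  measurable_fun setT F -> (forall z, 0 <= F z) ->
  \int[pg v]_z F z = \int[normal_prob 0 (Num.sqrt v)]_x
    \int[normal_prob 0 (Num.sqrt v)]_y F (x, y).
Proof.
move=> mF F0; rewrite /gaussian_plane_law -lock.
by rewrite (@fubini_tonelli1 _ _ _ _ _ (normal_prob 0 (Num.sqrt v))
  (normal_prob 0 (Num.sqrt v)) F mF F0).
Qed.

Lemma integral_normal_prob_density (s : R) (f : R -> \bar R) :
  measurable_fun setT f -> (forall x, 0 <= f x) ->
  \int[normal_prob 0 s]_x f x = \int[mu]_x (f x * (npdf s x)%:E).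
Proof.
move=> mf f0; apply: ge0_integral_density => //.
- exact: measurable_normal_pdf.
- by move=> x; exact: normal_pdf_ge0.
Qed.

Definition gaussian_density (v : R) (z : R * R) : R :=
  ((2 * pi * v)^-1 * expR (- (z.1 ^+ 2 + z.2 ^+ 2) / (2 * v)))%R.

Lemma gaussian_densityE (v : R) (z : R * R) : (0 < v)%R ->
  (npdf (Num.sqrt v) z.1 * npdf (Num.sqrt v) z.2)%R = gaussian_density v z.
Proof.
move=> v0; have sv : Num.sqrt v != 0%R by rewrite gt_eqF// sqrtr_gt0.
rewrite !normal_pdfE// /normal_fun /normal_peak sqr_sqrtr ?ltW//.
rewrite mulrACA -expRD /gaussian_density; congr (_ * expR _)%R.
  rewrite -invfM -expr2 sqr_sqrtr; last first.
    by rewrite mulrn_wge0// mulr_ge0 ?pi_ge0// ltW.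
  by congr (_^-1)%R; rewrite -mulr_natl; ring.
rewrite !subr0 -mulr_natl -mulrDl; congr (_ / _)%R; ring.
Qed.

Lemma gaussian_density_ge0 (v : R) z : (0 < v)%R -> (0 <= gaussian_density v z)%R.
Proof.
by move=> v0; rewrite mulr_ge0 ?expR_ge0// invr_ge0 !mulr_ge0 ?pi_ge0// ltW.
Qed.

Lemma measurable_gaussian_density (v : R) : measurable_fun setT (gaussian_density v).
Proof.
apply: measurable_funM => //; apply: measurableT_comp => //.
apply: measurable_funM => //; apply: measurableT_comp => //.
by apply: measurable_funD; apply: measurable_funX.
Qed.

Lemma integral_planar_gaussian (v : R) (F : R * R -> \bar R) : (0 < v)%R ->
  measurable_fun setT F -> (forall z, 0 <= F z) ->
  \int[pg v]_z F z = \int[mu \x mu]_z (F z * (gaussian_density v z)%:E).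
Proof.
move=> v0 mF F0.
have mFg : measurable_fun setT (fun z => F z * (gaussian_density v z)%:E).
  apply: emeasurable_funM => //.
  by apply/measurable_EFinP; exact: measurable_gaussian_density.
rewrite integral_gaussian_plane_fubini//.
rewrite (@fubini_tonelli1 _ _ _ _ _ mu mu _ mFg); last first.
  by move=> z; rewrite mule_ge0 ?lee_fin ?gaussian_density_ge0.
have mFx x : measurable_fun setT (fun y => F (x, y)).
  have : measurable_fun setT (F \o (fun y => (x, y))).
    by apply: measurableT_comp => //; exact: measurable_fun_pair.
  by [].
rewrite integral_normal_prob_density.
- apply: eq_integral => x _; rewrite /fubini_F integral_normal_prob_density//.
  rewrite -ge0_integralZr//.
  + apply: eq_integral => y _; rewrite -muleA; congr (_ * _).
    by rewrite -EFinM mulrC (@gaussian_densityE v (x, y)).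
  + apply: emeasurable_funM; first exact: mFx.
    by apply/measurable_EFinP; exact: measurable_normal_pdf.
  + by move=> y _; rewrite mule_ge0 ?lee_fin ?normal_pdf_ge0.
  + by rewrite lee_fin normal_pdf_ge0.
- exact: (@measurable_fun_fubini_tonelli_F _ _ _ _ _ (normal_prob 0 (Num.sqrt v))).
- by move=> x; apply: integral_ge0.
Qed.

(** Multiplication by the complex number [al + i be]: a rotation followed by a scaling with factor
    the square root of [al ^+ 2 + be ^+ 2]. *)
Definition similarity (al be : R) (z : R * R) : R * R :=
  (al * z.1 - be * z.2, be * z.1 + al * z.2)%R.

Lemma similarityE (al be : R) :
  similarity al be = affine_map al (- be) 0 be al 0.
Proof.
by apply/funext => z; rewrite /similarity /affine_map !addr0 mulNr.
Qed.

Lemma measurable_similarity al be : measurable_fun setT (similarity al be).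
Proof. by rewrite similarityE; exact: measurable_affine_map. Qed.

(** Rotation invariance and scaling in one statement: the Jacobian [al ^+ 2 + be ^+ 2] compensates
    the change of normalization of the density, and the exponent scales by the same factor. *)
Lemma integral_planar_gaussian_similarity (v al be : R) (F : R * R -> \bar R) :
  (0 < v)%R -> (0 < al ^+ 2 + be ^+ 2)%R ->
  measurable_fun setT F -> (forall z, 0 <= F z) ->
  \int[pg ((al ^+ 2 + be ^+ 2) * v)%R]_z F z =
  \int[pg v]_z F (similarity al be z).
Proof.
move=> v0 s0 mF F0; set s := (al ^+ 2 + be ^+ 2)%R in s0 *.
have detE : (al * al - - be * be = s)%R by rewrite /s; ring.
have mFL : measurable_fun setT (F \o similarity al be).
  by apply: measurableT_comp => //; exact: measurable_similarity.
have FL0 z : 0 <= (F \o similarity al be) z by exact: F0.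
rewrite (integral_planar_gaussian (mulr_gt0 s0 v0) mF F0).
rewrite (integral_planar_gaussian v0 mFL FL0).
have Fg0 w z : (0 < w)%R -> 0 <= F z * (gaussian_density w z)%:E.
  by move=> w0; rewrite mule_ge0 ?lee_fin ?gaussian_density_ge0.
rewrite (@integral_plane_affine _ al (- be) 0 be al 0); first last.
- by move=> z; apply: Fg0; exact: mulr_gt0.
- apply: emeasurable_funM => //.
  by apply/measurable_EFinP; exact: measurable_gaussian_density.
- by rewrite detE gt_eqF.
rewrite detE gtr0_norm// -ge0_integralZl//; last 3 first.
- apply: emeasurable_funM.
    by apply: measurableT_comp => //; exact: measurable_affine_map.
  apply/measurable_EFinP; apply: measurableT_comp.
    exact: measurable_gaussian_density.
  exact: measurable_affine_map.
- by move=> z _; apply: Fg0; exact: mulr_gt0.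
- by rewrite lee_fin ltW.
apply: eq_integral => z _; rewrite -similarityE muleCA; congr (_ * _).
rewrite -EFinM; congr EFin; rewrite /gaussian_density /similarity/= mulrA.
have pi0 : (pi != 0 :> R)%R by rewrite gt_eqF// pi_gt0.
congr (_ * expR _)%R.
  move: (pi) pi0 => p p0; field; by rewrite p0 !gt_eqF.
by rewrite /s; field; rewrite -/s !gt_eqF.
Qed.

End planar_gaussian_theory.

Section gaussian_exponential_moments.
Variable R : realType.
Local Open Scope ereal_scope.
Local Notation mu := (@lebesgue_measure R).
Local Notation pg := (@gaussian_plane_law R).

Definition dot (a z : R * R) : R := (a.1 * z.1 + a.2 * z.2)%R.

Lemma measurable_dot (a : R * R) : measurable_fun setT (dot a).
Proof. by apply: measurable_funD; exact: measurable_funM. Qed.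

(** The moment generating function of a chi-squared variable with one degree of freedom; only its
    threshold of finiteness at [1/2] is used. *)
Definition gauss_sq_mgf (th : R) : \bar R :=
  \int[pg 1%R]_z (expR (th * z.1 ^+ 2))%:E.

Lemma measurable_expR_sq (th : R) (f : R * R -> R) : measurable_fun setT f ->
  measurable_fun setT (fun z => (expR (th * f z ^+ 2))%:E).
Proof.
move=> mf; apply/measurable_EFinP; apply: measurableT_comp => //.
by apply: measurable_funM => //; exact: measurable_funX.
Qed.

Lemma integral_planar_gaussian_expR_dot_sq (v th : R) (a : R * R) : (0 < v)%R ->
  \int[pg v]_z (expR (th * dot a z ^+ 2))%:E =
  gauss_sq_mgf (th * v * (a.1 ^+ 2 + a.2 ^+ 2)).
Proof.
move=> v0.
have sc (w : R) (F : R * R -> \bar R) : (0 < w)%R -> measurable_fun setT F ->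
    (forall z, 0 <= F z) ->
    \int[pg w]_z F z = \int[pg 1%R]_z F (similarity (Num.sqrt w) 0 z).
  move=> w0 mF F0.
  have sw : (Num.sqrt w ^+ 2 + 0 ^+ 2 = w)%R.
    by rewrite expr0n addr0 sqr_sqrtr// ltW.
  rewrite -(@integral_planar_gaussian_similarity R 1 (Num.sqrt w) 0 F)//.
    by rewrite sw mulr1.
  by rewrite sw.
have mF : measurable_fun setT (fun z => (expR (th * dot a z ^+ 2))%:E).
  by apply: measurable_expR_sq; exact: measurable_dot.
have F0 z : 0 <= (expR (th * dot a z ^+ 2))%:E by rewrite lee_fin expR_ge0.
rewrite (sc _ _ v0 mF F0).
have [a0|a0] := eqVneq (a.1 ^+ 2 + a.2 ^+ 2)%R 0%R.
  have /andP[/eqP a1 /eqP a2] : (a.1 == 0)%R && (a.2 == 0)%R.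
    by move/eqP: a0; rewrite paddr_eq0 ?sqr_ge0// !sqrf_eq0.
  rewrite a0 /gauss_sq_mgf; apply: eq_integral => z _; congr (expR _)%:E.
  by rewrite /dot a1 a2; ring.
have a_gt0 : (0 < a.1 ^+ 2 + a.2 ^+ 2)%R.
  by rewrite lt_neqAle eq_sym a0/= addr_ge0 ?sqr_ge0.
(* [dot a z] is the real part of [z] times the conjugate of [a], that is, the first coordinate of a
   similarity; this reduces every direction to the first axis. *)
transitivity (\int[pg 1%R]_z
    (expR (th * v * (similarity a.1 (- a.2) z).1 ^+ 2))%:E).
  apply: eq_integral => z _; congr (expR _)%:E.
  rewrite /dot /similarity/= -[X in (_ = th * X * _)%R](sqr_sqrtr (ltW v0)).
  by ring.
pose G (z : R * R) := (expR (th * v * z.1 ^+ 2))%:E.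
have mG : measurable_fun setT G by exact: measurable_expR_sq.
have s0 : (0 < a.1 ^+ 2 + (- a.2) ^+ 2)%R by rewrite sqrrN.
have G0 z : 0 <= G z by rewrite lee_fin expR_ge0.
rewrite -(@integral_planar_gaussian_similarity R 1 a.1 (- a.2) G)//.
rewrite mulr1 sqrrN (sc _ _ a_gt0 mG G0).
apply: eq_integral => z _; rewrite /G; congr (expR _)%:E.
rewrite /similarity/= mul0r subr0 exprMn sqr_sqrtr ?ltW//; ring.
Qed.

Lemma integral_planar_gaussian_fst (v : R) (f : R -> \bar R) :
  measurable_fun setT f -> (forall x, 0 <= f x) ->
  \int[pg v]_z f z.1 = \int[normal_prob 0 (Num.sqrt v)]_x f x.
Proof.
move=> mf f0.
have mF : measurable_fun setT (fun z : R * R => f z.1) by exact: measurableT_comp.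
rewrite integral_gaussian_plane_fubini//.
apply: eq_integral => x _; rewrite /= integral_cst//.
by rewrite -[RHS]mule1; congr (_ * _); exact: probability_setT.
Qed.

Let gauss_sq_mgfE (th : R) :
  gauss_sq_mgf th = \int[mu]_x (normal_peak 1 * expR ((th - 2^-1) * x ^+ 2))%:E.
Proof.
rewrite /gauss_sq_mgf (@integral_planar_gaussian_fst 1 (fun x => (expR (th * x ^+ 2))%:E)).
- rewrite sqrtr1 integral_normal_prob_density.
  + apply: eq_integral => x _; rewrite -EFinM; congr EFin.
    rewrite normal_pdfE ?oner_neq0// /normal_fun mulrCA -expRD; congr (_ * expR _)%R.
    by rewrite subr0; field.
  + apply/measurable_EFinP; apply: measurableT_comp => //.
    by apply: measurable_funM => //; exact: measurable_funX.
  + by move=> x; rewrite lee_fin expR_ge0.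
- apply/measurable_EFinP; apply: measurableT_comp => //.
  by apply: measurable_funM => //; exact: measurable_funX.
- by move=> x; rewrite lee_fin expR_ge0.
Qed.

Lemma gauss_sq_mgf_lty (th : R) : (th < 2^-1)%R -> gauss_sq_mgf th < +oo.
Proof.
move=> th2; rewrite gauss_sq_mgfE.
have c0 : (0 < 1 - 2 * th)%R by lra.
(* Tilting by [expR (th * x ^+ 2)] gives, up to a constant, the centered normal density of variance
   [1 / (1 - 2 * th)]. *)
pose s : R := ((Num.sqrt (1 - 2 * th))^-1)%R.
have s0 : (s != 0)%R by rewrite invr_eq0 gt_eqF// sqrtr_gt0.
have p0 : (0 < normal_peak s)%R by exact: normal_peak_gt0.
have -> : \int[mu]_x (normal_peak 1 * expR ((th - 2^-1) * x ^+ 2))%:E =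
    \int[mu]_x ((normal_peak 1 / normal_peak s)%:E * (normal_pdf 0 s x)%:E).
  apply: eq_integral => x _; rewrite -EFinM; congr EFin; rewrite normal_pdfE//.
  rewrite -[RHS]/(normal_peak 1 / normal_peak s *
    (normal_peak s * normal_fun 0 s x))%R [RHS]mulrA divfK ?gt_eqF//; congr (_ * expR _)%R.
  rewrite /s exprVn sqr_sqrtr ?ltW// subr0.
  by field; rewrite gt_eqF.
rewrite ge0_integralZl//.
- by rewrite integral_normal_pdf mule1 ltry.
- by apply/measurable_EFinP; exact: measurable_normal_pdf.
- by move=> x _; rewrite lee_fin normal_pdf_ge0.
- by rewrite lee_fin divr_ge0// ?normal_peak_ge0.
Qed.

(** From the threshold on, the integrand is bounded below by a positive constant on a line of
    infinite measure. *)
Lemma gauss_sq_mgf_eqy (th : R) : (2^-1 <= th)%R -> gauss_sq_mgf th = +oo.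
Proof.
move=> th2; rewrite gauss_sq_mgfE; apply/eqP; rewrite -leye_eq.
have p0 : (0 < normal_peak (1 : R))%R by rewrite normal_peak_gt0// oner_neq0.
apply: (@le_trans _ _ (\int[mu]_(x in setT) (normal_peak 1)%:E)).
  rewrite integral_cst//= (_ : mu setT = +oo).
    by rewrite gt0_muley// lte_fin.
  by have := lebesgue_measure_itv (`]-oo, +oo[ : interval R); rewrite set_itvNyy/=.
apply: ge0_le_integral => //=.
- by move=> x _; rewrite lee_fin ltW.
- apply/measurable_EFinP; apply: measurable_funM => //; apply: measurableT_comp => //.
  by apply: measurable_funM => //; exact: measurable_funX.
- move=> x _; rewrite lee_fin; apply: ler_peMr; first exact: ltW.
  apply: (le_trans _ (expR_ge1Dx _)).
  by rewrite lerDl mulr_ge0 ?sqr_ge0// subr_ge0.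
Qed.

End gaussian_exponential_moments.

(** * Laws of Brownian increments *)

Section tuple_measure.
Local Open Scope ereal_scope.
Context d (T : measurableType d) (R : realType) (n : nat).

Lemma measurable_tuple_box (A : 'I_n -> set T) : (forall i, measurable (A i)) ->
  measurable [set y : n.-tuple T | forall i, A i (tnth y i)].
Proof.
move=> mA.
rewrite (_ : [set y : n.-tuple T | _] =
    \bigcap_(i in [set: 'I_n]) ((fun y : n.-tuple T => tnth y i) @^-1` A i)).
  apply: fin_bigcap_measurable => // i _; rewrite -[X in measurable X]setTI.
  exact: measurable_tnth.
by apply/seteqP; split => [y yA i _|y yA i]; exact: yA.
Qed.

(** Boxes are stable under intersection and generate the product sigma-algebra. *)
Lemma tuple_measure_unique (m1 m2 : {measure set (n.-tuple T) -> \bar R}) :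
  m1 setT < +oo ->
  (forall A : 'I_n -> set T, (forall i, measurable (A i)) ->
    m1 [set y | forall i, A i (tnth y i)] =
    m2 [set y | forall i, A i (tnth y i)]) ->
  forall B, measurable B -> m1 B = m2 B.
Proof.
move=> m1oo m12 B mB.
pose box (A : 'I_n -> set T) := [set y : n.-tuple T | forall i, A i (tnth y i)].
pose G := [set B | exists2 A : 'I_n -> set T, (forall i, measurable (A i)) & B = box A].
have boxT : box (fun=> setT) = setT by apply/seteqP; split.
apply: (measure_unique G (fun=> setT)).
- apply/seteqP; split.
    apply: smallest_sub; first exact: smallest_sigma_algebra.
    rewrite -bigcup_seq => _ [i _ [A mA <-]].
    apply: sub_sigma_algebra.
    exists (fun j => if j == i then A else setT).
      by move=> j; case: ifP.
    rewrite setTI; apply/seteqP; split => [y yA j|y yA].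
      by case: ifPn => // /eqP ->.
    by have := yA i; rewrite eqxx.
  apply: smallest_sub; first exact: sigma_algebra_measurable.
  by move=> _ [A mA ->]; exact: measurable_tuple_box.
- move=> _ _ [A mA ->] [A' mA' ->]; exists (fun i => A i `&` A' i).
    by move=> i; exact: measurableI.
  apply/seteqP; split => [y [yA yA'] i|y yAA'].
    by split; [exact: yA|exact: yA'].
  by split => i; case: (yAA' i).
- by move=> _; exists (fun=> setT); rewrite ?boxT.
- by rewrite bigcup_const//; exists 0%N.
- by move=> _ [A mA ->]; exact: m12.
- by [].
- exact: mB.
Qed.

End tuple_measure.

Section brownian_law.
Local Open Scope ereal_scope.
Context (R : realType).
Context d (Omega : measurableType d) (P : probability Omega R).
Variables (X : R -> Omega -> R * R) (x : R * R).
Hypothesis hX : planar_brownian_motion P X x.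
Context d' (Omega' : measurableType d') (P' : probability Omega' R).
Variables (X' : R -> Omega' -> R * R) (x' : R * R).
Hypothesis hX' : planar_brownian_motion P' X' x'.

Lemma measurable_increment d0 (T : measurableType d0) (Q : probability T R)
    (Y : R -> T -> R * R) (y : R * R) (s t : R) :
  planar_brownian_motion Q Y y -> (0 <= s)%R -> (0 <= t)%R ->
  measurable_fun setT (increment Y s t).
Proof.
move=> hY s0 t0; have ms := bm_measurable hY s0; have mt := bm_measurable hY t0.
apply: measurable_fun_pair.
  by apply: measurable_funB; exact: measurableT_comp.
by apply: measurable_funB; exact: measurableT_comp.
Qed.

(** Brownian scaling combined with a rotation, for finitely many increments and two motions that may
    live on different spaces. On boxes, independence reduces it to single Gaussian increments. *)
Lemma increments_same_law (n : nat) (al be : R) (t t' : nat -> R)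
    (B : set (n.-tuple (R * R))) :
  (0 < al ^+ 2 + be ^+ 2)%R ->
  (0 <= t 0%N)%R -> (0 <= t' 0%N)%R ->
  (forall i, (i < n)%N -> (t' i < t' i.+1)%R) ->
  (forall i, (i < n)%N ->
    (t i.+1 - t i = (al ^+ 2 + be ^+ 2) * (t' i.+1 - t' i))%R) ->
  measurable B ->
  P [set w | B [tuple increment X (t i) (t i.+1) w | i < n]] =
  P' [set w | B [tuple similarity al be (increment X' (t' i) (t' i.+1) w) | i < n]].
Proof.
move=> s0 t0 t'0 t'lt tt' mB.
have t'ge0 i : (i <= n)%N -> (0 <= t' i)%R.
  elim: i => // i IH ilen; apply: (le_trans (IH (ltnW ilen))).
  exact/ltW/t'lt.
have tlt i : (i < n)%N -> (t i < t i.+1)%R.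
  by move=> ilen; rewrite -subr_gt0 tt'// mulr_gt0// subr_gt0 t'lt.
have tge0 i : (i <= n)%N -> (0 <= t i)%R.
  elim: i => // i IH ilen; apply: (le_trans (IH (ltnW ilen))).
  exact/ltW/tlt.
pose Y (w : Omega) := [tuple increment X (t i) (t i.+1) w | i < n].
pose Y' (w : Omega') :=
  [tuple similarity al be (increment X' (t' i) (t' i.+1) w) | i < n].
have mY : measurable_fun setT Y.
  apply/measurable_fun_tnthP => i.
  rewrite (_ : _ \o _ = increment X (t i) (t i.+1)); last first.
    by apply/funext => w; rewrite /= tnth_mktuple.
  by apply: (measurable_increment hX); apply: tge0 => //; exact: ltnW.
have mY' : measurable_fun setT Y'.
  apply/measurable_fun_tnthP => i.
  rewrite (_ : _ \o _ = similarity al be \o increment X' (t' i) (t' i.+1)); last first.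
    by apply/funext => w; rewrite /= tnth_mktuple.
  apply: measurableT_comp; first exact: measurable_similarity.
  by apply: (measurable_increment hX'); apply: t'ge0 => //; exact: ltnW.
pose m := measure_function_pushforward__canonical__measure_function_Measure P mY.
pose m' := measure_function_pushforward__canonical__measure_function_Measure P' mY'.
apply: (@tuple_measure_unique _ _ _ _ m m' _ _ _ mB).
  by rewrite /m /= /pushforward preimage_setT probability_setT ltry.
move=> A mA; rewrite /m /m' /= /pushforward.
transitivity (P (\bigcap_(i in [set: 'I_n]) (increment X (t i) (t i.+1) @^-1` A i))).
  congr (P _); apply/seteqP; split => [w /= wA i _|w wA i]/=.
    by have := wA i; rewrite tnth_mktuple.
  by rewrite tnth_mktuple; exact: wA.
transitivity (P' (\bigcap_(i in [set: 'I_n])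
    (increment X' (t' i) (t' i.+1) @^-1` (similarity al be @^-1` A i)))); last first.
  congr (P' _); apply/seteqP; split => [w wA i|w /= wA i _]/=.
    by rewrite tnth_mktuple; exact: wA.
  by have := wA i; rewrite tnth_mktuple.
have mLA i : measurable (similarity al be @^-1` A i).
  by rewrite -[X in measurable X]setTI; exact: measurable_similarity.
rewrite (bm_independent hX)//; last by move=> i /tlt/ltW.
rewrite (bm_independent hX')//; last by move=> i /t'lt/ltW.
apply: eq_bigr => i _.
have dt : (0 < t' i.+1 - t' i)%R by rewrite subr_gt0 t'lt.
transitivity (gaussian_plane_law (t i.+1 - t i) (A i)).
  rewrite gaussian_plane_lawE; apply: (bm_gaussian hX) => //; last exact: tlt.
  by apply: tge0; exact: ltnW.
transitivity (gaussian_plane_law (t' i.+1 - t' i) (similarity al be @^-1` A i)); last first.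
  rewrite gaussian_plane_lawE; apply/esym; apply: (bm_gaussian hX') => //; last exact: t'lt.
  by apply: t'ge0; exact: ltnW.
rewrite tt'//.
have indicE w (D : set (R * R)) : measurable D ->
    gaussian_plane_law w D = \int[gaussian_plane_law w]_z (\1_D z)%:E.
  by move=> mD; rewrite integral_indic// setIT.
rewrite (indicE _ _ (mA i)) (indicE _ _ (mLA i)).
have mI : measurable_fun setT (fun z : R * R => (\1_(A i) z)%:E : \bar R).
  by apply/measurable_EFinP; exact: measurable_indic.
rewrite (integral_planar_gaussian_similarity dt s0 mI)//.
Qed.

End brownian_law.

Section dyadic_times.
Variable R : realType.

Definition dyadic (N j : nat) : R := j%:R / (2 ^ N)%:R.

Lemma dyadic0 N : dyadic N 0 = 0.
Proof. by rewrite /dyadic mul0r. Qed.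

Lemma dyadic_ge0 N j : 0 <= dyadic N j.
Proof. by rewrite divr_ge0. Qed.

Lemma dyadic_le1 N j : (j <= 2 ^ N)%N -> dyadic N j <= 1.
Proof.
by move=> jN; rewrite ler_pdivrMr ?mul1r ?ler_nat// ltr0n expn_gt0.
Qed.

Lemma dyadic1 N : dyadic N (2 ^ N) = 1.
Proof. by rewrite /dyadic divff// pnatr_eq0 expn_eq0. Qed.

Lemma dyadicS N j : dyadic N.+1 (2 * j) = dyadic N j.
Proof.
by rewrite /dyadic expnS !natrM -mulf_div divff ?mul1r// pnatr_eq0.
Qed.

Lemma dyadic_addn N M j : dyadic (M + N) (2 ^ M * j) = dyadic N j.
Proof. by elim: M => [|M IH]; rewrite ?mul1n// expnS -mulnA addSn dyadicS. Qed.

Lemma dyadic_step N j : dyadic N j.+1 - dyadic N j = (2 ^ N)%:R^-1.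
Proof. by rewrite /dyadic -mulrBl -natrB// subSnn mul1r. Qed.

Lemma lt_dyadicS N j : dyadic N j < dyadic N j.+1.
Proof. by rewrite -subr_gt0 dyadic_step invr_gt0 ltr0n expn_gt0. Qed.

End dyadic_times.
Arguments dyadic {R} N j.

Section brownian_dyadic_law.
Local Open Scope ereal_scope.
Context (R : realType).
Context d (Omega : measurableType d) (P : probability Omega R).
Variables (X : R -> Omega -> R * R) (x : R * R).
Hypothesis hX : planar_brownian_motion P X x.
Context d' (Omega' : measurableType d') (P' : probability Omega' R).
Variables (X' : R -> Omega' -> R * R) (x' : R * R).
Hypothesis hX' : planar_brownian_motion P' X' x'.

Lemma measurable_increment_event d0 (T : measurableType d0)
    (Q : probability T R) (Y : R -> T -> R * R) (y : R * R) (t : R)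
    (C : set (R * R)) (f : R * R -> R * R) (N : nat) :
  planar_brownian_motion Q Y y -> (0 <= t)%R -> measurable C ->
  measurable_fun setT f ->
  measurable [set w | forall j, (j <= 2 ^ N)%N ->
    C (f (increment Y 0 (t * dyadic N j) w))].
Proof.
move=> hY t0 mC mf.
rewrite (_ : [set _ | _] = \bigcap_(j in [set j | (j <= 2 ^ N)%N])
    ((f \o increment Y 0 (t * dyadic N j)) @^-1` C)); last by [].

apply: bigcap_measurableType => j _; rewrite -[X in measurable X]setTI.
apply: measurableT_comp => //.
by apply: (measurable_increment hY) => //; rewrite mulr_ge0// dyadic_ge0.
Qed.

Let dyadic_level_law (N : nat) (al be : R) (C : set (R * R)) :
  (0 < al ^+ 2 + be ^+ 2)%R -> measurable C ->
  P [set w | forall j, (j <= 2 ^ N)%N ->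
    C (increment X 0 ((al ^+ 2 + be ^+ 2) * dyadic N j) w)] =
  P' [set w | forall j, (j <= 2 ^ N)%N ->
    C (similarity al be (increment X' 0 (dyadic N j) w))].
Proof.
move=> s0 mC; set s := (al ^+ 2 + be ^+ 2)%R.
pose n := (2 ^ N)%N.
(* Positions at grid times are partial sums of increments, so an event on positions is an event on
   the tuple of increments. *)
pose psum (j : nat) (y : n.-tuple (R * R)) := (\sum_(i < n | (i < j)%N) tnth y i)%R.
have mpsum j : measurable_fun setT (psum j).
  rewrite (_ : psum j = fun y => (\sum_(i < n) (if (i < j)%N then (tnth y i).1 else 0),
      \sum_(i < n) (if (i < j)%N then (tnth y i).2 else 0))%R); last first.
    apply/funext => y; rewrite /psum -!big_mkcond /=.
    rewrite -(@big_morph _ _ fst 0%R +%R 0%R +%R)//.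
    rewrite -(@big_morph _ _ snd 0%R +%R 0%R +%R)//.
    by rewrite -surjective_pairing.
  apply: measurable_fun_pair; apply: measurable_sum => i; case: (i < j)%N => //.
  - by apply: measurableT_comp => //; exact: measurable_tnth.
  - by apply: measurableT_comp => //; exact: measurable_tnth.
pose B := [set y : n.-tuple (R * R) | forall j, (j <= n)%N -> C (psum j y)].
have mB : measurable B.
  rewrite (_ : B = \bigcap_(j in [set j | (j <= n)%N]) (psum j @^-1` C)); last by [].
  apply: bigcap_measurableType => j _; rewrite -[X in measurable X]setTI.
  exact: mpsum.
have psumE (V : zmodType) (g : nat -> V) j : (j <= n)%N ->
    (\sum_(i < n | (i < j)%N) (g i.+1 - g i) = g j - g 0%N)%R.
  move=> jn; rewrite -(big_mkord (fun i => (i < j)%N) (fun i => g i.+1 - g i)%R).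
  rewrite (big_cat_nat (leq0n j) jn)/=.
  have -> : (\sum_(j <= i < n | (i < j)%N) (g i.+1 - g i) = 0)%R.
    rewrite big_nat_cond big1// => i /andP[/andP[ji _] ij].
    by move: ij; rewrite ltnNge ji.
  rewrite addr0 -telescope_sumr// big_nat_cond [RHS]big_nat_cond.
  by apply: eq_bigl => i /=; case: (i < j)%N; rewrite ?andbT ?andbF.
have := @increments_same_law _ _ _ _ _ _ hX _ _ _ _ _ hX' n al be
  (fun i => s * dyadic N i)%R (dyadic N) B s0.
rewrite !dyadic0 mulr0 => /(_ (lexx _) (lexx _)) H.
transitivity (P [set w | B [tuple increment X (s * dyadic N i)
    (s * dyadic N i.+1) w | i < n]]).
  congr (P _); apply/seteqP; split => w wC j jn; have := wC j jn;
    rewrite /psum; under eq_bigr do rewrite tnth_mktuple;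
    by rewrite (psumE _ (fun i => X (s * dyadic N i) w))// dyadic0 mulr0.
rewrite H//; last 2 first.
- by move=> i _; exact: lt_dyadicS.
- by move=> i _; rewrite mulrBr.
congr (P' _); apply/seteqP; split => w wC j jn; have := wC j jn;
  rewrite /psum; under eq_bigr do rewrite tnth_mktuple.
- rewrite -(@big_morph _ _ (similarity al be) 0%R +%R 0%R +%R); first last.
  + by rewrite /similarity/= !mulr0 subr0 addr0.
  + by move=> [a b] [c e]; rewrite /similarity/=; congr pair => /=; ring.
  by rewrite (psumE _ (fun i => X' (dyadic N i) w))// dyadic0.
- rewrite -(@big_morph _ _ (similarity al be) 0%R +%R 0%R +%R); first last.
  + by rewrite /similarity/= !mulr0 subr0 addr0.
  + by move=> [a b] [c e]; rewrite /similarity/=; congr pair => /=; ring.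
  by rewrite (psumE _ (fun i => X' (dyadic N i) w))// dyadic0.
Qed.

(** The events of successive dyadic levels are nested, since each grid contains the previous one, so
    continuity from above passes the finite-level identity to all dyadic times at once. *)
Lemma brownian_dyadic_law (al be : R) (C : set (R * R)) :
  (0 < al ^+ 2 + be ^+ 2)%R -> measurable C ->
  P [set w | forall N j, (j <= 2 ^ N)%N ->
    C (increment X 0 ((al ^+ 2 + be ^+ 2) * dyadic N j) w)] =
  P' [set w | forall N j, (j <= 2 ^ N)%N ->
    C (similarity al be (increment X' 0 (dyadic N j) w))].
Proof.
move=> s0 mC; set s := (al ^+ 2 + be ^+ 2)%R.
pose E N := [set w | forall j, (j <= 2 ^ N)%N -> C (increment X 0 (s * dyadic N j) w)].
pose E' N := [set w | forall j, (j <= 2 ^ N)%N ->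
  C (similarity al be (increment X' 0 (dyadic N j) w))].
have mE N : measurable (E N).
  by apply: (measurable_increment_event N hX (f := id)) => //; exact: ltW.
have mE' N : measurable (E' N).
  have := measurable_increment_event N hX' (ler01 : (0 <= 1 :> R)%R) mC (measurable_similarity al be).
  rewrite (_ : [set _ | _] = E' N)//; apply/seteqP; split => w wC j jn;
    by have := wC j jn; rewrite mul1r.
have dE : nonincreasing_seq E.
  apply/nonincreasing_seqP => N; apply/subsetPset => w wE j jN.
  by have := wE (2 * j)%N; rewrite dyadicS; apply; rewrite expnS leq_mul2l jN orbT.
have dE' : nonincreasing_seq E'.
  apply/nonincreasing_seqP => N; apply/subsetPset => w wE j jN.
  by have := wE (2 * j)%N; rewrite dyadicS; apply; rewrite expnS leq_mul2l jN orbT.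
transitivity (P (\bigcap_N E N)).
  by congr (P _); apply/seteqP; split => [w wC N _ j|w wC N j]; [exact: wC|exact: (wC N I)].
transitivity (P' (\bigcap_N E' N)); last first.
  by congr (P' _); apply/seteqP; split => [w wC N j|w wC N _ j]; [exact: (wC N I)|exact: wC].
have c1 : P (E N) @[N --> \oo] --> P (\bigcap_N E N).
  apply: nonincreasing_cvg_mu => //.
  - by rewrite (le_lt_trans (probability_le1 _ (mE _)))// ltry.
  - exact: bigcapT_measurable.
have c2 : P' (E' N) @[N --> \oo] --> P' (\bigcap_N E' N).
  apply: nonincreasing_cvg_mu => //.
  - by rewrite (le_lt_trans (probability_le1 _ (mE' _)))// ltry.
  - exact: bigcapT_measurable.
have h1 := cvg_lim (@ereal_hausdorff R) c1.
have h2 := cvg_lim (@ereal_hausdorff R) c2.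
have EE : (fun N => P (E N)) = (fun N => P' (E' N)).
  by apply/funext => N; exact: dyadic_level_law.
by rewrite -h1 -h2 EE.
Qed.

End brownian_dyadic_law.

(** * Suprema of Brownian paths over dyadic times *)

Section chaining.
Variable R : realType.
Variable b : R -> R * R.

Let step (l j : nat) : R * R := b (dyadic l j.+1) - b (dyadic l j).

(** Halving the index moves from a level to the coarser one at the cost of at most one step, so the
    distance to level [n0] is bounded by one step per intermediate level. *)
Lemma dyadic_chain (A : nat -> R) (n0 N j : nat) :
  (forall l j, (j < 2 ^ l)%N -> `|step l j| <= A l) ->
  (n0 <= N)%N -> (j <= 2 ^ N)%N ->
  exists2 i, (i <= 2 ^ n0)%N &
    `|b (dyadic N j) - b (dyadic n0 i)| <= \sum_(n0.+1 <= l < N.+1) A l.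
Proof.
move=> stepA n0N; elim: N n0N j => [|N IH] n0N j jN.
  have -> : n0 = 0%N by apply/eqP; rewrite -leqn0.
  by exists j => //; rewrite subrr normr0 big_geq.
move: n0N; rewrite leq_eqVlt => /predU1P[->|n0N].
  by exists j => //; rewrite subrr normr0 big_geq.
have A0 l : 0 <= A l.
  by apply: le_trans (stepA l 0%N _); rewrite ?expn_gt0.
have jN2 : (j./2 <= 2 ^ N)%N.
  by rewrite -(doubleK (2 ^ N)%N) half_leq// -mul2n -expnS.
have [i i0 hi] := IH n0N _ jN2.
exists i => //; rewrite big_nat_recr//=.
have H : `|b (dyadic N.+1 j) - b (dyadic N j./2)| <= A N.+1.
  rewrite -(@dyadicS _ N) mul2n -{1}(odd_double_half j).
  case: (boolP (odd j)) => oj; last by rewrite add0n subrr normr0.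
  by apply: stepA; move: jN; rewrite -{1}(odd_double_half j) oj add1n.
rewrite -(subrK (b (dyadic N j./2)) (b (dyadic N.+1 j))) -addrA.
by apply: (le_trans (ler_normD _ _)); rewrite [leRHS]addrC lerD.
Qed.

Let ln4_le3 : ln (4 : R) <= 3.
Proof.
have -> : (4 : R) = 1 + 3 by ring.
by apply: le_ln1Dx; lra.
Qed.

(** The ratio [32 / 25] is twice the square of [4 / 5]: the growth left over when steps are only
    asked to decay like powers of [4 / 5]. The constant [11] exceeds [3 / (7 / 25)], as Bernoulli's
    inequality requires. *)
Let linear_le_geometric (l : nat) : 3 * l%:R <= 11 * (32 / 25) ^+ l :> R.
Proof.
have H : 1 + l%:R * (7 / 25) <= (32 / 25 : R) ^+ l.
  elim: l => [|l IH]; first by rewrite expr0 mul0r addr0.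
  rewrite exprS -natr1.
  have l0 : 0 <= l%:R :> R by [].
  by nra.
by have l0 : 0 <= l%:R :> R by []; nra.
Qed.

(** After taking logarithms, the linear term coming from [4 ^+ l] is absorbed into a geometric one.
    The decay weakens from powers of [1 / sqrt 2] to powers of [4 / 5], which is still summable over
    the levels. *)
Lemma step_bound (k : R) (l j : nat) : 1 <= k ->
  expR (2 ^+ l / 4 * `|step l j| ^+ 2) <= k * 4 ^+ l ->
  `|step l j| <= 2 * (4 / 5) ^+ l * Num.sqrt (ln k + 11).
Proof.
move=> k1 H.
have k0 : 0 < k by lra.
have lk0 : 0 <= ln k by exact: ln_ge0.
have e2 : 0 < (2 : R) ^+ l by rewrite exprn_gt0.
have H1 : 2 ^+ l / 4 * `|step l j| ^+ 2 <= ln k + 3 * l%:R.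
  rewrite -[leLHS]expRK; apply: (@le_trans _ _ (ln (k * 4 ^+ l))).
    by rewrite ler_ln// posrE ?expR_gt0// mulr_gt0// exprn_gt0.
  rewrite lnM ?posrE ?exprn_gt0// lnXn// lerD2l -[ln 4 *+ l]mulr_natr.
  by rewrite ler_wpM2r.
have s1 : 1 <= (32 / 25 : R) ^+ l by rewrite exprn_ege1//; lra.
have H2 : ln k + 3 * l%:R <= (ln k + 11) * (32 / 25) ^+ l.
  by have := linear_le_geometric l; nra.
have H3 : `|step l j| ^+ 2 <= (2 * (4 / 5) ^+ l * Num.sqrt (ln k + 11)) ^+ 2.
  rewrite [leRHS]exprMn sqr_sqrtr; last by lra.
  rewrite [(2 * _) ^+ 2]exprMn -exprM mulnC exprM (_ : (4 / 5) ^+ 2 = (32 / 25) / 2 :> R); last by field.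
  rewrite [(_ / 2) ^+ l]exprMn exprVn.
  rewrite (_ : _ * _ = (((ln k + 11) * (32 / 25) ^+ l)) / (2 ^+ l / 4)); last first.
    by field; rewrite gt_eqF.
  rewrite ler_pdivlMr; last by rewrite divr_gt0.
  by rewrite mulrC; lra.
by rewrite -(@ler_pXn2r _ 2)// nnegrE// !mulr_ge0 ?exprn_ge0.
Qed.

Let geometric_tail (n0 N : nat) : (n0 <= N)%N ->
  \sum_(n0.+1 <= l < N.+1) (4 / 5) ^+ l <= 4 * (4 / 5) ^+ n0 :> R.
Proof.
move=> n0N; suff : \sum_(n0.+1 <= l < N.+1) (4 / 5) ^+ l =
    4 * (4 / 5) ^+ n0 - 4 * (4 / 5) ^+ N :> R.
  have : 0 <= (4 / 5) ^+ N :> R by rewrite exprn_ge0//; lra.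
  by lra.
elim: N n0N => [|N IH].
  by rewrite leqn0 => /eqP ->; rewrite big_geq// subrr.
rewrite leq_eqVlt => /predU1P[->|n0N]; first by rewrite big_geq// subrr.
by rewrite big_nat_recr//= IH// exprS; field.
Qed.

(* The exponential bounds say that [k] dominates the weighted sum, over all
   dyadic increments, of exponentials of their squares; that sum has finite
   expectation for Brownian paths. *)
Lemma dyadic_modulus (k : R) (n0 N j : nat) : 1 <= k ->
  (forall l i, (i < 2 ^ l)%N ->
    expR (2 ^+ l / 4 * `|b (dyadic l i.+1) - b (dyadic l i)| ^+ 2) <= k * 4 ^+ l) ->
  (n0 <= N)%N -> (j <= 2 ^ N)%N ->
  exists2 i, (i <= 2 ^ n0)%N &
    `|b (dyadic N j) - b (dyadic n0 i)| <=
      8 * (4 / 5) ^+ n0 * Num.sqrt (ln k + 11).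
Proof.
move=> k1 H n0N jN.
have [i i0 hi] := @dyadic_chain (fun l => 2 * (4 / 5) ^+ l * Num.sqrt (ln k + 11))
  _ _ _ (fun l i il => step_bound k1 (H l i il)) n0N jN.
exists i => //; apply: (le_trans hi).
rewrite -mulr_suml ler_wpM2r ?sqrtr_ge0// -mulr_sumr.
by have := geometric_tail n0N; lra.
Qed.

End chaining.

(** * Exponential moments of Brownian increments *)

Section brownian_moments.
Local Open Scope ereal_scope.
Context (R : realType).
Context d (Omega : measurableType d) (P : probability Omega R).
Variables (X : R -> Omega -> R * R) (x : R * R).
Hypothesis hX : planar_brownian_motion P X x.
Local Notation pg := (@gaussian_plane_law R).
Local Notation plane := (measurableTypeR R * measurableTypeR R)%type.

Lemma integral_increment (s t : R) (F : R * R -> \bar R) :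
  (0 <= s)%R -> (s < t)%R -> measurable_fun setT F -> (forall z, 0 <= F z) ->
  \int[P]_w F (increment X s t w) = \int[pg (t - s)%R]_z F z.
Proof.
move=> s0 st mF F0.
have mI : measurable_fun setT (increment X s t).
  by apply: (measurable_increment hX) => //; rewrite ltW// (le_lt_trans s0).
have mI' : measurable_fun setT
    (increment X s t : Omega -> plane).
  exact: mI.
pose m : {measure set plane -> \bar R} :=
  measure_function_pushforward__canonical__measure_function_Measure P mI'.
transitivity (\int[m]_z F z).
  by rewrite (ge0_integral_pushforward mI').
apply: eq_measure_integral => A mA _; rewrite /m/= /pushforward.
by rewrite gaussian_plane_lawE -(bm_gaussian hX s0 st mA).
Qed.

Lemma integral_increment_expR_dot_sq (s t th : R) (a : R * R) :
  (0 <= s)%R -> (s < t)%R ->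
  \int[P]_w (expR (th * dot a (increment X s t w) ^+ 2))%:E =
  gauss_sq_mgf (th * (t - s) * (a.1 ^+ 2 + a.2 ^+ 2)).
Proof.
move=> s0 st.
rewrite (integral_increment (F := fun z => (expR (th * dot a z ^+ 2))%:E))//.
- by rewrite integral_planar_gaussian_expR_dot_sq// subr_gt0.
- by apply: measurable_expR_sq; exact: measurable_dot.
Qed.

(** The pair of increments has the product law, since the two measures agree on rectangles; Tonelli
    then factors the integral. *)
Lemma integral_two_increments (r s t : R) (F G : R * R -> \bar R) :
  (0 <= r)%R -> (r < s)%R -> (s < t)%R ->
  measurable_fun setT F -> (forall z, 0 <= F z) ->
  measurable_fun setT G -> (forall z, 0 <= G z) ->
  \int[P]_w (F (increment X r s w) * G (increment X s t w)) =
  (\int[P]_w F (increment X r s w)) * \int[P]_w G (increment X s t w).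
Proof.
move=> r0 rs st mF F0 mG G0.
have s0 : (0 <= s)%R by rewrite (le_trans r0)// ltW.
have t0 : (0 <= t)%R by rewrite (le_trans s0)// ltW.
pose Y (w : Omega) : plane * plane := (increment X r s w, increment X s t w).
have mY : measurable_fun setT Y.
  by apply: measurable_fun_pair; exact: (measurable_increment hX).
pose H (z : plane * plane) := F z.1 * G z.2.
have mH : measurable_fun setT H by apply: emeasurable_funM; exact: measurableT_comp.
have H0 z : 0 <= H z by rewrite mule_ge0.
transitivity (\int[pushforward P Y]_z H z).
  by rewrite (ge0_integral_pushforward mY).
pose g1 := pg (s - r)%R; pose g2 := pg (t - s)%R.
pose m' := measure_function_pushforward__canonical__measure_function_Measure P mY.
have law A : measurable A -> (g1 \x g2) A = m' A.
  move=> mA; apply: product_measure_unique => // A1 A2 mA1 mA2.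
  rewrite /m' /= /pushforward.
  pose A_ (i : 'I_2) := if i == ord0 then A1 else A2.
  pose t_ (i : nat) := nth 0%R [:: r; s; t] i.
  transitivity (P (\bigcap_(i in [set: 'I_2])
      (increment X (t_ i) (t_ i.+1) @^-1` A_ i))).
    congr (P _); apply/seteqP; split => [w [h1 h2] i _|w h].
      by case: i => [[|[|//]]] i2.
    by split; [exact: (h ord0 I)|exact: (h ord_max I)].
  rewrite (bm_independent hX)//; last 2 first.
  - by case=> [|[|//]] _; rewrite /t_/= ltW.
  - by case=> [[|[|//]]] i2; rewrite /A_.
  rewrite big_ord_recl big_ord1 /=; congr (_ * _).
    by rewrite /g1 gaussian_plane_lawE; exact: (bm_gaussian hX).
  by rewrite /g2 gaussian_plane_lawE; exact: (bm_gaussian hX).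
transitivity (\int[g1 \x g2]_z H z).
  by apply: eq_measure_integral => A mA _; apply/esym/law.
rewrite (@fubini_tonelli1 _ _ _ _ _ g1 g2 H mH H0).
rewrite (integral_increment r0 rs mF F0) (integral_increment s0 st mG G0).
rewrite -ge0_integralZr//.
- by apply: eq_integral => z _; rewrite /fubini_F /H/= ge0_integralZl.
- exact: integral_ge0.
Qed.

(* Cauchy-Schwarz replaces the square of a sum of independent increments by a
   sum of squares, each normalized by its time length; since the total length
   is at most [1], no constant is lost. *)
Lemma two_increments_exp_moment (r s t th : R) (a c : R * R) :
  (0 <= r)%R -> (r <= s)%R -> (s <= t)%R -> (t <= 1)%R -> (0 <= th)%R ->
  (th * (a.1 ^+ 2 + a.2 ^+ 2) < 2^-1)%R -> (th * (c.1 ^+ 2 + c.2 ^+ 2) < 2^-1)%R ->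
  \int[P]_w (expR (th * (dot a (increment X r s w) +
                         dot c (increment X s t w)) ^+ 2))%:E < +oo.
Proof.
move=> r0 rs st t1 th0 tha thc.
have s0 : (0 <= s)%R by exact: le_trans rs.
have dot0 b u w : dot b (increment X u u w) = 0%R.
  by rewrite /increment subrr /dot/= !mulr0 addr0.
have shrink u v (b : R * R) : (0 <= u)%R -> (u < v)%R -> (v <= 1)%R ->
    (th * (b.1 ^+ 2 + b.2 ^+ 2) < 2^-1)%R ->
    gauss_sq_mgf (th * (v - u) * (b.1 ^+ 2 + b.2 ^+ 2)) < +oo.
  move=> u0 uv v1 hb; apply: gauss_sq_mgf_lty; apply: le_lt_trans hb.
  rewrite mulrAC ler_piMr//; last by lra.
  by rewrite mulr_ge0// addr_ge0// sqr_ge0.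
move: rs; rewrite le_eqVlt => /predU1P[rs|rs].
  subst s; move: st; rewrite le_eqVlt => /predU1P[<-|st].
    under eq_integral do rewrite !dot0 addr0 expr0n mulr0 expR0.
    rewrite integral_cst// mul1e.
    by rewrite (le_lt_trans (probability_le1 P measurableT))// ltry.
  under eq_integral do rewrite dot0 add0r.
  by rewrite integral_increment_expR_dot_sq//; exact: shrink.
move: st; rewrite le_eqVlt => /predU1P[st|st].
  subst t; under eq_integral do rewrite dot0 addr0.
  by rewrite integral_increment_expR_dot_sq//; exact: shrink.
have d1 : (0 < s - r)%R by rewrite subr_gt0.
have d2 : (0 < t - s)%R by rewrite subr_gt0.
pose F (z : R * R) := (expR (th / (s - r) * dot a z ^+ 2))%:E : \bar R.
pose G (z : R * R) := (expR (th / (t - s) * dot c z ^+ 2))%:E : \bar R.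
have mF : measurable_fun setT F by apply: measurable_expR_sq; exact: measurable_dot.
have mG : measurable_fun setT G by apply: measurable_expR_sq; exact: measurable_dot.
have F0 z : 0 <= F z by rewrite lee_fin expR_ge0.
have G0 z : 0 <= G z by rewrite lee_fin expR_ge0.
have t0 : (0 <= t)%R by exact: le_trans (ltW st).
have m1 : measurable_fun setT (increment X r s) by exact: (measurable_increment hX).
have m2 : measurable_fun setT (increment X s t) by exact: (measurable_increment hX).
apply: (@le_lt_trans _ _
    (\int[P]_w (F (increment X r s w) * G (increment X s t w)))).
  apply: ge0_le_integral => //.
  - apply/measurable_EFinP; apply: measurableT_comp => //.
    apply: measurable_funM => //; apply: measurable_funX; apply: measurable_funD.
      exact: (measurableT_comp (measurable_dot a) m1).
    exact: (measurableT_comp (measurable_dot c) m2).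
  - apply: emeasurable_funM.
      exact: (measurableT_comp mF m1).
    exact: (measurableT_comp mG m2).
  - move=> w _; rewrite /F /G -EFinM -expRD lee_fin ler_expR.
    set p := dot a _; set q := dot c _.
    pose a' := (p / (s - r))%R; pose c' := (q / (t - s))%R.
    have -> : p = ((s - r) * a')%R by rewrite /a'; field; rewrite gt_eqF.
    have -> : q = ((t - s) * c')%R by rewrite /c'; field; rewrite gt_eqF.
    have -> : (th / (s - r) * ((s - r) * a') ^+ 2 + th / (t - s) * ((t - s) * c') ^+ 2 =
        th * ((s - r) * a' ^+ 2 + (t - s) * c' ^+ 2))%R.
      by field; rewrite !gt_eqF.
    apply: ler_wpM2l => //.
    have le1 : (s - r + (t - s) <= 1)%R by lra.
    (* This term and the next add up exactly to the gap in the inequality; the second is nonnegative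
       because the total time is at most [1]. *)
    have : (0 <= (s - r) * (t - s) * (a' - c') ^+ 2)%R.
      by rewrite mulr_ge0 ?sqr_ge0// mulr_ge0// ltW.
    have : (0 <= (1 - (s - r + (t - s))) * ((s - r) * a' ^+ 2 + (t - s) * c' ^+ 2))%R.
      rewrite mulr_ge0//; first by rewrite subr_ge0.
      by rewrite addr_ge0// mulr_ge0 ?sqr_ge0// ltW.
    move: (s - r)%R (t - s)%R => u v h1 h2.
    by rewrite -subr_ge0; apply: le_trans (addr_ge0 h1 h2) _;
      rewrite le_eqVlt; apply/orP; left; apply/eqP; ring.
rewrite integral_two_increments//.
have E1 : \int[P]_w F (increment X r s w) < +oo.
  rewrite integral_increment_expR_dot_sq//; apply: gauss_sq_mgf_lty.
  by rewrite divfK ?gt_eqF.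
have E2 : \int[P]_w G (increment X s t w) < +oo.
  rewrite integral_increment_expR_dot_sq//; apply: gauss_sq_mgf_lty.
  by rewrite divfK ?gt_eqF.
apply: lte_mul_pinfty => //; first exact: integral_ge0.
by rewrite ge0_fin_numE//; exact: integral_ge0.
Qed.

End brownian_moments.

Section dyadic_sup.
Variable R : realType.

(* Dyadic times keep the supremum measurable for every path, continuous or not. *)
Definition dyadic_sup (b : R -> R * R) (v : R * R) : \bar R :=
  ereal_sup [set y | exists N j, (j <= 2 ^ N)%N /\
    y = (dot v (b (dyadic N j)))%:E].

Lemma dyadic_sup_ge b v N j : (j <= 2 ^ N)%N ->
  ((dot v (b (dyadic N j)))%:E <= dyadic_sup b v)%E.
Proof. by move=> jN; apply: ereal_sup_ubound; exists N, j. Qed.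

Lemma dyadic_sup_leP b v (c : \bar R) :
  (dyadic_sup b v <= c)%E <->
  forall N j, (j <= 2 ^ N)%N -> ((dot v (b (dyadic N j)))%:E <= c)%E.
Proof.
split=> [h N j jN|h]; first by apply: le_trans h; exact: dyadic_sup_ge.
by apply: ub_ereal_sup => _ [N [j [jN ->]]]; exact: h.
Qed.

Lemma dotB (v z z' : R * R) : dot v (z - z') = dot v z - dot v z'.
Proof. by rewrite /dot/=; ring. Qed.

Lemma dot_le_norm (v z : R * R) : dot v z <= (`|v.1| + `|v.2|) * `|z|.
Proof.
have [h1 h2] : `|z.1| <= `|z| /\ `|z.2| <= `|z|.
  by rewrite !prod_normE/= !le_max !lexx orbT.
rewrite /dot mulrDl; apply: lerD.
  by apply: (le_trans (ler_norm _)); rewrite normrM ler_wpM2l.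
by apply: (le_trans (ler_norm _)); rewrite normrM ler_wpM2l.
Qed.

Definition chain_radius (k : R) (n : nat) : R :=
  8 * (4 / 5) ^+ n * Num.sqrt (ln k + 11).

Definition step_dominated (b : R -> R * R) (k : R) := forall l i, (i < 2 ^ l)%N ->
  expR (2 ^+ l / 4 * `|b (dyadic l i.+1) - b (dyadic l i)| ^+ 2) <= k * 4 ^+ l.

(** The index maximizes [dot v] over the grid of level [n]. Finer times are within [chain_radius] of
    that grid, and coarser times belong to it. *)
Lemma dyadic_sup_le_grid (b : R -> R * R) (v : R * R) (k : R) (n : nat) :
  1 <= k -> step_dominated b k ->
  exists i : 'I_(2 ^ n).+1, (dyadic_sup b v <=
    (dot v (b (dyadic n i)) + (`|v.1| + `|v.2|) * chain_radius k n)%:E)%E.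
Proof.
move=> k1 H.
pose f (i : 'I_(2 ^ n).+1) := dot v (b (dyadic n i)).
have [i _ himax] := @Order.TotalTheory.arg_maxP _ _ 'I_(2 ^ n).+1 ord0 predT f isT.
have r0 : 0 <= chain_radius k n.
  by rewrite !mulr_ge0 ?exprn_ge0 ?sqrtr_ge0.
exists i; apply/dyadic_sup_leP => N j jN; rewrite lee_fin.
have V0 : 0 <= `|v.1| + `|v.2| by rewrite addr_ge0.
have [nN|Nn] := leqP n N.
  have [i' i'n hi'] := dyadic_modulus k1 H nN jN.
  rewrite -(subrK (dot v (b (dyadic n i'))) (dot v (b (dyadic N j)))) addrC.
  apply: lerD; first exact: (himax (Ordinal (i'n : (i' < (2 ^ n).+1)%N)) isT).
  by rewrite -dotB; apply: (le_trans (dot_le_norm _ _)); rewrite ler_wpM2l.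
have jn : (2 ^ (n - N) * j < (2 ^ n).+1)%N.
  by rewrite ltnS -{2}(subnK (ltnW Nn)) expnD leq_mul2l jN orbT.
have := himax (Ordinal jn) isT; rewrite /f/=.
rewrite -{1}(subnK (ltnW Nn)) dyadic_addn => h.
by rewrite (le_trans h)// lerDl mulr_ge0.
Qed.

(** The first term suffices when [c <= e * a], the second one otherwise. *)
Lemma expR_sq_sum_le (a c e : R) : 0 < e -> 0 <= a -> 0 <= c ->
  expR (a + c) <= expR ((1 + e) * a) + expR ((1 + e^-1) * c).
Proof.
move=> e0 a0 c0; have [h|h] := leP c (e * a).
  apply: (@le_trans _ _ (expR ((1 + e) * a))); last by rewrite lerDl expR_ge0.
  by rewrite ler_expR; lra.
apply: (@le_trans _ _ (expR ((1 + e^-1) * c))); last by rewrite lerDr expR_ge0.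
rewrite ler_expR mulrDl mul1r addrC lerD2l.
by rewrite ler_pdivlMl// ltW.
Qed.

(** This does the work of a Gaussian concentration inequality. The main term keeps the exponent up
    to the factor [(1 + e) ^+ 2] and runs over all choices of grid points, so that it dominates the
    maximizing one. The chaining error contributes only linearly in [k], hence stays integrable. *)
Lemma expR_sup_bound (b : R -> R * R) (v : 'I_3 -> R * R) (s : 'I_3 -> R)
    (k lam e : R) (n : nat) :
  1 <= k -> step_dominated b k -> 0 <= lam -> 0 < e ->
  (forall m, 0 <= s m) -> (forall m, (s m)%:E = dyadic_sup b (v m)) ->
  lam * (1 + e^-1) ^+ 2 * (\sum_m (`|(v m).1| + `|(v m).2|)) ^+ 2 *
    (64 * (16 / 25) ^+ n) <= 1 ->
  expR (lam * (\sum_m s m) ^+ 2) <=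
  \sum_(f : {ffun 'I_3 -> 'I_(2 ^ n).+1})
    expR (lam * (1 + e) ^+ 2 * (\sum_m dot (v m) (b (dyadic n (f m)))) ^+ 2) +
  expR 11 * k.
Proof.
move=> k1 H lam0 e0 s0 sE small.
have /choice[g hg] : forall m, exists i : 'I_(2 ^ n).+1, s m <=
    dot (v m) (b (dyadic n i)) + (`|(v m).1| + `|(v m).2|) * chain_radius k n.
  move=> m; have [i hi] := dyadic_sup_le_grid (v m) n k1 H.
  by exists i; rewrite -lee_fin sE.
pose f := [ffun m => g m].
set V := \sum_m (`|(v m).1| + `|(v m).2|).
set Z := \sum_m s m.
pose Y := \sum_m dot (v m) (b (dyadic n (f m))).
pose r := chain_radius k n.
have lk : 0 <= ln k by exact: ln_ge0.
have r0 : 0 <= r by rewrite !mulr_ge0 ?exprn_ge0 ?sqrtr_ge0.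
have r2 : r ^+ 2 = 64 * (16 / 25) ^+ n * (ln k + 11).
  rewrite /r /chain_radius exprMn sqr_sqrtr; last by lra.
  congr (_ * _); rewrite exprMn -exprM mulnC exprM.
  by congr (_ * _ ^+ _); field.
have Z0 : 0 <= Z by apply: sumr_ge0.
have ZY : Z <= Y + V * r.
  rewrite /Z /Y /V mulr_suml -big_split/=; apply: ler_sum => m _.
  by rewrite ffunE; exact: hg.
(* Young's inequality with a small parameter [e] on the main term and the large factor [1 + e^-1] on
   the chaining error. *)
have Z2 : Z ^+ 2 <= (1 + e) * Y ^+ 2 + (1 + e^-1) * (V * r) ^+ 2.
  have h1 : Z ^+ 2 <= (Y + V * r) ^+ 2.
    by rewrite ler_pXn2r// nnegrE//; exact: le_trans ZY.
  apply: (le_trans h1).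
  have : 0 <= e^-1 * (e * Y - V * r) ^+ 2 by rewrite mulr_ge0 ?sqr_ge0 ?invr_ge0 ?ltW.
  move: (V * r) => c.
  have -> : e^-1 * (e * Y - c) ^+ 2 = e * Y ^+ 2 - 2 * Y * c + e^-1 * c ^+ 2.
    by field; rewrite gt_eqF.
  move=> h2; rewrite -subr_ge0; apply: le_trans h2 _.
  by rewrite le_eqVlt; apply/orP; left; apply/eqP; ring.
apply: (@le_trans _ _ (expR (lam * ((1 + e) * Y ^+ 2) + lam * ((1 + e^-1) * (V * r) ^+ 2)))).
  by rewrite ler_expR -mulrDr ler_wpM2l.
have e1 : 0 < 1 + e by lra.
have e2 : 0 < 1 + e^-1 by rewrite ltr_wpDr// invr_ge0 ltW.
apply: (le_trans (expR_sq_sum_le e0 _ _)).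
- by rewrite mulr_ge0// mulr_ge0 ?sqr_ge0 ?ltW.
- by rewrite mulr_ge0// mulr_ge0 ?sqr_ge0 ?ltW.
apply: lerD.
  rewrite (bigD1 f)//= -[leLHS]addr0; apply: lerD; last first.
    by apply: sumr_ge0 => ? _; exact: expR_ge0.
  by rewrite ler_expR le_eqVlt; apply/orP; left; apply/eqP; rewrite -/Y; ring.
(* The smallness hypothesis makes the coefficient of [ln k + 11] at most [1], so the exponential of
   the error is at most [expR 11 * k]. *)
rewrite -[X in _ <= _ * X](@lnK _ k) ?posrE; last by lra.
rewrite -expRD ler_expR [11 + _]addrC exprMn r2.
have lk11 : 0 <= ln k + 11 by lra.
have := ler_wpM2r lk11 small; rewrite mul1r; apply: le_trans.
by rewrite le_eqVlt; apply/orP; left; apply/eqP; rewrite -/V; ring.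
Qed.

End dyadic_sup.

(** * The random constant that controls all dyadic increments *)

Section brownian_sup.
Local Open Scope ereal_scope.
Context (R : realType).
Context d (Omega : measurableType d) (P : probability Omega R).
Variables (X : R -> Omega -> R * R) (x : R * R).
Hypothesis hX : planar_brownian_motion P X x.

Definition path (w : Omega) (q : R) : R * R := increment X 0 q w.

Lemma pathB w q q' : (path w q' - path w q)%R = increment X q q' w.
Proof. by rewrite /path /increment opprB addrA subrK. Qed.

Lemma path0 w : path w 0 = 0%R.
Proof. by rewrite /path /increment subrr. Qed.

Lemma measurable_path q : (0 <= q)%R -> measurable_fun setT (path ^~ q).
Proof. by move=> q0; exact: (measurable_increment hX). Qed.

Let fst_dot (z : R * R) : z.1 = dot (1, 0)%R z.
Proof. by rewrite /dot/= mul1r mul0r addr0. Qed.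

Let snd_dot (z : R * R) : z.2 = dot (0, 1)%R z.
Proof. by rewrite /dot/= mul1r mul0r add0r. Qed.

(** The norm is the larger absolute coordinate, so the two exponentials together dominate the
    exponential of the squared norm. *)
Let ksum_term (l i : nat) (w : Omega) : \bar R :=
  (expR (2 ^+ l / 4 * dot (1, 0) (increment X (dyadic l i) (dyadic l i.+1) w) ^+ 2))%:E +
  (expR (2 ^+ l / 4 * dot (0, 1) (increment X (dyadic l i) (dyadic l i.+1) w) ^+ 2))%:E.

(** The random constant [k] of the chaining argument. Level [l] has [2 ^ l] increments with a common
    mean, so the weight [4 ^+ l] leaves a summable [2 ^- l]. *)
Definition chain_sum (w : Omega) : \bar R :=
  \sum_(0 <= l <oo) ((4 ^+ l)^-1%:E * \sum_(i < 2 ^ l) ksum_term l i w).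

Let measurable_inc l i :
  measurable_fun setT (increment X (dyadic l i) (dyadic l i.+1)).
Proof. by apply: (measurable_increment hX); exact: dyadic_ge0. Qed.

Let measurable_expR_inc th a l i : measurable_fun setT
  (fun w => (expR (th * dot a (increment X (dyadic l i) (dyadic l i.+1) w) ^+ 2))%:E).
Proof.
apply/measurable_EFinP; apply: measurableT_comp => //.
apply: measurable_funM => //; apply: measurable_funX.
by apply: (measurableT_comp (measurable_dot a)); exact: measurable_inc.
Qed.

Let measurable_ksum_term l i : measurable_fun setT (ksum_term l i).
Proof. by apply: emeasurable_funD; exact: measurable_expR_inc. Qed.

Let ksum_term_ge0 l i w : 0 <= ksum_term l i w.
Proof. by rewrite adde_ge0// lee_fin expR_ge0. Qed.

Let measurable_ksum_level l : measurable_fun setT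
  (fun w => (4 ^+ l)^-1%:E * \sum_(i < 2 ^ l) ksum_term l i w).
Proof.
by apply: emeasurable_funM => //; apply: emeasurable_sum => i.
Qed.

Let ksum_level_ge0 l w : 0 <= (4 ^+ l)^-1%:E * \sum_(i < 2 ^ l) ksum_term l i w.
Proof.
by rewrite mule_ge0 ?sume_ge0// lee_fin invr_ge0 exprn_ge0.
Qed.

Lemma measurable_chain_sum : measurable_fun setT chain_sum.
Proof.
by apply: (@ge0_emeasurable_sum _ _ _ _ _ xpredT) => // l w _ _; exact: ksum_level_ge0.
Qed.

Lemma chain_sum_ge0 w : 0 <= chain_sum w.
Proof. by apply: nneseries_ge0 => l _ _; exact: ksum_level_ge0. Qed.

Lemma integral_chain_sum_lty : \int[P]_w chain_sum w < +oo.
Proof.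
rewrite integral_nneseries//.
pose c := gauss_sq_mgf (4^-1 : R).
have c_ge0 : 0 <= c by apply: integral_ge0 => z _; rewrite lee_fin expR_ge0.
have c_lty : c < +oo by apply: gauss_sq_mgf_lty; lra.
have cE : c = (fine c)%:E by rewrite fineK// ge0_fin_numE.
have fc0 : (0 <= fine c)%R by exact: fine_ge0.
(* The exponent [2 ^+ l / 4] times the variance [2 ^- l] is [1/4] at every level, safely below the
   threshold [1/2]. *)
have inc a l i : (a.1 ^+ 2 + a.2 ^+ 2 = 1)%R ->
    \int[P]_w (expR (2 ^+ l / 4 *
      dot a (increment X (dyadic l i) (dyadic l i.+1) w) ^+ 2))%:E = c.
  move=> a1; rewrite (integral_increment_expR_dot_sq hX _ _ (dyadic_ge0 R l i) (lt_dyadicS R l i)).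
  rewrite a1 mulr1 dyadic_step natrX; congr gauss_sq_mgf.
  by field; rewrite gt_eqF// exprn_gt0.
have term l i : \int[P]_w ksum_term l i w = (2 * fine c)%:E.
  rewrite ge0_integralD//.
  rewrite !inc ?expr0n ?expr1n ?addr0 ?add0r//.
  by rewrite cE -EFinD; congr EFin; rewrite mulrDl mul1r.
have level l : \int[P]_w ((4 ^+ l)^-1%:E * \sum_(i < 2 ^ l) ksum_term l i w) =
    (4 * fine c / (2 ^ l.+1)%:R)%:E.
  rewrite ge0_integralZl//; first last.
  - by move=> w _; apply: sume_ge0.
  - by apply: emeasurable_sum => i.
  rewrite ge0_integral_sum//.
  rewrite (eq_bigr (fun=> (2 * fine c)%:E)); last by move=> i _; exact: term.
  rewrite sumEFin -EFinM; congr EFin.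
  rewrite sumr_const card_ord -[(_ *+ (2 ^ l)%N)%R]mulr_natr !natrX exprS.
  have -> : (4 ^+ l = 2 ^+ l * 2 ^+ l :> R)%R.
    by rewrite -exprMn; congr (_ ^+ _)%R; ring.
  have : (2 ^+ l != 0 :> R)%R by rewrite gt_eqF// exprn_gt0.
  by move: (2 ^+ l)%R => p p0; field.
under eq_eseriesr do rewrite level.
have := @epsilon_trick0 R (4 * fine c)%R xpredT.
by move=> /(_ (mulr_ge0 _ fc0)) h; apply: (le_lt_trans (h _)) => //; rewrite ltry.
Qed.

(** Each exponential enters the sum with weight [(4 ^+ l)^-1], so it is at most [4 ^+ l] times the
    total. The added [1] supplies the bound [1 <= k] that chaining needs. *)
Lemma chain_sum_step_dominated w : chain_sum w < +oo ->
  step_dominated (path w) (1 + fine (chain_sum w)).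
Proof.
move=> Kfin l i il; rewrite pathB.
have KE : chain_sum w = (fine (chain_sum w))%:E.
  by rewrite fineK// ge0_fin_numE// chain_sum_ge0.
set Y := increment X _ _ w.
suff : (expR (2 ^+ l / 4 * `|Y| ^+ 2) <= fine (chain_sum w) * 4 ^+ l)%R.
  by move=> h; apply: (le_trans h); rewrite ler_wpM2r ?exprn_ge0// lerDr.
rewrite -ler_pdivrMr ?exprn_gt0// -lee_fin -KE.
apply: (@le_trans _ _ ((4 ^+ l)^-1%:E * \sum_(i < 2 ^ l) ksum_term l i w)).
  rewrite mulrC EFinM; apply: lee_wpmul2l; first by rewrite lee_fin invr_ge0 exprn_ge0.
  rewrite (bigD1 (Ordinal il))//=.
  apply: (@le_trans _ _ (ksum_term l i w)); last first.
    by rewrite leeDl//; apply: sume_ge0.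
  rewrite /ksum_term -/Y -fst_dot -snd_dot -EFinD lee_fin prod_normE.
  rewrite /Num.max; case: ifP => _.
    by rewrite real_normK ?num_real// lerDr expR_ge0.
  by rewrite real_normK ?num_real// lerDl expR_ge0.
rewrite /chain_sum (nneseriesD1 (n := l))//.
by rewrite leeDl//; apply: nneseries_ge0 => ? _ _; exact: ksum_level_ge0.
Qed.

End brownian_sup.

Definition sqnorm (R : realType) (v : R * R) : R := v.1 ^+ 2 + v.2 ^+ 2.

Section brownian_sup_moments.
Local Open Scope ereal_scope.
Context (R : realType).
Context d (Omega : measurableType d) (P : probability Omega R).
Variables (X : R -> Omega -> R * R) (x : R * R).
Hypothesis hX : planar_brownian_motion P X x.

Definition path_sup (v : R * R) (w : Omega) : \bar R := dyadic_sup (path X w) v.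

(** Infinite suprema are sent to [0]; they occur only where [chain_sum] is infinite, which is a null
    set. *)
Definition rpath_sup (v : R * R) (w : Omega) : R := fine (path_sup v w).

Lemma measurable_path_sup v : measurable_fun setT (path_sup v).
Proof.
move=> mT; apply: (measurability _ (ErealGenOInfty.measurableE R)) => //.
move=> _ [_ [r ->] <-]; rewrite setTI.
rewrite (_ : _ @^-1` _ = \bigcup_N \bigcup_(j in [set j | (j <= 2 ^ N)%N])
    [set w | (r < dot v (path X w (dyadic N j)))%R]).
  apply: bigcup_measurable => N _; apply: bigcup_measurable => j _.
  have mf : measurable_fun setT (fun w => dot v (path X w (dyadic N j))).
    apply: (measurableT_comp (measurable_dot v)).
    by apply: (measurable_path hX); exact: dyadic_ge0.
  rewrite (_ : [set w | _] = setT `&`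
      (fun w => dot v (path X w (dyadic N j))) @^-1` `]r, +oo[); last first.
    by rewrite setTI; apply/seteqP; split => w /=; rewrite in_itv/= andbT.
  exact: mf.
apply/seteqP; split => [w/=|w [N _ [j jN /= h]]].
  rewrite in_itv/= andbT => h; apply: contrapT => H; move: h; apply/negP.
  rewrite -leNgt; apply/dyadic_sup_leP => N j jN; rewrite lee_fin leNgt.
  by apply/negP => h; apply: H; exists N => //; exists j.
rewrite /= in_itv/= andbT; apply: lt_le_trans (dyadic_sup_ge _ v jN).
by rewrite lte_fin.
Qed.

Lemma path_sup_ge0 v w : 0 <= path_sup v w.
Proof.
have := @dyadic_sup_ge _ (path X w) v 0 0 isT.
by rewrite dyadic0 path0 /dot/= !mulr0 addr0.
Qed.

Lemma measurable_rpath_sup v : measurable_fun setT (rpath_sup v).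
Proof. exact: (measurableT_comp _ (measurable_path_sup v)). Qed.

Lemma rpath_sup_ge0 v w : (0 <= rpath_sup v w)%R.
Proof. by apply: fine_ge0; exact: path_sup_ge0. Qed.

Lemma path_sup_lty v w : chain_sum X w < +oo -> path_sup v w < +oo.
Proof.
move=> Kfin.
have k1 : (1 <= 1 + fine (chain_sum X w))%R.
  by rewrite lerDl fine_ge0// chain_sum_ge0.
have [i hi] := dyadic_sup_le_grid v 0 k1 (chain_sum_step_dominated Kfin).
by apply: le_lt_trans hi _; rewrite ltry.
Qed.

Lemma rpath_supE v w : chain_sum X w < +oo -> (rpath_sup v w)%:E = path_sup v w.
Proof.
by move=> K; rewrite fineK// ge0_fin_numE ?path_sup_ge0// path_sup_lty.
Qed.

Lemma chain_sum_ae_lty : {ae P, forall w, chain_sum X w < +oo}.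
Proof.
have mK := measurable_chain_sum hX.
have iK : P.-integrable setT (chain_sum X).
  apply/integrableP; split=> //.
  under eq_integral do rewrite gee0_abs ?chain_sum_ge0//.
  exact: (integral_chain_sum_lty hX).
have := integrable_ae measurableT iK; apply: filterS => w /(_ I).
by rewrite ge0_fin_numE// chain_sum_ge0.
Qed.

Lemma rpath_sup_ge v w N j : chain_sum X w < +oo -> (j <= 2 ^ N)%N ->
  (dot v (path X w (dyadic N j)) <= rpath_sup v w)%R.
Proof. by move=> K jN; rewrite -lee_fin rpath_supE//; exact: dyadic_sup_ge. Qed.

Let sorted_three_exp_moment (v1 v2 v3 : R * R) (q1 q2 q3 th : R) :
  (v1 + v2 + v3 = 0)%R -> (0 <= q1)%R -> (q1 <= q2)%R -> (q2 <= q3)%R -> (q3 <= 1)%R ->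
  (0 <= th)%R -> (th * sqnorm v1 < 2^-1)%R -> (th * sqnorm v3 < 2^-1)%R ->
  \int[P]_w (expR (th * (dot v1 (path X w q1) + dot v2 (path X w q2) +
                         dot v3 (path X w q3)) ^+ 2))%:E < +oo.
Proof.
move=> v0 q10 q12 q23 q31 th0 h1 h3.
have h1' : (th * ((- v1).1 ^+ 2 + (- v1).2 ^+ 2) < 2^-1)%R by rewrite /= !sqrrN.
have := two_increments_exp_moment hX q10 q12 q23 q31 th0 h1' h3.
rewrite (_ : \int[P]_w _ = \int[P]_w (expR (th * (dot v1 (path X w q1) +
    dot v2 (path X w q2) + dot v3 (path X w q3)) ^+ 2))%:E); first by [].
apply: eq_integral => w _; congr (expR (_ * _ ^+ 2))%:E.
rewrite -!pathB.
(* Eliminating the middle vector leaves [- v1] on the first increment and [v3] on the second. *)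
have -> : v2 = (- v1 - v3)%R.
  by move/eqP: v0; rewrite addrAC addr_eq0 => /eqP h; rewrite -[v2]opprK -h opprD.
by rewrite /dot/=; ring.
Qed.

(* Since the [v m] sum to zero, for sorted times the sum telescopes into two
   independent increments. *)
Lemma three_point_exp_moment (v : 'I_3 -> R * R) (q : 'I_3 -> R) (th : R) :
  (\sum_m v m = 0)%R -> (forall m, 0 <= q m <= 1)%R -> (0 <= th)%R ->
  (forall m, th * sqnorm (v m) < 2^-1)%R ->
  \int[P]_w (expR (th * (\sum_m dot (v m) (path X w (q m))) ^+ 2))%:E < +oo.
Proof.
move=> sv q01 th0 hv.
pose i0 : 'I_3 := ord0; pose i1 : 'I_3 := lift ord0 ord0.
pose i2 : 'I_3 := lift ord0 (lift ord0 ord0).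
have sum3 (V : nmodType) (F : 'I_3 -> V) : (\sum_m F m = F i0 + F i1 + F i2)%R.
  by rewrite !big_ord_recl big_ord0 addr0 addrA.
have v0 : (v i0 + v i1 + v i2 = 0)%R by rewrite -sum3.
have [[a0 b0] [a1 b1] [a2 b2]] : [/\ (0 <= q i0 /\ q i0 <= 1)%R,
    (0 <= q i1 /\ q i1 <= 1)%R & (0 <= q i2 /\ q i2 <= 1)%R].
  by split; apply/andP.
under eq_integral do rewrite sum3.
have perm (a b c : 'I_3) : (v a + v b + v c = 0)%R ->
    (forall w, dot (v i0) (path X w (q i0)) + dot (v i1) (path X w (q i1)) +
      dot (v i2) (path X w (q i2)) = dot (v a) (path X w (q a)) +
      dot (v b) (path X w (q b)) + dot (v c) (path X w (q c)))%R ->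
    (q a <= q b)%R -> (q b <= q c)%R ->
    \int[P]_w (expR (th * (dot (v i0) (path X w (q i0)) +
      dot (v i1) (path X w (q i1)) + dot (v i2) (path X w (q i2))) ^+ 2))%:E < +oo.
  move=> vabc E ab bc; under eq_integral do rewrite E.
  by apply: sorted_three_exp_moment => //; [case/andP: (q01 a)|case/andP: (q01 c)].
have [h01|h10] := leP (q i0) (q i1).
  have [h12|h21] := leP (q i1) (q i2); first exact: (@perm i0 i1 i2).
  have [h02|h20] := leP (q i0) (q i2).
    apply: (@perm i0 i2 i1) => //; last exact: ltW.
    - by rewrite -[RHS]v0 addrAC.
    - by move=> w; ring.
  apply: (@perm i2 i0 i1) => //; last exact: ltW.
  - by rewrite -[RHS]v0 -addrA [LHS]addrC.
  - by move=> w; ring.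
have [h12|h21] := leP (q i1) (q i2).
  have [h02|h20] := leP (q i0) (q i2).
    apply: (@perm i1 i0 i2) => //; last exact: ltW.
    - by rewrite -[RHS]v0 [in RHS](addrC (v i0)).
    - by move=> w; ring.
  apply: (@perm i1 i2 i0) => //; last exact: ltW.
  - by rewrite -[RHS]v0 -[RHS]addrA [RHS]addrC.
  - by move=> w; ring.
apply: (@perm i2 i1 i0) => //; try exact: ltW.
- by rewrite -[RHS]v0 [LHS]addrC [(v i2 + _)%R]addrC addrA.
- by move=> w; ring.
Qed.

Definition sup_sum (v : 'I_3 -> R * R) (w : Omega) : R := (\sum_m rpath_sup (v m) w)%R.

Lemma measurable_sup_sum v : measurable_fun setT (sup_sum v).
Proof. by apply: measurable_sum => m; exact: measurable_rpath_sup. Qed.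

Lemma sup_sum_ge0 v w : (0 <= sup_sum v w)%R.
Proof. by apply: sumr_ge0 => m _; exact: rpath_sup_ge0. Qed.

Lemma measurable_expR_sup_sum lam v :
  measurable_fun setT (fun w => (expR (lam * sup_sum v w ^+ 2))%:E).
Proof.
apply/measurable_EFinP; apply: measurableT_comp => //.
by apply: measurable_funM => //; apply: measurable_funX; exact: measurable_sup_sum.
Qed.

Let small_power (C : R) : exists n, (C * (64 * (16 / 25) ^+ n) <= 1)%R.
Proof.
have H n : (1 + n%:R * (9 / 16) <= (25 / 16 : R) ^+ n)%R.
  elim: n => [|n IH]; first by rewrite expr0 mul0r addr0.
  rewrite exprS -natr1; have l0 : (0 <= n%:R :> R)%R by [].
  by nra.
have [C0|C0] := leP C 0%R.
  exists 0%N; apply: (@le_trans _ _ 0%R) => //.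
  by rewrite mulr_le0_ge0// expr0 mulr1.
(* The bound comes from Bernoulli's inequality for [25 / 16 = 1 + 9 / 16]. *)
pose n := Num.bound (C * 64 * (16 / 9))%R; exists n.
have hn : (C * 64 * (16 / 9) < n%:R)%R.
  by apply: archi_boundP; rewrite !mulr_ge0// ltW.
have -> : (16 / 25 = (25 / 16)^-1 :> R)%R by field.
have p0 : (0 < (25 / 16 : R) ^+ n)%R by rewrite exprn_gt0//; lra.
rewrite exprVn mulrA ler_pdivrMr// mul1r.
by apply: le_trans (H n); lra.
Qed.

(* Chaining replaces the suprema by maxima over a finite dyadic grid, with an
   error of small exponential cost. *)
Lemma sup_sum_exp_moment_lty (v : 'I_3 -> R * R) (lam : R) :
  (\sum_m v m = 0)%R -> (0 <= lam)%R ->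
  (forall m, lam * sqnorm (v m) < 2^-1)%R ->
  \int[P]_w (expR (lam * sup_sum v w ^+ 2))%:E < +oo.
Proof.
move=> sv lam0 hv.
pose M := (\big[Num.max/0]_m (lam * sqnorm (v m)))%R.
have M0 : (0 <= M)%R by exact: bigmax_ge_id.
have M2 : (M < 2^-1)%R by apply: bigmax_lt => //; rewrite invr_gt0.
have Mv m : (lam * sqnorm (v m) <= M)%R by exact: le_bigmax.
(* Since [e <= 1], [M * (1 + e) ^+ 2] is at most [M + 3 * e * M], which is below
   [M + e * (3 * M + 1) = 1/2]. *)
pose e := ((2^-1 - M) / (3 * M + 1))%R.
have e0 : (0 < e)%R by rewrite divr_gt0//; lra.
have eE : (e * (3 * M + 1) = 2^-1 - M)%R by rewrite /e divfK// gt_eqF//; lra.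
have e1 : (e <= 1)%R by rewrite /e ler_pdivrMr; lra.
have lam' m : (lam * (1 + e) ^+ 2 * sqnorm (v m) < 2^-1)%R.
  rewrite mulrAC; apply: le_lt_trans (_ : M * (1 + e) ^+ 2 < _)%R.
    by rewrite ler_wpM2r// sqr_ge0.
  by rewrite expr2; nra.
have [n hn] := small_power (lam * (1 + e^-1) ^+ 2 *
  (\sum_m (`|(v m).1| + `|(v m).2|)) ^+ 2)%R.
pose F (f : {ffun 'I_3 -> 'I_(2 ^ n).+1}) (w : Omega) :=
  (expR (lam * (1 + e) ^+ 2 * (\sum_m dot (v m) (path X w (dyadic n (f m)))) ^+ 2))%R.
have mF f : measurable_fun setT (fun w => (F f w)%:E).
  apply/measurable_EFinP; apply: measurableT_comp => //.
  apply: measurable_funM => //; apply: measurable_funX.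
  apply: measurable_sum => m; apply: (measurableT_comp (measurable_dot _)).
  by apply: (measurable_path hX); exact: dyadic_ge0.
have mK := measurable_chain_sum hX.
have K0 w := chain_sum_ge0 X w.
pose G w := \sum_f (F f w)%:E + (expR 11)%:E * (1 + chain_sum X w).
have G10 w : 0 <= \sum_f (F f w)%:E by apply: sume_ge0 => f _; rewrite lee_fin expR_ge0.
have G20 w : 0 <= (expR 11)%:E * (1 + chain_sum X w).
  by rewrite mule_ge0 ?lee_fin ?expR_ge0// adde_ge0.
have mG1 : measurable_fun setT (fun w => \sum_f (F f w)%:E).
  exact: emeasurable_sum.
have mG2 : measurable_fun setT (fun w => (expR 11)%:E * (1 + chain_sum X w)).
  by apply: emeasurable_funM => //; apply: emeasurable_funD.
apply: (@le_lt_trans _ _ (\int[P]_w G w)).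
  apply: ae_ge0_le_integral => //.
  - exact: measurable_expR_sup_sum.
  - by move=> w _; rewrite adde_ge0.
  - exact: emeasurable_funD.
  apply: filterS chain_sum_ae_lty => w Kw _.
  have k1 : (1 <= 1 + fine (chain_sum X w))%R by rewrite lerDl fine_ge0.
  have := expR_sup_bound k1 (chain_sum_step_dominated Kw) lam0 e0
    (fun m => rpath_sup_ge0 (v m) w) (fun m => rpath_supE (v m) Kw) hn.
  rewrite -lee_fin EFinD EFinM EFinD fineK; last by rewrite ge0_fin_numE.
  by rewrite -sumEFin.
rewrite ge0_integralD// lte_add_pinfty//.
  rewrite ge0_integral_sum//; last by move=> f w _; rewrite lee_fin expR_ge0.
  apply: lte_sum_pinfty => f _; apply: three_point_exp_moment => //.
  - by move=> m; rewrite dyadic_ge0 dyadic_le1// -ltnS.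
  - by rewrite mulr_ge0// sqr_ge0.
rewrite ge0_integralZl//; last 2 first.
- exact: emeasurable_funD.
- by move=> w _; rewrite adde_ge0.
rewrite lte_mul_pinfty ?lee_fin ?expR_ge0//.
rewrite ge0_integralD// lte_add_pinfty//; last exact: (integral_chain_sum_lty hX).
rewrite integral_cst// mul1e.
by rewrite (le_lt_trans (probability_le1 P measurableT))// ltry.
Qed.

(* Only two times are needed: wait at one of them in the directions other than
   [m], since the three directions sum to zero. *)
Lemma sup_sum_ge_dot (v : 'I_3 -> R * R) (w : Omega) (N i j : nat) (m : 'I_3) :
  (\sum_m v m = 0)%R -> chain_sum X w < +oo -> (i <= 2 ^ N)%N -> (j <= 2 ^ N)%N ->
  (`|dot (v m) (increment X (dyadic N i) (dyadic N j) w)| <= sup_sum v w)%R.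
Proof.
move=> sv Kw iN jN.
have H i' j' : (i' <= 2 ^ N)%N -> (j' <= 2 ^ N)%N ->
    (dot (v m) (increment X (dyadic N i') (dyadic N j') w) <= sup_sum v w)%R.
  move=> iN' jN'; rewrite -pathB /sup_sum.
  have : (\sum_k dot (v k) (path X w (dyadic N i')) = 0)%R.
    have E z : (\sum_k dot (v k) z = dot (\sum_k v k) z)%R.
      have dotD (a b : R * R) : dot (a + b)%R z = (dot a z + dot b z)%R.
        by rewrite /dot/=; ring.
      have dot0 : dot 0%R z = 0%R by rewrite /dot/= !mul0r addr0.
      by rewrite -(@big_morph _ _ (fun a : R * R => dot a z) 0%R +%R 0%R +%R dotD dot0).
    by rewrite E sv /dot/= !mul0r addr0.
  rewrite (bigD1 m)//= => S0; rewrite (bigD1 m)//= dotB.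
  have : (dot (v m) (path X w (dyadic N j')) <= rpath_sup (v m) w)%R.
    exact: rpath_sup_ge.
  have : (\sum_(k | k != m) dot (v k) (path X w (dyadic N i')) <=
      \sum_(k | k != m) rpath_sup (v k) w)%R.
    by apply: ler_sum => k _; exact: rpath_sup_ge.
  by lra.
rewrite ler_norml H// andbT lerNl.
have := H _ _ jN iN.
have -> : increment X (dyadic N j) (dyadic N i) w =
    (- increment X (dyadic N i) (dyadic N j) w)%R by rewrite /increment opprB.
by rewrite /dot/= !mulrN -opprD.
Qed.

(** By [sup_sum_ge_dot] between times [0] and [1], the sum dominates the absolute value of a
    centered Gaussian variable of variance [sqnorm (v m)], whose square has no exponential moment
    from the threshold on. *)
Lemma sup_sum_exp_moment_eqy (v : 'I_3 -> R * R) (lam : R) (m : 'I_3) :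
  (\sum_m v m = 0)%R -> (0 <= lam)%R -> (2^-1 <= lam * sqnorm (v m))%R ->
  \int[P]_w (expR (lam * sup_sum v w ^+ 2))%:E = +oo.
Proof.
move=> sv lam0 hv; apply/eqP; rewrite -leye_eq.
rewrite -(@gauss_sq_mgf_eqy _ (lam * (1 - 0) * sqnorm (v m)))%R; last first.
  by rewrite subr0 mulr1.
rewrite -(integral_increment_expR_dot_sq hX _ _ (lexx _) ltr01).
apply: ae_ge0_le_integral => //.
- apply/measurable_EFinP; apply: measurableT_comp => //.
  apply: measurable_funM => //; apply: measurable_funX.
  apply: (measurableT_comp (measurable_dot _)).
  exact: (measurable_increment hX).
- exact: measurable_expR_sup_sum.
apply: filterS chain_sum_ae_lty => w Kw _.
rewrite lee_fin ler_expR ler_wpM2l//.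
have := sup_sum_ge_dot m sv Kw (leq0n _) (leqnn (2 ^ 0)).
rewrite dyadic0 dyadic1 => h.
by rewrite -[leLHS]real_normK ?num_real// ler_pXn2r// nnegrE ?sup_sum_ge0.
Qed.

End brownian_sup_moments.

(** * Small values of the supremum sum *)

Section small_ball.
Local Open Scope ereal_scope.
Context (R : realType).

Lemma nneseries_geometric_lty (r : R) : (0 < r)%R -> (r < 1)%R ->
  \sum_(0 <= N <oo) (r ^+ N)%:E < +oo.
Proof.
move=> r_gt0 r1; have r0 := ltW r_gt0.
apply: (@le_lt_trans _ _ (1 / (1 - r))%:E); last by rewrite ltry.
apply: lime_le; first by apply: is_cvg_nneseries => n _ _; rewrite lee_fin exprn_ge0.
apply: nearW => n; rewrite sumEFin lee_fin.
have h : (`|r| < 1)%R by rewrite ger0_norm.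
have := geometric_le_lim n (ler01 : (0 <= 1 :> R)%R) r_gt0 h.
rewrite seriesEnat/=; apply: le_trans; apply: ler_sum => i _.
by rewrite /geometric mul1r.
Qed.

Local Notation pg := (@gaussian_plane_law R).

Let slab (a : R * R) (c : R) := [set z : R * R | dot a z ^+ 2 * c < 1]%R.

Let measurable_slab a c : measurable (slab a c).
Proof.
have mf : measurable_fun setT (fun z : R * R => dot a z ^+ 2 * c)%R.
  by apply: measurable_funM => //; apply: measurable_funX; exact: measurable_dot.
rewrite (_ : slab a c = setT `&` (fun z : R * R => dot a z ^+ 2 * c)%R @^-1` `]-oo, 1%R[).
  exact: mf.
by rewrite setTI; apply/seteqP; split => z /=; rewrite in_itv.
Qed.

Let slab_scale (a : R * R) (c : R) : (0 < c)%R -> pg c^-1 (slab a c) = pg 1 (slab a 1).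
Proof.
move=> c0; have ci : (0 < c^-1)%R by rewrite invr_gt0.
have s0 : (0 < Num.sqrt c^-1 ^+ 2 + 0 ^+ 2)%R by rewrite expr0n addr0 sqr_sqrtr// ltW.
have lawE w (D : set (R * R)) : measurable D ->
    pg w D = \int[pg w]_z (\1_D z)%:E.
  by move=> mD; rewrite integral_indic// setIT.
have mI D : measurable D -> measurable_fun setT (fun z : R * R => (\1_D z)%:E : \bar R).
  by move=> mD; apply/measurable_EFinP; exact: measurable_indic.
have sE : (c^-1 = (Num.sqrt c^-1 ^+ 2 + 0 ^+ 2) * 1)%R.
  by rewrite mulr1 expr0n addr0 sqr_sqrtr// ltW.
rewrite [in X in X _ = _]sE (lawE _ _ (measurable_slab a c)).
rewrite (integral_planar_gaussian_similarity ltr01 s0)//; last exact: mI.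
rewrite (lawE _ _ (measurable_slab a 1)); apply: eq_integral => z _.
congr EFin; rewrite !indicE; congr (_ : bool)%:R; apply/idP/idP.
- rewrite !inE /slab/= => h; apply: le_lt_trans h.
  rewrite le_eqVlt; apply/orP; left; apply/eqP.
  rewrite /dot /similarity/= !mul0r subr0 add0r mulr1.
  rewrite (_ : (a.1 * (_ * z.1) + _) = Num.sqrt c^-1 * (a.1 * z.1 + a.2 * z.2))%R; last by ring.
  by rewrite exprMn sqr_sqrtr ?ltW// mulrAC mulVf ?mul1r// gt_eqF.
- rewrite !inE /slab/= => h; apply: le_lt_trans h.
  rewrite le_eqVlt; apply/orP; left; apply/eqP.
  rewrite /dot /similarity/= !mul0r subr0 add0r mulr1.
  rewrite (_ : (a.1 * (_ * z.1) + _) = Num.sqrt c^-1 * (a.1 * z.1 + a.2 * z.2))%R; last by ring.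
  by rewrite exprMn sqr_sqrtr ?ltW// mulrAC mulVf ?mul1r// gt_eqF.
Qed.

(** Were the slab of full measure, [expR (th * dot a z ^+ 2)] would be bounded almost everywhere for
    every [th], against the divergence of [gauss_sq_mgf]. *)
Let slab_lt1 (a : R * R) : (0 < sqnorm a)%R -> pg 1 (slab a 1) < 1.
Proof.
move=> a0; have := probability_le1 (pg 1) (measurable_slab a 1).
rewrite le_eqVlt => /predU1P[p1|//]; exfalso.
pose th := (sqnorm a)^-1%R.
have th0 : (0 < th)%R by rewrite invr_gt0.
have E : \int[pg 1]_z (expR (th * dot a z ^+ 2))%:E = +oo.
  rewrite integral_planar_gaussian_expR_dot_sq//; apply: gauss_sq_mgf_eqy.
  by rewrite mulr1 /th mulVf ?gt_eqF//; lra.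
suff : \int[pg 1]_z (expR (th * dot a z ^+ 2))%:E <= (expR th)%:E.
  by rewrite E leye_eq.
apply: (@le_trans _ _ (\int[pg 1]_(z in setT) (expR th)%:E)); last first.
  rewrite integral_cst// -[leRHS]mule1; apply: lee_wpmul2l.
    by rewrite lee_fin expR_ge0.
  exact: probability_le1.
apply: ae_ge0_le_integral => //.
- by apply: measurable_expR_sq; exact: measurable_dot.
- exists (~` slab a 1); split.
  + by apply: measurableC; exact: measurable_slab.
  + apply: (eq_trans (probability_setC (pg 1) (measurable_slab a 1))).
    by move: p1 => /= ->; rewrite subee.
  + move=> z /= H sz; apply: H => _.
    rewrite lee_fin ler_expR -[leRHS]mulr1; apply: ler_wpM2l; first exact: ltW.
    by apply: ltW; move: sz; rewrite /slab/= mulr1.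
Qed.

Context d (Omega : measurableType d) (P : probability Omega R).
Variables (X : R -> Omega -> R * R) (x : R * R).
Hypothesis hX : planar_brownian_motion P X x.

Let small_event (v : 'I_3 -> R * R) (N : nat) :=
  [set w | sup_sum X v w ^+ 2 * (2 ^+ N) < 1]%R.

Let measurable_small_event v N : measurable (small_event v N).
Proof.
have mf : measurable_fun setT (fun w => sup_sum X v w ^+ 2 * (2 ^+ N))%R.
  apply: measurable_funM => //; apply: measurable_funX.
  exact: (measurable_sup_sum hX).
rewrite (_ : small_event v N =
    setT `&` (fun w => sup_sum X v w ^+ 2 * (2 ^+ N))%R @^-1` `]-oo, 1%R[).
  exact: mf.
by rewrite setTI; apply/seteqP; split => w /=; rewrite in_itv.
Qed.

(** A small sum forces all [2 ^ N] increments over steps of length [2 ^- N] to be small in the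
    direction [v m]. These are independent events, and by scaling they all have the same
    probability. *)
Let small_event_prob (v : 'I_3 -> R * R) (m : 'I_3) (N : nat) :
  (\sum_m v m = 0)%R ->
  P (small_event v N) <= pg 1 (slab (v m) 1) ^+ (2 ^ N).
Proof.
move=> sv; pose n := (2 ^ N)%N.
have c0 : (0 < 2 ^+ N :> R)%R by rewrite exprn_gt0.
pose F := \bigcap_(i in [set: 'I_n])
  (increment X (dyadic N i) (dyadic N i.+1) @^-1` slab (v m) (2 ^+ N)%R).
have mF : measurable F.
  apply: fin_bigcap_measurable => // i _; rewrite -[Y in measurable Y]setTI.
  by apply: (measurable_increment hX); rewrite ?dyadic_ge0.
have PF : P F = pg 1 (slab (v m) 1) ^+ (2 ^ N).
  have -> : P F = \prod_(i < n) P (increment X (dyadic N i) (dyadic N i.+1) @^-1`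
      slab (v m) (2 ^+ N)%R).
    apply: (bm_independent hX (t := dyadic N) (A := fun=> slab (v m) (2 ^+ N)%R)).
    - exact: dyadic_ge0.
    - by move=> i _; exact/ltW/lt_dyadicS.
    - by [].
  rewrite (eq_bigr (fun=> pg 1 (slab (v m) 1))); last first.
    move=> i _; rewrite -(slab_scale _ c0) gaussian_plane_lawE.
    rewrite -natrX -(dyadic_step R N i).
    by apply: (bm_gaussian hX); rewrite ?dyadic_ge0 ?lt_dyadicS.
  by rewrite big_const_ord iter_mule mule1.
rewrite -PF; have [K [mK K0 sK]] := chain_sum_ae_lty hX.
apply: (@le_trans _ _ (P (F `|` K))).
  apply: le_measure; rewrite ?inE//; first exact: measurableU.
  move=> w wE; have [wK|wK] := pselect (K w); first by right.
  left => i _ /=; have Kw : chain_sum X w < +oo.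
    by apply: contrapT => h; apply: wK; apply: sK.
  apply: le_lt_trans wE; apply: ler_wpM2r; first exact: ltW.
  rewrite -[leLHS]real_normK ?num_real// ler_pXn2r// ?nnegrE ?sup_sum_ge0//.
  by apply: sup_sum_ge_dot => //; exact: ltnW.
apply: le_trans; first exact: (measureU2 P mF mK).
rewrite -[leRHS]adde0; apply: leeD; first exact: lexx.
by rewrite le_eqVlt; apply/orP; left; apply/eqP; exact: K0.
Qed.

(** The zero set lies in every [small_event], and the probabilities of these tend to [0]. *)
Lemma sup_sum_ae_gt0 (v : 'I_3 -> R * R) (m : 'I_3) :
  (\sum_m v m = 0)%R -> (0 < sqnorm (v m))%R ->
  {ae P, forall w, (0 < sup_sum X v w)%R}.
Proof.
move=> sv vm; have p1 := slab_lt1 vm; set p := pg 1 _ in p1.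
have p0 : 0 <= p by exact: measure_ge0.
have pE : p = (fine p)%:E by rewrite fineK// ge0_fin_numE// (lt_trans p1)// ltry.
have fp0 : (0 <= fine p)%R by exact: fine_ge0.
have fp1 : (fine p < 1)%R by rewrite -lte_fin -pE.
pose E := setT `&` sup_sum X v @^-1` [set 0%R].
have mE : measurable E by apply: (measurable_sup_sum hX).
exists E; split => //; last first.
  move=> w /= /negP; rewrite -leNgt => h; split=> //=.
  by apply/eqP; rewrite eq_le h sup_sum_ge0.
have PEfin : P E \is a fin_num by exact: fin_num_measure.
suff : (fine (P E) <= 0)%R.
  move=> h; apply/eqP; rewrite eq_le measure_ge0 andbT.
  by rewrite -(fineK PEfin) lee_fin.
rewrite leNgt; apply/negP => a0.
have fpn : (`|fine p| < 1)%R by rewrite ger0_norm.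
have [N _ /(_ N (leqnn N))/=] := cvgr_lt _ (cvg_expr fpn) _ a0.
apply/negP; rewrite -leNgt -lee_fin fineK//.
apply: (@le_trans _ _ (P (small_event v N))).
  apply: le_measure; rewrite ?inE// => w [_ /= w0].
  by rewrite /small_event/= w0 expr0n mul0r.
apply: (le_trans (small_event_prob m N sv)).
rewrite -/p [leLHS](_ : _ = ((fine p) ^+ (2 ^ N))%:E).
  rewrite lee_fin; apply: ler_wiXn2l => //; first exact: ltW.
  exact/ltnW/ltn_expl.
by rewrite [in LHS]pE EFin_expe.
Qed.

(** Cut [Z ^- 2] into layers between [2 ^+ N] and [2 ^+ N.+1]. The exponential there is at most
    [expR (c * 2) ^+ (2 ^ N)], while the layer has probability at most [p ^+ (2 ^ N)], so a small
    [c] makes the layers summable. *)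
Lemma sup_sum_inv_exp_moment (v : 'I_3 -> R * R) (m : 'I_3) :
  (\sum_m v m = 0)%R -> (0 < sqnorm (v m))%R ->
  exists2 c : R, (0 < c)%R &
    \int[P]_w (expR (c * (sup_sum X v w ^+ 2)^-1))%:E < +oo.
Proof.
move=> sv vm.
have p1 := slab_lt1 vm; set p := pg 1 _ in p1.
have p0 : 0 <= p by exact: measure_ge0.
have pE : p = (fine p)%:E by rewrite fineK// ge0_fin_numE// (lt_trans p1)// ltry.
(* A midpoint between [p] and [1] is positive even if [p = 0], so its logarithm is meaningful. The
   choice of [c] below gives [expR (c * 2) * q = r], with [r] the square root of [q]. *)
pose q := ((1 + fine p) / 2)%R.
have [fp0 fp1] : (0 <= fine p)%R /\ (fine p < 1)%R.
  by split; [exact: fine_ge0|rewrite -lte_fin -pE].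
have [q0 [q1 pq]] : (0 < q)%R /\ (q < 1)%R /\ (fine p <= q)%R.
  by rewrite /q; split; [|split]; lra.
have lq : (ln q < 0)%R by rewrite ln_lt0// q0.
pose c := (- ln q / 4)%R.
have c0 : (0 < c)%R by rewrite divr_gt0// oppr_gt0.
exists c => //.
pose r := expR (ln q / 2).
have r0 : (0 < r)%R by exact: expR_gt0.
have r1 : (r < 1)%R by rewrite -expR0 ltr_expR; lra.
pose g N w := (expR (c * 2 ^+ N.+1))%:E * (\1_(small_event v N) w)%:E : \bar R.
have g0 N w : 0 <= g N w by rewrite mule_ge0// lee_fin ?expR_ge0.
have mg N : measurable_fun setT (g N).
  by apply: emeasurable_funM => //; apply/measurable_EFinP; exact: measurable_indic.
have mS : measurable_fun setT (fun w => \sum_(0 <= N <oo) g N w).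
  by apply: (@ge0_emeasurable_sum _ _ _ _ _ xpredT).
have S0 w : 0 <= \sum_(0 <= N <oo) g N w by apply: nneseries_ge0 => N _ _; exact: g0.
apply: (@le_lt_trans _ _ (\int[P]_w ((expR c)%:E + \sum_(0 <= N <oo) g N w))).
  apply: ge0_le_integral => //.
  - apply/measurable_EFinP; apply: measurableT_comp => //.
    apply: measurable_funM => //; apply: (measurableT_comp (@measurable_invr R)).
    by apply: measurable_funX; exact: (measurable_sup_sum hX).
  - exact: emeasurable_funD.
  move=> w _; set W := ((sup_sum X v w ^+ 2)^-1)%R.
  have [W1|W1] := leP W 1%R.
    apply: (@le_trans _ _ (expR c)%:E); last by rewrite leeDl.
    by rewrite lee_fin ler_expR ler_piMr// ltW.
  have s0 : (0 < sup_sum X v w ^+ 2)%R.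
    by rewrite -invr_gt0; apply: lt_trans W1.
  have [N h1 h2] : exists2 N, (2 ^+ N < W)%R & (W <= 2 ^+ N.+1)%R.
    have ex : exists k, (W <= 2 ^+ k)%R.
      exists (Num.bound W); apply: ltW.
      have hb : (W < (Num.bound W)%:R)%R by apply: archi_boundP; exact: ltW (lt_trans ltr01 W1).
      apply: lt_trans hb _; rewrite -natrX ltr_nat; exact: ltn_expl.
    have := ex_minnP ex; case=> -[|k] hk kmin.
      by move: hk; rewrite expr0 leNgt W1.
    by exists k => //; rewrite ltNge; apply/negP => /kmin; rewrite ltnn.
  apply: (@le_trans _ _ (g N w)).
    rewrite /g indicE mem_set ?mule1.
      by rewrite lee_fin ler_expR ler_wpM2l// ltW.
    rewrite /small_event/= mulrC -ltr_pdivlMr//.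
    by rewrite div1r.
  apply: (@le_trans _ _ (\sum_(0 <= N <oo) g N w)); last by rewrite leeDr// lee_fin expR_ge0.
  by rewrite (nneseriesD1 (n := N))// leeDl//; apply: nneseries_ge0.
rewrite ge0_integralD//.
apply: lte_add_pinfty.
  rewrite integral_cst//; apply: (@le_lt_trans _ _ ((expR c)%:E * 1)); last by rewrite mule1 ltry.
  by apply: lee_wpmul2l; rewrite ?lee_fin ?expR_ge0// probability_le1.
rewrite integral_nneseries//.
apply: le_lt_trans (nneseries_geometric_lty r0 r1).
apply: lee_nneseries => [N _ _|N _]; first by apply: integral_ge0.
rewrite /g ge0_integralZl//; last first.
  by apply/measurable_EFinP; exact: measurable_indic.
rewrite integral_indic// setIT.
apply: (@le_trans _ _ ((expR (c * 2 ^+ N.+1))%:E * p ^+ (2 ^ N))).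
  by apply: lee_wpmul2l; [rewrite lee_fin expR_ge0|exact: small_event_prob].
have -> : p ^+ (2 ^ N) = ((fine p) ^+ (2 ^ N))%:E by rewrite [in LHS]pE EFin_expe.
rewrite -EFinM lee_fin.
have -> : expR (c * 2 ^+ N.+1) = (expR (c * 2) ^+ (2 ^ N))%R.
  by rewrite -expRM_natl natrX; congr expR; rewrite exprS; ring.
rewrite -exprMn; apply: (@le_trans _ _ (r ^+ (2 ^ N))%R).
  apply: lerXn2r; rewrite ?nnegrE ?mulr_ge0 ?expR_ge0//.
  apply: (@le_trans _ _ (expR (c * 2) * q)%R); first by rewrite ler_wpM2l ?expR_ge0.
  rewrite -[X in (_ * X)%R](@lnK _ q) ?posrE// -expRD ler_expR /c; lra.
by apply: ler_wiXn2l; [exact: ltW|exact: ltW|exact/ltnW/ltn_expl].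
Qed.

End small_ball.

(** * Mean of the supremum in one direction *)

Section mean_sup.
Local Open Scope ereal_scope.
Context (R : realType).
Context d (Omega : measurableType d) (P : probability Omega R).
Variables (X : R -> Omega -> R * R) (x : R * R).
Hypothesis hX : planar_brownian_motion P X x.

(** By rotation invariance, [dot v] of the path has the same law as the length of [v] times its
    first coordinate, so the suprema have the same tails. The mean for the first axis is left
    uncomputed. *)
Lemma integral_path_sup (v : R * R) :
  \int[P]_w path_sup X v w =
  (Num.sqrt (sqnorm v))%:E * \int[P]_w path_sup X (1, 0)%R w.
Proof.
set l := Num.sqrt (sqnorm v).
have [v0|vN0] := eqVneq (sqnorm v) 0%R.
  have /andP[/eqP v1 /eqP v2] : (v.1 == 0)%R && (v.2 == 0)%R.
    by move/eqP: v0; rewrite paddr_eq0 ?sqr_ge0// !sqrf_eq0.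
  rewrite /l v0 sqrtr0 mul0e; apply: integral0_eq => w _.
  apply/eqP; rewrite eq_le path_sup_ge0 andbT; apply/dyadic_sup_leP => N j jN.
  by rewrite /dot v1 v2 !mul0r addr0.
have v0 : (0 < sqnorm v)%R.
  by rewrite lt_neqAle eq_sym vN0 addr_ge0// sqr_ge0.
have l0 : (0 < l)%R by rewrite sqrtr_gt0.
have l2 : (l ^+ 2 = v.1 ^+ 2 + v.2 ^+ 2)%R by rewrite sqr_sqrtr// ltW.
have m1 := measurable_path_sup hX (1, 0)%R.
have mv := measurable_path_sup hX v.
rewrite -ge0_integralZl//; last 2 first.
- by move=> w _; exact: path_sup_ge0.
- by rewrite lee_fin ltW.
have ml1 : measurable_fun setT (fun w => l%:E * path_sup X (1, 0)%R w).
  exact: emeasurable_funM.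
have P0 w : 0 <= l%:E * path_sup X (1, 0)%R w.
  by rewrite mule_ge0 ?path_sup_ge0// lee_fin ltW.
transitivity (\int[P]_w `|path_sup X v w|).
  by apply: eq_integral => w _; rewrite gee0_abs// path_sup_ge0.
transitivity (\int[P]_w `|l%:E * path_sup X (1, 0)%R w|); last first.
  by apply: eq_integral => w _; rewrite gee0_abs.
apply: (eq_tail_integral (h := abse)) => //.
- by move=> w _; exact: path_sup_ge0.
- by rewrite (le_lt_trans (probability_le1 P measurableT))// ltry.
move=> r _; rewrite !setTI.
have C_tail (f : Omega -> \bar R) : measurable_fun setT f ->
    P [set w | r%:E < f w] = 1 - P [set w | f w <= r%:E].
  move=> mf.
  have mA : measurable [set w | f w <= r%:E].
    rewrite (_ : [set _ | _] = setT `&` f @^-1` `]-oo, r%:E]); last first.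
      by rewrite setTI; apply/seteqP; split => w /=; rewrite in_itv.
    by apply: mf => //; exact: emeasurable_itv.
  rewrite -(probability_setC P mA); congr (P _).
  by apply/seteqP; split => w /=; [move=> h; apply/negP; rewrite -ltNge
    |move/negP; rewrite -ltNge].
apply: (eq_trans (C_tail _ mv)); apply: (eq_trans _ (esym (C_tail _ ml1))).
congr (1 - _).
pose C := [set z : R * R | (l * z.1 <= r)%R].
have mC : measurable C.
  rewrite (_ : C = setT `&` (fun z : R * R => (l * z.1)%R) @^-1` `]-oo, r%R]).
    by apply: measurable_funM.
  by rewrite setTI; apply/seteqP; split => z /=; rewrite in_itv.
(* The rotation that carries the direction of [v] to the first axis; the scaling law is applied to
   the process and itself. *)
have s1 : ((v.1 / l) ^+ 2 + (- v.2 / l) ^+ 2 = 1)%R.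
  by rewrite !expr_div_n sqrrN -mulrDl -l2 divff// sqrf_eq0 gt_eqF.
have s0 : (0 < (v.1 / l) ^+ 2 + (- v.2 / l) ^+ 2)%R by rewrite s1.
have := brownian_dyadic_law hX hX s0 mC; rewrite s1.
rewrite (_ : [set w | _] = [set w | l%:E * path_sup X (1, 0)%R w <= r%:E]); last first.
  have E w : (l%:E * path_sup X (1, 0)%R w <= r%:E) = (path_sup X (1, 0)%R w <= (r / l)%:E).
    have -> : r%:E = l%:E * (r / l)%:E by rewrite -EFinM mulrCA divff ?mulr1// gt_eqF.
    by rewrite lee_pmul2l// lte_fin.
  apply/seteqP; split => w /=.
    move=> h; rewrite E; apply/dyadic_sup_leP => N j jN.
    rewrite lee_fin /dot/= mul1r mul0r addr0 ler_pdivlMr// mulrC.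
    by have := h N j jN; rewrite mul1r.
  rewrite E => /dyadic_sup_leP h N j jN.
  have := h N j jN.
  by rewrite lee_fin /dot/= mul1r mul0r addr0 ler_pdivlMr// mulrC mul1r.
rewrite (_ : [set w | forall N j, _ -> C (similarity _ _ _)] =
    [set w | path_sup X v w <= r%:E]) //.
have E z : (l * (similarity (v.1 / l) (- v.2 / l) z).1 = dot v z)%R.
  by rewrite /similarity /dot/=; field; rewrite gt_eqF.
apply/seteqP; split => w /=.
  move=> h; apply/dyadic_sup_leP => N j jN.
  by rewrite lee_fin -E; exact: h.
move=> /dyadic_sup_leP h N j jN; have := h N j jN.
by rewrite lee_fin -E.
Qed.

End mean_sup.

(** * Exit times of triangles *)

Section continuous_paths.
Variable R : realType.

Lemma continuous_dot (a : R * R) : continuous (dot a).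
Proof.
move=> z; apply: cvgD.
  by apply: cvgM; [exact: cvg_cst|exact: cvg_fst].
by apply: cvgM; [exact: cvg_cst|exact: cvg_snd].
Qed.

Variable f : R -> R * R.
Hypothesis cf : {within `[0, +oo[, continuous f}.

Let cdot (a : R * R) : {within `[0, +oo[, continuous (fun s => dot a (f s))}.
Proof.
by apply: within_continuous_comp => // z _; exact: continuous_dot.
Qed.

Let dot_lt_near (a : R * R) (s M : R) : 0 <= s -> dot a (f s) < M ->
  exists2 e : R, 0 < e & forall s', 0 <= s' -> `|s - s'| < e -> dot a (f s') < M.
Proof.
move=> s0 sM.
have := @cdot a; move=> /subspace_continuousP/(_ s).
rewrite /= in_itv/= andbT => /(_ s0) h.
have H : nbhs s (fun s' => `[0, +oo[%classic s' -> dot a (f s') < M).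
  exact: (cvgr_lt _ h _ sM).
have [e /= e0 he] := (nbhs_ballP _ _).1 H.
exists e => // s' s'0 ss'; apply: (he s') => //.
by rewrite /= in_itv/= s'0.
Qed.

Lemma dyadic_approx (t s e : R) : 0 < t -> 0 <= s -> s <= t -> 0 < e ->
  exists N j, (j <= 2 ^ N)%N /\ `|s - t * dyadic N j| < e.
Proof.
move=> t0 s0 st e0.
pose N := Num.truncn (t / e) ; pose y := s / t * 2 ^+ N.
have e2 : 0 < 2 ^+ N :> R by rewrite exprn_gt0.
have y0 : 0 <= y by rewrite mulr_ge0 ?divr_ge0// ltW.
pose j := Num.truncn y.
have /andP[jy yj] := truncn_itv y0.
have yN : y <= 2 ^+ N.
  by apply: ler_piMl; [exact: ltW|rewrite ler_pdivrMr// mul1r].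
exists N, j; split.
  by rewrite -(ler_nat R) natrX (le_trans jy).
have tN : t / e < 2 ^+ N.
  have te0 : 0 <= t / e by rewrite divr_ge0// ltW.
  have /andP[_ h] := truncn_itv te0.
  by apply: lt_le_trans h _; rewrite -natrX ler_nat; exact: ltn_expl.
have sE : s = t * (y / 2 ^+ N).
  by rewrite /y mulfK ?gt_eqF// mulrCA divff ?mulr1// gt_eqF.
rewrite {1}sE /dyadic -mulrBr natrX -mulrBl normrM (gtr0_norm t0).
rewrite ger0_norm; last by rewrite mulr_ge0 ?subr_ge0// invr_ge0 ltW.
rewrite mulrA ltr_pdivrMr//.
have h1 : y - j%:R < 1 by rewrite ltrBlDr addrC natr1.
have h2 : t < 2 ^+ N * e by rewrite -ltr_pdivrMr.
apply: le_lt_trans (_ : t * 1 < _); first by apply: ler_wpM2l; exact: ltW.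
by rewrite mulr1 mulrC.
Qed.

Variables (I : finType) (v : I -> R * R) (c : I -> R).
Let D := [set z | forall m, dot (v m) z < c m].

(** The strict inequality corresponds to a uniform margin at dyadic times: compactness of [[0, t]]
    creates the margin, while density of the dyadic times and continuity at [t] recover survival
    slightly past [t]. *)
Lemma exit_time_gtP (t : R) : 0 < t ->
  (t%:E < ereal_inf [set s%:E | s in [set s : R | (0 <= s)%R /\ ~ D (f s)]])%E <->
  exists n, forall N j, (j <= 2 ^ N)%N -> forall m,
    dot (v m) (f (t * dyadic N j)) <= c m - n.+1%:R^-1.
Proof.
move=> t0; split=> [tinf|[n hn]].
  have Df s : 0 <= s -> s <= t -> D (f s).
    move=> s0 st; apply: contrapT => Ds; move: tinf; apply/negP; rewrite -leNgt.
    apply: (@le_trans _ _ s%:E); last by rewrite lee_fin.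
    by apply: ereal_inf_lbound; exists s.
  (* Each functional attains its maximum on [[0, t]], so the strict inequality leaves a positive
     gap; the least gap is then rounded down to some [n.+1%:R^-1]. *)
  have /choice[g hg] : forall m, exists e : R, 0 < e /\
      forall s, 0 <= s -> s <= t -> dot (v m) (f s) <= c m - e.
    move=> m.
    have ct : {within `[0, t], continuous (fun s => dot (v m) (f s))}.
      apply: continuous_subspaceW (@cdot (v m)) => s /=.
      by rewrite !in_itv/= => /andP[->].
    have [u] := EVT_max (ltW t0) ct; rewrite in_itv/= => /andP[u0 ut] hu.
    exists (c m - dot (v m) (f u)); split; first by rewrite subr_gt0; exact: Df.
    by move=> s s0 st; rewrite subKr; apply: hu; rewrite in_itv/= s0.
  pose e := \big[Num.min/1]_m g m.
  have e0 : 0 < e by apply: lt_bigmin => // m _; case: (hg m).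
  exists (Num.truncn e^-1) => N j jN m.
  have [_ h] := hg m.
  apply: (@le_trans _ _ (c m - g m)).
    apply: h; first by rewrite mulr_ge0 ?dyadic_ge0// ltW.
    by rewrite ler_piMr ?dyadic_le1// ltW.
  rewrite lerD2l lerN2; apply: (@le_trans _ _ e); last exact: bigmin_le.
  rewrite -[leRHS]invrK lef_pV2 ?posrE ?invr_gt0 ?ltr0n//.
  have ei0 : 0 <= e^-1 by rewrite invr_ge0 ltW.
  by have /andP[_ /ltW] := truncn_itv ei0.
have n0 : 0 < (n.+1%:R^-1 : R) by rewrite invr_gt0 ltr0n.
(* A violation at [s] would persist nearby, hence at some dyadic time. *)
have H s m : 0 <= s -> s <= t -> dot (v m) (f s) <= c m - n.+1%:R^-1.
  move=> s0 st; rewrite leNgt; apply/negP => h.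
  have dotN z : dot (- v m) z = - dot (v m) z by rewrite /dot/=; ring.
  have h' : dot (- v m) (f s) < - (c m - n.+1%:R^-1) by rewrite dotN ltrN2.
  have [e e0 he] := dot_lt_near s0 h'.
  have [N [j [jN hj]]] := dyadic_approx t0 s0 st e0.
  have := he (t * dyadic N j); rewrite mulr_ge0 ?dyadic_ge0 1?ltW// => /(_ isT hj).
  by rewrite dotN ltrN2 ltNge hn.
(* The margin keeps the path inside on a short interval after [t], which pushes the infimum strictly
   beyond [t]. *)
have /choice[g hg] : forall m, exists e : R, 0 < e /\
    forall s, 0 <= s -> `|t - s| < e -> dot (v m) (f s) < c m.
  move=> m.
  have tM : dot (v m) (f t) < c m by apply: le_lt_trans (H t m (ltW t0) (lexx _)) _; rewrite ltrBlDr ltrDl.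
  by have [e e0 he] := dot_lt_near (ltW t0) tM; exists e; split.
pose e := \big[Num.min/1]_m g m.
have e0 : 0 < e by apply: lt_bigmin => // m _; case: (hg m).
apply: (@lt_le_trans _ _ (t + e)%:E); first by rewrite lte_fin ltrDl.
apply: le_ereal_inf_tmp => _ [s [s0 Ds] <-]; rewrite lee_fin leNgt; apply/negP => ste.
apply: Ds => m; have [st|ts] := leP s t.
  by apply: le_lt_trans (H s m s0 st) _; rewrite ltrBlDr ltrDl.
have [_] := hg m; apply => //.
rewrite distrC gtr0_norm ?subr_gt0//.
by apply: (@lt_le_trans _ _ e); [lra|exact: bigmin_le].
Qed.

End continuous_paths.

(** * The law of the exit time from a fixed starting point *)

Section exit_law.
Local Open Scope ereal_scope.
Context (R : realType).
Context d (Omega : measurableType d) (P : probability Omega R).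
Variables (X : R -> Omega -> R * R) (x : R * R).
Hypothesis hX : planar_brownian_motion P X x.
Context d' (Omega' : measurableType d') (P' : probability Omega' R).
Variables (X' : R -> Omega' -> R * R) (x' : R * R).
Hypothesis hX' : planar_brownian_motion P' X' x'.
Variables (v : 'I_3 -> R * R) (c : 'I_3 -> R).
Hypothesis sv : (\sum_m v m = 0)%R.
Variable m0 : 'I_3.
Hypothesis vm0 : (0 < sqnorm (v m0))%R.
Let D := [set z | forall m, (dot (v m) z < c m)%R].
Hypothesis Dx : D x.

Let y m := (c m - dot (v m) x)%R.

Let y0 m : (0 < y m)%R. Proof. by rewrite subr_gt0; exact: Dx. Qed.

Let C n := [set z | forall m, (dot (v m) z <= y m - n.+1%:R^-1)%R].

Let measurable_C n : measurable (C n).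
Proof.
rewrite (_ : C n = \bigcap_(m in [set: 'I_3])
    (setT `&` dot (v m) @^-1` `]-oo, (y m - n.+1%:R^-1)%R])).
  apply: fin_bigcap_measurable => // m _.
  exact: measurable_dot.
apply/seteqP; split => [z zC m _|z zC m].
  by rewrite setTI /= in_itv/=; exact: zC.
by have := zC m I; rewrite setTI /= in_itv.
Qed.

(* [G] and [G'] are the survival events of the path started at [x] and, through
   Brownian scaling, of a rescaled copy; the margin [n.+1%:R^-1] absorbs the
   passage from dyadic to all times. *)
Let G t := \bigcup_n [set w | forall N j, (j <= 2 ^ N)%N ->
  C n (increment X 0 (t * dyadic N j) w)].

Let G' t := \bigcup_n [set w | forall N j, (j <= 2 ^ N)%N ->
  C n (similarity (Num.sqrt t) 0 (increment X' 0 (dyadic N j) w))].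

Let measurable_level d0 (T : measurableType d0) (Q : probability T R)
    (Y : R -> T -> R * R) (z : R * R) (t : R) n (f : R * R -> R * R) :
  planar_brownian_motion Q Y z -> (0 <= t)%R -> measurable_fun setT f ->
  measurable [set w | forall N j, (j <= 2 ^ N)%N ->
    C n (f (increment Y 0 (t * dyadic N j) w))].
Proof.
move=> hY t0 mf.
rewrite (_ : [set w | _] = \bigcap_N [set w | forall j, (j <= 2 ^ N)%N ->
    C n (f (increment Y 0 (t * dyadic N j) w))]).
  apply: bigcapT_measurable => N.
  exact: (measurable_increment_event N hY t0 (measurable_C n) mf).
by apply/seteqP; split => [w h N _ j|w h N j]; [exact: h|exact: (h N I)].
Qed.

Let C_nd n n' : (n <= n')%N -> C n `<=` C n'.
Proof.
move=> nn z zC m; apply: (le_trans (zC m)); rewrite lerD2l lerN2.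
by rewrite lef_pV2 ?posrE ?ltr0n// ler_nat.
Qed.

Let measurable_G t : (0 < t)%R -> measurable (G t).
Proof.
move=> t0; apply: bigcupT_measurable => n.
by apply: (measurable_level n (f := id) hX) => //; exact: ltW.
Qed.

Let measurable_level' t n : measurable [set w | forall N j, (j <= 2 ^ N)%N ->
  C n (similarity (Num.sqrt t) 0 (increment X' 0 (dyadic N j) w))].
Proof.
have := measurable_level n hX' (ler01 : (0 <= 1 :> R)%R)
  (measurable_similarity (Num.sqrt t) 0).
rewrite (_ : [set w | _] = [set w | forall N j, (j <= 2 ^ N)%N ->
  C n (similarity (Num.sqrt t) 0 (increment X' 0 (dyadic N j) w))])//.
by apply/seteqP; split => w h N j jN; have := h N j jN; rewrite mul1r.
Qed.

Let measurable_G' t : measurable (G' t).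
Proof. by apply: bigcupT_measurable => n; exact: measurable_level'. Qed.

Let law_G t : (0 < t)%R -> P (G t) = P' (G' t).
Proof.
move=> t0.
have st : (Num.sqrt t ^+ 2 + 0 ^+ 2 = t)%R by rewrite expr0n addr0 sqr_sqrtr// ltW.
have c1 : P [set w | forall N j, (j <= 2 ^ N)%N ->
    C n (increment X 0 (t * dyadic N j) w)] @[n --> \oo] --> P (G t).
  apply: nondecreasing_cvg_mu.
  - by move=> n; apply: (measurable_level n (f := id) hX) => //; exact: ltW.
  - exact: measurable_G.
  - move=> n n' nn; apply/subsetPset => w h N j jN.
    by apply: (C_nd nn); exact: h.
have c2 : P' [set w | forall N j, (j <= 2 ^ N)%N ->
    C n (similarity (Num.sqrt t) 0 (increment X' 0 (dyadic N j) w))] @[n --> \oo] -->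
    P' (G' t).
  apply: nondecreasing_cvg_mu.
  - by move=> n; exact: measurable_level'.
  - exact: measurable_G'.
  - move=> n n' nn; apply/subsetPset => w h N j jN.
    by apply: (C_nd nn); exact: h.
have h1 := cvg_lim (@ereal_hausdorff R) c1.
have h2 := cvg_lim (@ereal_hausdorff R) c2.
rewrite -h1 -h2; congr (lim _).
have E : (fun n => P [set w | forall N j, (j <= 2 ^ N)%N ->
    C n (increment X 0 (t * dyadic N j) w)]) =
  (fun n => P' [set w | forall N j, (j <= 2 ^ N)%N ->
    C n (similarity (Num.sqrt t) 0 (increment X' 0 (dyadic N j) w))]).
  apply/funext => n.
  have := brownian_dyadic_law hX hX' (al := Num.sqrt t) (be := 0) _ (measurable_C n).
  by rewrite st => ->.
by rewrite E.
Qed.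

(** Its inverse square has the law of the exit time. The suprema are in the numerator because they
    may vanish, whereas the coordinates [y m] are positive. *)
Definition hit_ratio (w : Omega') : R := (\big[Num.max/0]_m (rpath_sup X' (v m) w / y m))%R.

Lemma measurable_hit_ratio : measurable_fun setT hit_ratio.
Proof.
apply: measurable_bigmax => m; apply: measurable_funM => //.
exact: (measurable_rpath_sup hX').
Qed.

(** With finitely many [m], some margin [n.+1%:R^-1] works for all of them exactly when every
    inequality is strict. *)
Let G'E t : (0 < t)%R -> {ae P', forall w, G' t w <->
  forall m, (Num.sqrt t * rpath_sup X' (v m) w < y m)%R}.
Proof.
move=> t0; apply: filterS (chain_sum_ae_lty hX') => w Kw.
have s0 : (0 < Num.sqrt t)%R by rewrite sqrtr_gt0.
have dotS m z : dot (v m) (similarity (Num.sqrt t) 0 z) = (Num.sqrt t * dot (v m) z)%R.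
  by rewrite /dot /similarity/=; ring.
have E n : (forall N j, (j <= 2 ^ N)%N ->
    C n (similarity (Num.sqrt t) 0 (increment X' 0 (dyadic N j) w))) <->
    forall m, (Num.sqrt t * rpath_sup X' (v m) w <= y m - n.+1%:R^-1)%R.
  split=> [h m|h N j jN m].
    rewrite mulrC -ler_pdivlMr// -lee_fin rpath_supE//.
    apply/dyadic_sup_leP => N j jN; rewrite lee_fin ler_pdivlMr// mulrC -dotS.
    exact: h.
  rewrite dotS; apply: le_trans (h m); apply: ler_wpM2l; first exact: ltW.
  exact: rpath_sup_ge.
split=> [[n _ /= h] m|h].
  apply: le_lt_trans ((E n).1 h m) _.
  by rewrite ltrBlDr ltrDl invr_gt0 ltr0n.
pose e := (\big[Num.min/1]_m (y m - Num.sqrt t * rpath_sup X' (v m) w))%R.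
have e0 : (0 < e)%R by apply: lt_bigmin => // m _; rewrite subr_gt0.
exists (Num.truncn e^-1) => //=; apply/E => m.
rewrite lerBrDr addrC -lerBrDr; apply: (@le_trans _ _ e); last exact: bigmin_le.
rewrite -[leRHS]invrK lef_pV2 ?posrE ?invr_gt0 ?ltr0n//.
have ei0 : (0 <= e^-1)%R by rewrite invr_ge0 ltW.
by have /andP[_ /ltW] := truncn_itv ei0.
Qed.

Let GE : {ae P, forall w, (forall t, (0 < t)%R ->
  (t%:E < exit_time X D w <-> G t w)) /\ 0 <= exit_time X D w}.
Proof.
have := bm_continuous hX; have := bm_start hX.
apply: filterS2 => w w0 cw; split; last first.
  by apply: le_ereal_inf_tmp => _ [t [t0 _] <-]; rewrite lee_fin.
move=> t t0; have := exit_time_gtP cw v c t0.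
rewrite -/D => H; apply: (iff_trans H); split.
  move=> [n hn]; exists n => //= N j jN m.
  by rewrite /increment w0 dotB /y [leRHS]addrAC lerD2r; exact: hn.
move=> [n _ /= hn]; exists n => N j jN m.
have := hn N j jN m.
by rewrite /increment w0 dotB /y [X in (_ <= X)%R -> _]addrAC lerD2r.
Qed.

(** A measurable version of the exit time, built from the measurable events [G] at rational times
    only; it agrees with the exit time almost surely. The value [0] is included so that the supremum
    is never [-oo]. *)
Let tau (w : Omega) : \bar R := ereal_sup [set z | z = 0 \/
  exists q : rat, [/\ (0 < ratr q :> R)%R, G (ratr q) w & z = (ratr q)%:E]].

Let tau_ge0 w : 0 <= tau w.
Proof. by apply: ereal_sup_ubound; left. Qed.

Let tau_gtE (r : R) : (0 < r)%R -> [set w | r%:E < tau w] =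
  \bigcup_(q : rat) (if (r < ratr q)%R then G (ratr q) else set0).
Proof.
move=> r0; apply/seteqP; split => [w /=|w [q _]].
  move=> /ereal_sup_gt[_ [->|[q [q0 Gq ->]]]].
    by rewrite lte_fin ltNge ltW.
  by rewrite lte_fin => rq; exists q => //; rewrite rq.
case: ifPn => // rq Gq /=; apply: (@lt_le_trans _ _ (ratr q)%:E).
  by rewrite lte_fin.
by apply: ereal_sup_ubound; right; exists q; split => //; exact: lt_trans rq.
Qed.

Let measurable_tau_gt (r : R) : (0 < r)%R -> measurable [set w | r%:E < tau w].
Proof.
move=> r0; rewrite tau_gtE//; apply: bigcupT_measurable_rat => q.
by case: ifPn => // rq; apply: measurable_G; exact: lt_trans rq.
Qed.

Let measurable_tau : measurable_fun setT tau.
Proof.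
move=> mT; apply: (measurability _ (ErealGenOInfty.measurableE R)) => //.
move=> _ [_ [r ->] <-]; rewrite setTI.
rewrite (_ : _ @^-1` _ = [set w | r%:E < tau w]); last first.
  by apply/seteqP; split => w /=; rewrite in_itv/= andbT.
have [r0|r0] := ltP 0%R r; first exact: measurable_tau_gt.
have [rN|rN] := ltP r 0%R.
  rewrite (_ : [set w | _] = setT)//; apply/seteqP; split => // w _ /=.
  by apply: lt_le_trans (tau_ge0 w); rewrite lte_fin.
have -> : r = 0%R by apply/eqP; rewrite eq_le r0.
rewrite (_ : [set w | _] = \bigcup_n [set w | n.+1%:R^-1%:E < tau w]).
  by apply: bigcupT_measurable => n; apply: measurable_tau_gt; rewrite invr_gt0 ltr0n.
apply/seteqP; split => [w /=|w [n _ /=]]; last first.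
  by apply: lt_trans; rewrite lte_fin invr_gt0 ltr0n.
move=> /ereal_sup_gt[_ [->|[q [q0 Gq ->]] _]]; first by rewrite ltxx.
exists (Num.truncn (ratr q : R)^-1%R) => //=.
apply: (@lt_le_trans _ _ (ratr q)%:E); last first.
  by apply: ereal_sup_ubound; right; exists q.
rewrite lte_fin -[ltRHS]invrK ltf_pV2 ?posrE ?invr_gt0 ?ltr0n//.
have ei0 : (0 <= (ratr q)^-1 :> R)%R by rewrite invr_ge0 ltW.
by have /andP[_] := truncn_itv ei0.
Qed.

Let tau_exit_time : {ae P, forall w, exit_time X D w = tau w}.
Proof.
apply: filterS GE => w [GEw E0]; apply/eqP; rewrite eq_le; apply/andP; split.
  rewrite leNgt; apply/negP => tE.
  have [r tr] : exists r : R, tau w = r%:E.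
    move: tE (tau_ge0 w); case: (tau w) => [r _ _| |//]; first by exists r.
    by rewrite ltNge leey.
  have r0 : (0 <= r)%R by rewrite -lee_fin -tr.
  have [q rq qE] : exists2 q : rat, (r < ratr q)%R & (ratr q)%:E < exit_time X D w.
    move: tE; rewrite tr; case: (exit_time X D w) => [e| |//].
      rewrite lte_fin => /rat_in_itvoo[q]; rewrite in_itv/= => /andP[h1 h2].
      by exists q => //; rewrite lte_fin.
    have /rat_in_itvoo[q] : (r < r + 1)%R by rewrite ltrDl.
    by rewrite in_itv/= => /andP[h1 _]; exists q => //; rewrite ltry.
  have q0 : (0 < ratr q :> R)%R by apply: le_lt_trans rq.
  have : (ratr q)%:E <= tau w.
    by apply: ereal_sup_ubound; right; exists q; split => //; exact/GEw.
  by rewrite tr lee_fin leNgt rq.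
apply: ub_ereal_sup => _ [->//|[q [q0 Gq ->]]].
by apply/ltW/GEw.
Qed.

Let hit_ratio_gt (r : R) : (0 < r)%R ->
  {ae P', forall w, (r%:E < (((hit_ratio w) ^+ 2)^-1)%:E) <-> G' r w}.
Proof.
move=> r0; have h1 := G'E r0; have h2 := sup_sum_ae_gt0 hX' sv vm0.
apply: filterS2 h1 h2 => w E Z0.
have s0 : (0 < Num.sqrt r)%R by rewrite sqrtr_gt0.
(* If it vanished, so would all suprema, and hence their sum. The case must be excluded because the
   inverse of [0] is [0] here, not infinity. *)
have Q0 : (0 < hit_ratio w)%R.
  rewrite lt_neqAle eq_sym; apply/andP; split; last exact: bigmax_ge_id.
  apply: contraTneq Z0 => Q0; rewrite -leNgt; apply: sumr_le0 => m _.
  have : (rpath_sup X' (v m) w / y m <= hit_ratio w)%R by exact: le_bigmax.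
  by rewrite Q0 ler_pdivrMr// mul0r.
apply: iff_trans (iff_sym E); rewrite lte_fin.
have -> : (r < (hit_ratio w ^+ 2)^-1)%R = (hit_ratio w < (Num.sqrt r)^-1)%R.
  rewrite -[LHS]ltf_pV2 ?posrE ?invr_gt0 ?exprn_gt0// invrK.
  rewrite -[RHS](@ltr_pXn2r _ 2)// ?nnegrE ?invr_ge0 ?ltW//.
  by rewrite exprVn sqr_sqrtr// ltW.
split=> [h m|h].
  rewrite mulrC -ltr_pdivlMr// mulrC -ltr_pdivrMr//.
  by apply: le_lt_trans h; exact: le_bigmax.
apply: bigmax_lt => [|m _]; first by rewrite invr_gt0.
by rewrite ltr_pdivrMr// mulrC ltr_pdivlMr// mulrC.
Qed.

(** The starting point enters only through the coordinates [y], and the right-hand side may use any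
    Brownian motion. One and the same motion can thus serve all starting points, which makes Tonelli
    applicable later. *)
Lemma exit_moment_hit_ratio (k : nat) :
  exit_moment P X D k = \int[P']_w ((((hit_ratio w) ^+ 2)^-1) ^+ k)%:E.
Proof.
pose g w := (((hit_ratio w) ^+ 2)^-1)%:E.
have g0 w : 0 <= g w by rewrite lee_fin invr_ge0 sqr_ge0.
have mg : measurable_fun setT g.
  apply/measurable_EFinP; apply: (measurableT_comp (@measurable_invr R)).
  by apply: measurable_funX; exact: measurable_hit_ratio.
transitivity (\int[P]_w (`|tau w| ^+ k)).
  apply: ge0_ae_eq_integral_nonmeasurable.
  - move=> w; apply: expe_ge0; apply: le_ereal_inf_tmp => _ [t [t0 _] <-].
    by rewrite lee_fin.
  - by move=> w; apply: expe_ge0.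
  - by apply: filterS tau_exit_time => w ->; rewrite gee0_abs.
transitivity (\int[P']_w (`|g w| ^+ k)); last first.
  by apply: eq_integral => w _; rewrite gee0_abs// EFin_expe.
apply: (eq_tail_integral (h := fun z => `|z| ^+ k)) => //.
- exact: measurable_expe_abse.
- by move=> z; apply: expe_ge0.
- by rewrite (le_lt_trans (probability_le1 P measurableT))// ltry.
- exact: (eq_trans (probability_setT P) (esym (probability_setT P'))).
move=> r r0; rewrite !setTI.
transitivity (P (G r)).
  apply: ae_eq_measure; [exact: measurable_tau_gt|exact: measurable_G|].
  have := GE; have := tau_exit_time; apply: filterS2 => w Et [h _].
  by rewrite /= -Et; exact: h.
rewrite law_G//; apply/esym/ae_eq_measure => //; last first.
  by apply: filterS (hit_ratio_gt r0) => w; exact.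
rewrite (_ : [set w | _] = setT `&` g @^-1` `]r%:E, +oo[); last first.
  by rewrite setTI; apply/seteqP; split => z /=; rewrite in_itv/= andbT.
by apply: mg => //; exact: emeasurable_itv.
Qed.

End exit_law.

(** * Integration over the standard simplex *)

Section simplex.
Local Open Scope ereal_scope.
Variable R : realType.
Local Notation mu := (@lebesgue_measure R).

Definition bary (q : R * R) (m : 'I_3) : R := nth 0%R [:: q.1; q.2; 1 - q.1 - q.2]%R m.

Definition simplex : set (R * R) := [set q | forall m, (0 < bary q m)%R].

Definition max_ratio (a : 'I_3 -> R) (q : R * R) : R :=
  (\big[Num.max/0]_m (a m / bary q m))%R.

Lemma measurable_bary m : measurable_fun setT (bary ^~ m).
Proof.
case: m => [[|[|[|//]]]] /= ?; rewrite /bary/=.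
- exact: measurable_fst.
- exact: measurable_snd.
- by apply: measurable_funB => //; exact: measurable_funB.
Qed.

Lemma measurable_bary_gt (b : 'I_3 -> R) :
  measurable [set q : R * R | forall m, (b m < bary q m)%R].
Proof.
rewrite (_ : [set q | _] = \bigcap_(m in [set: 'I_3])
    (setT `&` (bary ^~ m) @^-1` `]b m, +oo[)).
  by apply: fin_bigcap_measurable => // m _; exact: measurable_bary.
apply/seteqP; split => [q qb m _|q qb m].
  by rewrite setTI /= in_itv/= andbT.
by have := qb m I; rewrite setTI /= in_itv/= andbT.
Qed.

Lemma measurable_simplex : measurable simplex.
Proof. exact: measurable_bary_gt. Qed.

Lemma measurable_max_ratio a : measurable_fun setT (max_ratio a).
Proof.
apply: measurable_bigmax => m; apply: measurable_funM => //.
by apply: (measurableT_comp (@measurable_invr R)); exact: measurable_bary.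
Qed.

Lemma max_ratio_gtP (a : 'I_3 -> R) (q : R * R) (r : R) : (0 < r)%R ->
  simplex q -> (exists m, 0 < a m)%R ->
  (r < (max_ratio a q ^+ 2)^-1)%R <-> (forall m, Num.sqrt r * a m < bary q m)%R.
Proof.
move=> r0 qS [m am].
have s0 : (0 < Num.sqrt r)%R by rewrite sqrtr_gt0.
have Q0 : (0 < max_ratio a q)%R.
  apply: lt_le_trans (_ : a m / bary q m <= _)%R; last exact: le_bigmax.
  by rewrite divr_gt0.
have -> : (r < (max_ratio a q ^+ 2)^-1)%R = (max_ratio a q < (Num.sqrt r)^-1)%R.
  rewrite -[LHS]ltf_pV2 ?posrE ?invr_gt0 ?exprn_gt0// invrK.
  rewrite -[RHS](@ltr_pXn2r _ 2)// ?nnegrE ?invr_ge0 ?ltW//.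
  by rewrite exprVn sqr_sqrtr// ltW.
split=> [h n|h].
  rewrite mulrC -ltr_pdivlMr// mulrC -ltr_pdivrMr//.
  by apply: le_lt_trans h; exact: le_bigmax.
apply: bigmax_lt => [|n _]; first by rewrite invr_gt0.
by rewrite ltr_pdivrMr// mulrC ltr_pdivlMr// mulrC.
Qed.

Let sum3 (V : nmodType) (F : 'I_3 -> V) :
  (\sum_m F m = F ord0 + F (lift ord0 ord0) + F (lift ord0 (lift ord0 ord0)))%R.
Proof. by rewrite !big_ord_recl big_ord0 addr0 addrA. Qed.

Lemma forall_ord3 (Q : 'I_3 -> Prop) : (forall m, Q m) <->
  [/\ Q ord0, Q (lift ord0 ord0) & Q (lift ord0 (lift ord0 ord0))].
Proof.
split=> [h|[h0 h1 h2] m]; first by split.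
by case: m => [[|[|[|//]]]] i; [move: h0|move: h1|move: h2];
  congr (Q _); exact/val_inj.
Qed.

(* Cutting a fixed total amount off the barycentric coordinates leaves the
   same smaller triangle up to translation. *)
Lemma measure_bary_gt (b b' : 'I_3 -> R) : (\sum_m b m = \sum_m b' m)%R ->
  (mu \x mu) [set q | forall m, (b m < bary q m)%R] =
  (mu \x mu) [set q | forall m, (b' m < bary q m)%R].
Proof.
rewrite !sum3 => bb.
have mb := measurable_bary_gt b; have mb' := measurable_bary_gt b'.
rewrite -[in LHS](setIT [set q | _]) -[in RHS](setIT [set q | _]).
rewrite -!integral_indic//.
rewrite [RHS](@integral_plane_affine _ 1 0 (b' ord0 - b ord0)%R 0 1
    (b' (lift ord0 ord0) - b (lift ord0 ord0))%R).
- rewrite mul0r subr0 mulr1 normr1 mul1e; apply: eq_integral => q _.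
  congr EFin; rewrite !indicE; congr (_ : bool)%:R; apply/idP/idP;
    rewrite !inE /= => /forall_ord3; rewrite /bary/= => -[h0 h1 h2];
    apply/forall_ord3; rewrite /bary/=; split; lra.
- by rewrite mul0r subr0 mulr1 oner_neq0.
- by apply/measurable_EFinP; exact: measurable_indic.
- by [].
Qed.

(** The constant common to all triangles. Equal weights represent all weights of sum [1], since only
    the sum matters. *)
Definition simplex_moment (k : nat) : \bar R :=
  \int[mu \x mu]_(q in simplex) (((max_ratio (fun=> 3^-1) q ^+ 2)^-1) ^+ k)%:E.

Let simplex_sub : simplex `<=` `[0%R, 1%R]%classic `*` `[0%R, 1%R]%classic.
Proof.
move=> q /forall_ord3; rewrite /bary/= => -[h0 h1 h2].
by split; rewrite /= in_itv/=; apply/andP; split; lra.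
Qed.

Lemma simplex_measure_lty : (mu \x mu) simplex < +oo.
Proof.
apply: (@le_lt_trans _ _ ((mu \x mu) (`[0%R, 1%R]%classic `*` `[0%R, 1%R]%classic))).
  apply: le_measure; rewrite ?inE//; first exact: measurable_simplex.
  exact: measurableX.
rewrite product_measure1E//= !lebesgue_measure_itv/= lte_fin ltr01.
by rewrite oppr0 adde0 mule1 ltry.
Qed.

(** Summing [3^-1 <= max_ratio * bary] over the three coordinates gives a ratio of at least [1], so
    the integrand is at most [1] on a set of finite measure. *)
Lemma simplex_moment_lty k : simplex_moment k < +oo.
Proof.
apply: (@le_lt_trans _ _ (\int[mu \x mu]_(q in simplex) 1)); last first.
  by rewrite integral_cst ?mul1e ?simplex_measure_lty//; exact: measurable_simplex.
apply: ge0_le_integral => //.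
- exact: measurable_simplex.
- by move=> q _; rewrite lee_fin exprn_ge0// invr_ge0 sqr_ge0.
- apply: measurable_funTS; apply/measurable_EFinP; apply: measurable_funX.
  apply: (measurableT_comp (@measurable_invr R)).
  by apply: measurable_funX; exact: measurable_max_ratio.
move=> q qS; rewrite lee_fin exprn_ile1// ?invr_ge0 ?sqr_ge0//.
suff h : (1 <= max_ratio (fun=> 3^-1) q)%R.
  by rewrite invf_le1 ?exprn_ege1// exprn_gt0// (lt_le_trans ltr01).
have H m : (3^-1 <= max_ratio (fun=> 3^-1) q * bary q m)%R.
  by rewrite -ler_pdivrMr ?qS//; exact: le_bigmax.
have := H ord0; have := H (lift ord0 ord0); have := H (lift ord0 (lift ord0 ord0)).
rewrite /bary/=; move: (max_ratio _ q) => M.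
by rewrite !mulrBr; lra.
Qed.

Lemma simplex_moment_gt0 k : 0 < simplex_moment k.
Proof.
(* On this square all three barycentric coordinates are at least [1/4], so the ratio is at most
   [4/3] and the integrand at least [(9 / 16) ^+ k]. *)
pose B := (`[4^-1, 3 / 8]%classic `*` `[4^-1, 3 / 8]%classic : set (R * R))%R.
have mB : measurable B by exact: measurableX.
have BS : B `<=` simplex.
  move=> [q1 q2] [/=]; rewrite !in_itv/= => /andP[h1 h2] /andP[h3 h4].
  by apply/forall_ord3; rewrite /bary/=; split; lra.
have Bge m q : B q -> (4^-1 <= bary q m)%R.
  case: q => q1 q2 [/=]; rewrite !in_itv/= => /andP[h1 h2] /andP[h3 h4].
  move: m; apply/(@forall_ord3 (fun m => 4^-1 <= bary (q1, q2) m)%R).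
  by rewrite /bary/=; split; lra.
apply: (@lt_le_trans _ _ (\int[mu \x mu]_(q in B) ((9 / 16) ^+ k)%:E)).
  have BE : (mu \x mu) B = mu `[4^-1%R, (3 / 8)%R]%classic * mu `[4^-1%R, (3 / 8)%R]%classic.
    by apply: product_measure1E; exact: measurable_itv.
  have B0 : 0 < (mu \x mu) B.
    rewrite BE lebesgue_measure_itv/= lte_fin ifT; last by lra.
    by rewrite -!EFinB -EFinM lte_fin mulr_gt0//; lra.
  rewrite integral_cst//; apply: mule_gt0; last exact: B0.
  by rewrite lte_fin exprn_gt0// divr_gt0.
have mF : measurable_fun setT
    (fun q : R * R => (((max_ratio (fun=> 3^-1) q ^+ 2)^-1) ^+ k)%:E : \bar R).
  apply/measurable_EFinP; apply: measurable_funX.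
  apply: (measurableT_comp (@measurable_invr R)).
  by apply: measurable_funX; exact: measurable_max_ratio.
have F0 (q : R * R) : 0 <= (((max_ratio (fun=> 3^-1) q ^+ 2)^-1) ^+ k)%:E :> \bar R.
  by rewrite lee_fin exprn_ge0// invr_ge0 sqr_ge0.
apply: (@le_trans _ _ (\int[mu \x mu]_(q in B)
    (((max_ratio (fun=> 3^-1) q ^+ 2)^-1) ^+ k)%:E)).
  apply: ge0_le_integral => //.
  - exact: measurable_funTS.
  move=> q qB; rewrite lee_fin; apply: lerXn2r; rewrite ?nnegrE; [lra|by rewrite invr_ge0 sqr_ge0|].
  have h : (max_ratio (fun=> 3^-1) q <= 4 / 3)%R.
    apply: bigmax_le => [|m _]; first by lra.
    have := Bge m q qB; move: (bary q m) => u hu.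
    by rewrite ler_pdivrMr; lra.
  have h0 : (0 < max_ratio (fun=> 3^-1) q)%R.
    apply: lt_le_trans (_ : 3^-1 / bary q ord0 <= _)%R; last exact: le_bigmax.
    by rewrite divr_gt0//; exact: BS.
  rewrite (_ : (9 / 16 = ((4 / 3) ^+ 2)^-1)%R); last by rewrite expr2; field.
  have h43 : (0 < 4 / 3 :> R)%R by lra.
  rewrite lef_pV2 ?posrE ?exprn_gt0//.
  by apply: lerXn2r => //; rewrite nnegrE ltW.
apply: ge0_subset_integral => //; first exact: measurable_simplex.
exact: measurable_funTS.
Qed.

(* The tail events of [max_ratio a] are simplices whose size only depends on the
   sum of the [a m]. *)
Lemma integral_simplex_max_ratio (a : 'I_3 -> R) (k : nat) :
  (forall m, 0 <= a m)%R -> (0 < \sum_m a m)%R ->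
  \int[mu \x mu]_(q in simplex) (((max_ratio a q ^+ 2)^-1) ^+ k)%:E =
  simplex_moment k * ((((\sum_m a m) ^+ 2)^-1) ^+ k)%:E.
Proof.
move=> a0; set Z := (\sum_m a m)%R => Z0.
have [m0 am0] : (exists m, 0 < a m)%R.
  apply: contrapT => h; move: Z0; apply/negP; rewrite -leNgt.
  by apply: sumr_le0 => m _; rewrite leNgt; apply/negP => am; apply: h; exists m.
have mf b : measurable_fun setT (fun q : R * R => ((max_ratio b q ^+ 2)^-1)%:E : \bar R).
  apply/measurable_EFinP; apply: (measurableT_comp (@measurable_invr R)).
  by apply: measurable_funX; exact: measurable_max_ratio.
have f0 b (q : R * R) : 0 <= ((max_ratio b q ^+ 2)^-1)%:E :> \bar R.
  by rewrite lee_fin invr_ge0 sqr_ge0.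
pose g q := (((Z ^+ 2)^-1)%:E * ((max_ratio (fun=> 3^-1) q ^+ 2)^-1)%:E : \bar R).
have mg : measurable_fun setT g by exact: emeasurable_funM.
have g0 q : 0 <= g q by rewrite mule_ge0// lee_fin invr_ge0 sqr_ge0.
have mS := measurable_simplex.
transitivity (\int[mu \x mu]_(q in simplex) (`|((max_ratio a q ^+ 2)^-1)%:E| ^+ k)).
  by apply: eq_integral => q _; rewrite gee0_abs// EFin_expe.
transitivity (\int[mu \x mu]_(q in simplex) (`|g q| ^+ k)); last first.
  rewrite muleC /simplex_moment -ge0_integralZl//.
  - by apply: eq_integral => q _; rewrite gee0_abs// /g -EFinM -EFin_expe exprMn EFinM.
  - apply: measurable_funTS; apply/measurable_EFinP; apply: measurable_funX.
    by apply/measurable_EFinP; exact: mf.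
  - by move=> q _; rewrite lee_fin exprn_ge0// invr_ge0 sqr_ge0.
  - by rewrite lee_fin exprn_ge0// invr_ge0 sqr_ge0.
apply: (@eq_tail_integral _ _ _ _ _ _ _ _ _ _ _ (fun z => `|z| ^+ k)) => //.
- exact: mf.
- exact: measurable_expe_abse.
- by move=> z; apply: expe_ge0.
- exact: simplex_measure_lty.
move=> r r0.
have s0 : (0 < Num.sqrt r)%R by rewrite sqrtr_gt0.
transitivity ((mu \x mu) [set q | forall m, (Num.sqrt r * a m < bary q m)%R]).
  congr ((mu \x mu) _); apply/seteqP; split => [q [qS /=]|q h].
    by rewrite lte_fin => /max_ratio_gtP; apply => //; exists m0.
  have qS : simplex q.
    by move=> m; apply: le_lt_trans (h m); rewrite mulr_ge0 ?sqrtr_ge0.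
  by split => //=; rewrite lte_fin; apply/max_ratio_gtP => //; exists m0.
(* The three cuts are replaced by equal ones with the same total [Num.sqrt r * Z]; the tail event
   becomes that of the equal-weight ratio at level [r * Z ^+ 2]. *)
transitivity ((mu \x mu) [set q | forall m, (Num.sqrt r * Z * 3^-1 < bary q m)%R]).
  by apply: measure_bary_gt; rewrite -mulr_sumr -/Z [RHS]sum3; field.
have Z2 : (0 < Z ^+ 2)%R by rewrite exprn_gt0.
have rZ : (0 < r * Z ^+ 2)%R by rewrite mulr_gt0.
have sE : Num.sqrt (r * Z ^+ 2) = (Num.sqrt r * Z)%R.
  by rewrite sqrtrM ?ltW// sqrtr_sqr gtr0_norm.
have e3 : exists m : 'I_3, (0 < (fun=> 3^-1) m :> R)%R by exists ord0.
have gE q : (r%:E < g q) = (r * Z ^+ 2 < (max_ratio (fun=> 3^-1) q ^+ 2)^-1)%R.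
  by rewrite /g -EFinM lte_fin mulrC ltr_pdivlMr.
congr ((mu \x mu) _); apply/seteqP; split => [q h|q [qS /=]].
  have qS : simplex q.
    by move=> m; apply: le_lt_trans (h m); rewrite !mulr_ge0 ?sqrtr_ge0// ltW.
  by split => //=; rewrite gE; apply/max_ratio_gtP => // m; rewrite sE.
by rewrite gE => /(max_ratio_gtP rZ qS e3) h m; rewrite -sE.
Qed.

End simplex.

Section plane_lebesgue.
Local Open Scope ereal_scope.
Variable R : realType.
Local Notation mu := (@lebesgue_measure R).
Local Notation plane := (measurableTypeR R * measurableTypeR R)%type.

(* A name for the product measure, whose sigma-finiteness is not inferred. *)
Definition plane_lebesgue : set plane -> \bar R := mu \x mu.

HB.instance Definition _ := Measure.on plane_lebesgue.

Let plane_lebesgue_sigma_finite : sigma_finite setT plane_lebesgue.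
Proof.
pose I (n : nat) : set (measurableTypeR R) := `[- n%:R, n%:R]%classic%R.
exists (fun n => I n `*` I n).
  apply/seteqP; split => // -[a b] _.
  pose M : R := Num.max `|a : R|%R `|b : R|%R.
  pose n := (Num.truncn M).+1.
  have hn : (M <= n%:R)%R.
    have m0 : (0 <= M)%R by rewrite le_max normr_ge0.
    by have /andP[_ /ltW] := truncn_itv m0.
  move: hn; rewrite ge_max => /andP[ha hb].
  by exists n => //; split; rewrite /I /= in_itv/= -ler_norml.
move=> n; split; first by apply: measurableX; exact: measurable_itv.
have -> : plane_lebesgue (I n `*` I n) = mu (I n) * mu (I n).
  by apply: product_measure1E; exact: measurable_itv.
have -> : mu (I n) = (if (- n%:R < n%:R :> R)%R then (n%:R - - n%:R)%:E else 0).
  by rewrite /I lebesgue_measure_itv/= lte_fin.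
by case: ifP => _; rewrite ?mule0 ?ltry// -EFinM ltry.
Qed.

HB.instance Definition _ :=
  Measure_isSigmaFinite.Build _ _ _ plane_lebesgue plane_lebesgue_sigma_finite.

End plane_lebesgue.

(** * The moment formula for a triangle *)

Section L1_moment.
Local Open Scope ereal_scope.
Context (R : realType) d (Omega : measurableType d).
Variables (P : R * R -> probability Omega R) (X : R -> Omega -> R * R).
Hypothesis hX : forall x : R * R, planar_brownian_motion (P x) X x.
Variables (v : 'I_3 -> R * R) (c : 'I_3 -> R).
Hypotheses (sv : (\sum_m v m = 0)%R) (sc : (\sum_m c m = 1)%R).
Let m0 : 'I_3 := ord0.
Let m1 : 'I_3 := lift ord0 ord0.
Let del : R := ((v m0).1 * (v m1).2 - (v m0).2 * (v m1).1)%R.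
Hypothesis del0 : del != 0%R.

Local Notation mu := (@lebesgue_measure R).
Local Notation plane := (measurableTypeR R * measurableTypeR R)%type.
Let D := [set z | forall m, (dot (v m) z < c m)%R].

(* Barycentric coordinates, as an affine map onto the standard simplex. *)
Let phi : R * R -> R * R :=
  affine_map (- (v m0).1) (- (v m0).2) (c m0) (- (v m1).1) (- (v m1).2) (c m1).

Let phiE z m : bary (phi z) m = (c m - dot (v m) z)%R.
Proof.
have sv1 : (\sum_m (v m).1 = 0)%R.
  by rewrite -(@big_morph _ _ fst 0%R +%R 0%R +%R)// sv.
have sv2 : (\sum_m (v m).2 = 0)%R.
  by rewrite -(@big_morph _ _ snd 0%R +%R 0%R +%R)// sv.
move: sv1 sv2 sc; rewrite !big_ord_recl !big_ord0 !addr0 => h1 h2 h3.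
move: m; apply/(@forall_ord3 (fun m => bary (phi z) m = c m - dot (v m) z)%R).
rewrite /bary/phi/affine_map/dot/=; split; [ring|ring|].
set u := lift ord0 (lift ord0 ord0) in h1 h2 h3 *.
have -> : (v u).1 = (- (v m0).1 - (v m1).1)%R by rewrite /m0 /m1; lra.
have -> : (v u).2 = (- (v m0).2 - (v m1).2)%R by rewrite /m0 /m1; lra.
have -> : c u = (1 - c m0 - c m1)%R by rewrite /m0 /m1; lra.
ring.
Qed.

Let D_phi z : D z <-> simplex (phi z).
Proof.
by split=> h m; have := h m; rewrite phiE subr_gt0.
Qed.

Let vm0 : (0 < sqnorm (v m0))%R.
Proof.
rewrite lt_neqAle eq_sym addr_ge0 ?sqr_ge0// andbT.
apply: contra_neq del0 => /eqP; rewrite paddr_eq0 ?sqr_ge0// !sqrf_eq0.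
by move=> /andP[/eqP a /eqP b]; rewrite /del a b !mul0r subrr.
Qed.

(** All starting points are served by the motion under [P 0], so the integrals over the plane and
    over paths can be exchanged. For a fixed path, barycentric coordinates turn the plane integral
    into one over the simplex, with Jacobian [del]. *)
Lemma L1_exit_momentE (k : nat) :
  L1_exit_moment P X D k = (`|del|^-1)%:E * simplex_moment R k *
    \int[P 0%R]_w (((sup_sum X v w ^+ 2)^-1) ^+ k)%:E.
Proof.
pose A w m := rpath_sup X (v m) w.
have mA m : measurable_fun setT (A ^~ m) by exact: (measurable_rpath_sup (hX 0%R)).
pose H (z : plane * Omega) := (((max_ratio (A z.2) (phi z.1) ^+ 2)^-1) ^+ k)%R.
have mphi : measurable_fun setT phi by exact: measurable_affine_map.
have mH : measurable_fun setT H.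
  apply: measurable_funX; apply: (measurableT_comp (@measurable_invr R)).
  apply: measurable_funX; apply: measurable_bigmax => m; apply: measurable_funM.
    by apply: (measurableT_comp (mA m)).
  apply: (measurableT_comp (@measurable_invr R)).
  apply: (measurableT_comp (measurable_bary m)).
  by apply: (measurableT_comp mphi).
have H0 z : (0 <= H z)%R by rewrite exprn_ge0// invr_ge0 sqr_ge0.
have mD : measurable (D : set plane).
  rewrite (_ : D = setT `&` phi @^-1` @simplex R).
    by apply: mphi => //; exact: measurable_simplex.
  by rewrite setTI; apply/seteqP; split => z /D_phi.
pose F (z : plane * Omega) := ((\1_D z.1)%:E * (H z)%:E : \bar R).
have mF : measurable_fun setT F.
  apply: emeasurable_funM; last exact/measurable_EFinP.
  have mI : measurable_fun setT (\1_D : plane -> R) by exact: measurable_indic.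
  by apply/measurable_EFinP; exact: (measurableT_comp mI measurable_fst).
have F0 z : 0 <= F z by rewrite mule_ge0// lee_fin.
transitivity (\int[mu \x mu]_x \int[P 0%R]_w F (x, w)).
  rewrite /L1_exit_moment integral_mkcond; apply: eq_integral => x _.
  rewrite patchE; case: ifPn => xD; last first.
    rewrite (eq_integral (cst 0)) ?integral_cst ?mul0e//.
    by move=> w _; rewrite /F /= indicE (negbTE xD) mul0e.
  have Dx : D x by move: xD; rewrite inE.
  rewrite (exit_moment_hit_ratio (hX x) (hX 0%R) sv vm0 Dx).
  apply: eq_integral => w _; rewrite /F /= indicE xD mul1e; congr EFin.
  rewrite /H /hit_ratio /max_ratio; congr ((_ ^+ 2)^-1 ^+ k)%R.
  by apply: eq_bigr => m _; rewrite /= phiE.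
transitivity (\int[P 0%R]_w \int[mu \x mu]_x F (x, w)).
  exact: (@fubini_tonelli _ _ _ _ _ (@plane_lebesgue R) (P 0%R) F mF F0).
rewrite -ge0_integralZl//; first last.
- by rewrite mule_ge0// ?lee_fin ?invr_ge0// ltW// simplex_moment_gt0.
- by move=> w _; rewrite lee_fin exprn_ge0// invr_ge0 sqr_ge0.
- apply/measurable_EFinP; apply: measurable_funX.
  apply: (measurableT_comp (@measurable_invr R)).
  by apply: measurable_funX; exact: (measurable_sup_sum (hX 0%R)).
apply: ge0_ae_eq_integral_nonmeasurable.
- by move=> w; apply: integral_ge0 => x _; exact: F0.
- move=> w; rewrite mule_ge0//; last by rewrite lee_fin exprn_ge0// invr_ge0 sqr_ge0.
  by rewrite mule_ge0// ?lee_fin ?invr_ge0// ltW// simplex_moment_gt0.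
(* The simplex integral is evaluated only for paths with a positive supremum sum, which is almost
   all of them. *)
apply: filterS (sup_sum_ae_gt0 (hX 0%R) sv vm0) => w Z0.
pose G (q : R * R) := ((fun q => ((max_ratio (A w) q ^+ 2)^-1 ^+ k)%:E : \bar R) \_ (@simplex R)) q.
have mG : measurable_fun setT G.
  apply/measurable_restrict => //; first exact: measurable_simplex.
  apply: measurable_funTS; apply/measurable_EFinP; apply: measurable_funX.
  apply: (measurableT_comp (@measurable_invr R)).
  by apply: measurable_funX; exact: measurable_max_ratio.
have G0 q : 0 <= G q.
  by rewrite /G patchE; case: ifPn => // _; rewrite lee_fin exprn_ge0// invr_ge0 sqr_ge0.
have detE : (- (v m0).1 * - (v m1).2 - - (v m0).2 * - (v m1).1 = del)%R by rewrite /del; ring.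
transitivity ((`|del|^-1)%:E * \int[mu \x mu]_q G q); last first.
  rewrite -muleA; congr (_ * _); rewrite -[LHS]integral_mkcond.
  by apply: integral_simplex_max_ratio => // m; exact: rpath_sup_ge0.
rewrite (@integral_plane_affine _ (- (v m0).1) (- (v m0).2) (c m0) (- (v m1).1)
  (- (v m1).2) (c m1) G)//; last by rewrite detE.
rewrite detE muleA -EFinM mulVf ?normr_eq0// mul1e.
apply: eq_integral => x _; rewrite /F /G /= patchE -/phi indicE.
have -> : (x \in D) = (phi x \in @simplex R).
  by apply/idP/idP; rewrite !inE => /D_phi.
by case: ifPn => _; rewrite ?mul1e ?mul0e.
Qed.

End L1_moment.

(** * Determination of the law of the supremum sum *)

Section laplace.
Local Open Scope ereal_scope.
Context d (Omega : measurableType d) (R : realType) (P : probability Omega R).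

Lemma exprn_le_expR (x : R) (k : nat) : (0 <= x)%R -> (x ^+ k <= k`!%:R * expR x)%R.
Proof.
move=> x0; case: k => [|k].
  by rewrite expr0 fact0 mul1r -[leLHS](@expR0 R) ler_expR.
have kf : (0 < (k.+1)`!%:R :> R)%R by rewrite ltr0n fact_gt0.
rewrite mulrC -ler_pdivrMr//; apply: le_trans (expR_ge1Dxn k x0).
by rewrite lerDr.
Qed.

Section one_variable.
Variables (W : Omega -> R) (c : R).
Hypotheses (mW : measurable_fun setT W) (W0 : forall w, (0 <= W w)%R) (c0 : (0 < c)%R).
Hypothesis Wc : \int[P]_w (expR (c * W w))%:E < +oo.

(** Up to sign, the [k]-th derivative at [s] of the Laplace transform of [W]. *)
Definition laplace_moment (s : R) (k : nat) : \bar R :=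
  \int[P]_w (W w ^+ k * expR (- s * W w))%:E.

Let measurable_term (s : R) k : measurable_fun setT (fun w => (W w ^+ k * expR (s * W w)))%R.
Proof.
apply: measurable_funM; first exact: measurable_funX.
by apply: measurableT_comp => //; exact: measurable_funM.
Qed.

(** Half of the exponential moment absorbs [expR (s * W)], the other half absorbs the power; the
    constant [C] is [exprn_le_expR] at [c / 2 * W]. *)
Let integrable_term (s : R) (k : nat) : (s <= c / 2)%R ->
  P.-integrable setT (fun w => (W w ^+ k * expR (s * W w))%:E).
Proof.
move=> sc; pose C := (k`!%:R * (2 / c) ^+ k)%R.
have C0 : (0 <= C)%R by rewrite mulr_ge0// exprn_ge0// divr_ge0// ltW.
have mE : measurable_fun setT (fun w => (C * expR (c * W w))%:E).
  apply/measurable_EFinP; apply: measurable_funM => //.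
  by apply: measurableT_comp => //; exact: measurable_funM.
apply: (@le_integrable _ _ _ _ _ measurableT _ (fun w => (C * expR (c * W w))%:E)).
- by apply/measurable_EFinP; exact: measurable_term.
- move=> w _.
  have T0 : (0 <= W w ^+ k * expR (s * W w))%R by rewrite mulr_ge0 ?exprn_ge0 ?expR_ge0.
  have T1 : (0 <= C * expR (c * W w))%R by apply: mulr_ge0 => //; exact: expR_ge0.
  rewrite !gee0_abs ?lee_fin//.
  have h1 : (W w ^+ k <= C * expR (c / 2 * W w))%R.
    have y0 : (0 <= c / 2 * W w)%R by rewrite mulr_ge0// divr_ge0// ltW.
    have := exprn_le_expR k y0; rewrite exprMn => h.
    have ck : (0 < (c / 2) ^+ k)%R by rewrite exprn_gt0// divr_gt0.
    rewrite -(ler_pM2l ck); apply: (le_trans h).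
    have -> : C = (k`!%:R / (c / 2) ^+ k)%R.
      by rewrite /C -exprVn invf_div.
    rewrite mulrA mulrCA divff ?mulr1// gt_eqF//.
  apply: (@le_trans _ _ (C * expR (c / 2 * W w) * expR (c / 2 * W w))%R).
    apply: ler_pM => //; rewrite ?exprn_ge0 ?expR_ge0//.
    by rewrite ler_expR ler_wpM2r.
  rewrite -mulrA -expRD -mulrDl (_ : (c / 2 + c / 2 = c)%R)//.
  by field.
- apply/integrableP; split => //.
  under eq_integral => w _ do
    rewrite gee0_abs ?lee_fin ?(mulr_ge0 C0 (expR_ge0 _))// EFinM.
  rewrite ge0_integralZl//.
  + by rewrite lte_mul_pinfty// lee_fin.
  + apply/measurable_EFinP; apply: measurableT_comp => //; exact: measurable_funM.
Qed.

Lemma laplace_moment_fin s k : (0 <= s)%R -> laplace_moment s k \is a fin_num.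
Proof.
move=> s0; apply: integrable_fin_num => //; apply: integrable_term.
by apply: (@le_trans _ _ 0%R); rewrite ?oppr_le0// divr_ge0// ltW.
Qed.

(** Dominated convergence for the exponential series of [expR (- h * W)]: its partial sums are at
    most [expR (h * W)], integrable with any power of [W] up to [h = c / 2], a radius that does not
    depend on [s]. *)
Lemma laplace_moment_expansion (s h : R) (k : nat) :
  (0 <= s)%R -> (0 <= h)%R -> (h <= c / 2)%R ->
  \sum_(0 <= j < n) ((- h) ^+ j / j`!%:R)%:E * laplace_moment s (k + j) @[n --> \oo]
    --> laplace_moment (s + h) k.
Proof.
move=> s0 h0 hc.
have s_neg : (- s <= c / 2)%R.
  by apply: (@le_trans _ _ 0%R); rewrite ?oppr_le0// divr_ge0// ltW.
pose f n w := (W w ^+ k * expR (- s * W w) * series (exp_coeff (- h * W w)) n)%:E.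
have partial (x : R) n : (`|series (exp_coeff (- x)) n| <= series (exp_coeff `|x|) n)%R.
  rewrite /series/=; apply: (le_trans (ler_norm_sum _ _ _)).
  apply: ler_sum => i _; rewrite !exp_coeffE normrM normrX normrN.
  by rewrite ger0_norm ?invr_ge0.
have partial_exp (x : R) n : (0 <= x)%R -> (series (exp_coeff x) n <= expR x)%R.
  move=> x0; apply: nondecreasing_cvgn_le; last exact: is_cvg_series_exp_coeff.
  apply/nondecreasing_seqP => i; rewrite !seriesEnat/= big_nat_recr//= lerDl.
  exact: exp_coeff_ge0.
have fE n : \int[P]_w f n w =
    \sum_(0 <= j < n) ((- h) ^+ j / j`!%:R)%:E * laplace_moment s (k + j).
  have E w : f n w = \sum_(0 <= j < n) (((- h) ^+ j / j`!%:R)%:E *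
      (W w ^+ (k + j) * expR (- s * W w))%:E).
    rewrite /f seriesEnat/= mulr_sumr -sumEFin; apply: eq_bigr => j _.
    rewrite -EFinM exp_coeffE; congr EFin; rewrite exprMn exprD.
    by field; rewrite pnatr_eq0 -lt0n fact_gt0.
  under eq_integral do rewrite E.
  rewrite integral_sum//; last first.
    by move=> j; apply: integrableZl => //; exact: integrable_term.
  apply: eq_bigr => j _; rewrite integralZl//; exact: integrable_term.
have := @dominated_cvg _ _ _ P setT measurableT f
  (fun w => (W w ^+ k * expR (- (s + h) * W w))%:E)
  (fun w => (W w ^+ k * expR (h * W w))%:E).
rewrite (_ : (fun n => \int[P]_w f n w) =
  (fun n => \sum_(0 <= j < n) ((- h) ^+ j / j`!%:R)%:E * laplace_moment s (k + j))); last first.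
  by apply/funext => n; exact: fE.
apply => //.
- move=> n; apply/measurable_EFinP; apply: measurable_funM; first exact: measurable_term.
  rewrite /series/=; apply: measurable_sum => i.
  rewrite (_ : (fun w => _) = fun w => (i`!%:R^-1 * (- h * W w) ^+ i)%R).
    by apply: measurable_funM => //; apply: measurable_funX; exact: measurable_funM.
  by apply/funext => w; rewrite exp_coeffE.
- move=> w _; apply: cvg_EFin; first exact: nearW.
  rewrite opprD mulrDl expRD mulrA; apply: cvgMl_tmp.
  exact: is_cvg_series_exp_coeff.
- exact: integrable_term.
- move=> n w _; rewrite lee_fin !normrM [`|_ ^+ k|%R]ger0_norm ?exprn_ge0//.
  rewrite [`|expR _|%R]ger0_norm ?expR_ge0// -mulrA; apply: ler_wpM2l; first exact: exprn_ge0.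
  apply: (@le_trans _ _ (1 * expR (h * W w))%R); last by rewrite mul1r.
  apply: ler_pM => //.
    by rewrite -expR0 ler_expR mulNr oppr_le0 mulr_ge0.
  rewrite mulNr; apply: (le_trans (partial _ _)).
  by rewrite ger0_norm ?mulr_ge0//; apply: partial_exp; exact: mulr_ge0.
Qed.

End one_variable.

(* The Taylor expansions have a uniform radius, so they propagate the equality
   from [s = 0] to all [s >= 0]. *)
Lemma laplace_determined (W1 W2 : Omega -> R) (a1 a2 c : R) :
  measurable_fun setT W1 -> measurable_fun setT W2 ->
  (forall w, 0 <= W1 w)%R -> (forall w, 0 <= W2 w)%R -> (0 < c)%R ->
  \int[P]_w (expR (c * W1 w))%:E < +oo -> \int[P]_w (expR (c * W2 w))%:E < +oo ->
  (forall k, (1 <= k)%N ->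
    a1%:E * \int[P]_w (W1 w ^+ k)%:E = a2%:E * \int[P]_w (W2 w ^+ k)%:E) ->
  forall s k, (0 <= s)%R -> (1 <= k)%N ->
    a1%:E * laplace_moment W1 s k = a2%:E * laplace_moment W2 s k.
Proof.
move=> mW1 mW2 W10 W20 c0 Wc1 Wc2 mom.
have c2 : (0 < c / 2)%R by rewrite divr_gt0.
(* Induction on the number of intervals of length [c / 2]. Every order [k >= 1] is carried along,
   because the expansion of order [k] uses all orders [k + j], and none below [1]. *)
suff H n s k : (0 <= s)%R -> (s <= n%:R * (c / 2))%R -> (1 <= k)%N ->
    a1%:E * laplace_moment W1 s k = a2%:E * laplace_moment W2 s k.
  move=> s k s0 k1; apply: (H (Num.truncn (s / (c / 2))).+1) => //.
  rewrite -ler_pdivrMr//.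
  have y0 : (0 <= s / (c / 2))%R by rewrite divr_ge0// ltW.
  by have /andP[_ /ltW] := truncn_itv y0.
elim: n s k => [|n IH] s k s0 sn k1.
  have -> : s = 0%R by apply/eqP; rewrite eq_le s0 andbT; move: sn; rewrite mul0r.
  rewrite /laplace_moment oppr0.
  under eq_integral do rewrite mul0r expR0 mulr1.
  by under [in RHS]eq_integral do rewrite mul0r expR0 mulr1; exact: mom.
have [sc|cs] := leP s (n%:R * (c / 2))%R; first exact: IH.
pose s' := (n%:R * (c / 2))%R; pose h := (s - s')%R.
have s'0 : (0 <= s')%R by rewrite mulr_ge0// ltW.
have h0 : (0 <= h)%R by rewrite subr_ge0 ltW.
have hc : (h <= c / 2)%R.
  by rewrite /h lerBlDr addrC -[X in (_ <= X + _)%R]/(n%:R * (c / 2))%R -[X in (_ <= _ + X)%R]mul1r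
    -mulrDl natr1.
have sE : s = (s' + h)%R by rewrite /h addrC subrK.
have e1 := laplace_moment_expansion (k := k) mW1 W10 c0 Wc1 s'0 h0 hc.
have e2 := laplace_moment_expansion (k := k) mW2 W20 c0 Wc2 s'0 h0 hc.
have f1 := cvgeZl (isT : a1%:E \is a fin_num) e1.
have f2 := cvgeZl (isT : a2%:E \is a fin_num) e2.
rewrite sE.
have g1 := cvg_lim (@ereal_hausdorff R) f1.
have g2 := cvg_lim (@ereal_hausdorff R) f2.
rewrite -g1 -g2.
have EE : (fun n0 => a1%:E * \sum_(0 <= j < n0) ((- h) ^+ j / j`!%:R)%:E * laplace_moment W1 s' (k + j)) =
   (fun n0 => a2%:E * \sum_(0 <= j < n0) ((- h) ^+ j / j`!%:R)%:E * laplace_moment W2 s' (k + j)).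
  apply/funext => N.
  have fin W mW W0 Wc j := @laplace_moment_fin W c mW W0 c0 Wc s' j s'0.
  have F1 j : laplace_moment W1 s' j = (fine (laplace_moment W1 s' j))%:E.
    by rewrite fineK//; exact: fin.
  have F2 j : laplace_moment W2 s' j = (fine (laplace_moment W2 s' j))%:E.
    by rewrite fineK//; exact: fin.
  under eq_bigr do rewrite F1 -EFinM.
  under [in RHS]eq_bigr do rewrite F2 -EFinM.
  rewrite !sumEFin -!EFinM; congr EFin; rewrite !mulr_sumr; apply: eq_bigr => j _.
  have : a1%:E * laplace_moment W1 s' (k + j) = a2%:E * laplace_moment W2 s' (k + j).
    by apply: IH => //; rewrite (leq_trans k1)// leq_addr.
  rewrite F1 F2 -!EFinM => -[E].
  by rewrite mulrCA E mulrCA.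
by rewrite EE.
Qed.

End laplace.

Lemma mule_pIl (R : realType) (x y z : \bar R) : x \is a fin_num -> (0 < x)%E ->
  (x * y = x * z)%E -> y = z.
Proof.
move=> xfin x0 e; apply/eqP.
by rewrite eq_le -(lee_pmul2l xfin x0 y z) -(lee_pmul2l xfin x0 z y) e !lexx.
Qed.

(** * From the Laplace transform of the inverse square to positive moments *)

Section negative_moments.
Local Open Scope ereal_scope.
Variable R : realType.
Local Notation mu := (@lebesgue_measure R).

(** The power [s^(j/2)] on the half-line. The square root already vanishes for negative [s], but the
    indicator is needed for [j = 0], where the power would be [1]. *)
Definition half_power (j : nat) (s : R) : R := (\1_(`[0%R, +oo[%classic) s * Num.sqrt s ^+ j)%R.

Lemma half_power_ge0 j s : (0 <= half_power j s)%R.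
Proof. by rewrite mulr_ge0 ?exprn_ge0 ?sqrtr_ge0. Qed.

Lemma measurable_half_power j : measurable_fun setT (half_power j).
Proof.
apply: measurable_funM; first exact: measurable_indic.
apply: measurable_funX; apply: continuous_measurable_fun => s.
exact: sqrt_continuous.
Qed.

Lemma half_powerM j w s : (0 < w)%R ->
  half_power j (w * s) = (Num.sqrt w ^+ j * half_power j s)%R.
Proof.
move=> w0; rewrite /half_power sqrtrM ?ltW// exprMn mulrCA; congr (_ * _)%R.
congr (_ * _)%R; rewrite !indicE; congr (_ : bool)%:R.
by apply/idP/idP; rewrite !inE/= !in_itv/= !andbT pmulr_rge0.
Qed.

(** The value [Gamma (1 + j/2)]; only its being positive and finite is used. *)
Definition half_gamma (j : nat) : \bar R :=
  \int[mu]_s (half_power j s * expR (- s))%:E.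

Let measurable_integrand j (w : R) :
  measurable_fun setT (fun s => half_power j s * expR (- s * w))%R.
Proof.
apply: measurable_funM; first exact: measurable_half_power.
by apply: measurableT_comp => //; apply: measurable_funM => //; exact: measurableT_comp.
Qed.

Lemma half_gamma_lty j : half_gamma j < +oo.
Proof.
pose C : R := (1 + j`!%:R * 2 ^+ j)%R.
have C0 : (0 <= C)%R by rewrite addr_ge0// mulr_ge0// exprn_ge0.
(* Half of the decay [expR (- s)] pays for the power; what remains, [expR (- s / 2)], is twice the
   exponential density of rate [1/2]. *)
apply: (@le_lt_trans _ _ (\int[mu]_s ((C * 2)%:E * (exponential_pdf 2^-1 s)%:E))).
  apply: ge0_le_integral => //.
  - by move=> s _; rewrite lee_fin mulr_ge0 ?half_power_ge0 ?expR_ge0.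
  - apply/measurable_EFinP; have := measurable_integrand j 1.
    by under eq_fun do rewrite mulr1.
  - apply: emeasurable_funM => //; apply/measurable_EFinP.
    exact: measurable_exponential_pdf.
  move=> s _; rewrite -EFinM lee_fin.
  have [s0|s0] := leP 0%R s; last first.
    rewrite /half_power indicE memNset ?mul0r; last first.
      by rewrite /= in_itv/= andbT; apply/negP; rewrite -ltNge.
    by rewrite !mulr_ge0// exponential_pdf_ge0// invr_ge0.
  rewrite exponential_pdfE// /half_power indicE mem_set ?mul1r; last by rewrite /= in_itv/= s0.
  have h1 : (Num.sqrt s ^+ j <= 1 + s ^+ j)%R.
    have [s1|s1] := leP s 1%R.
      apply: (@le_trans _ _ 1%R); last by rewrite lerDl exprn_ge0.
      rewrite exprn_ile1 ?sqrtr_ge0//.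
      by rewrite -(@ler_pXn2r _ 2)// ?nnegrE ?sqrtr_ge0// sqr_sqrtr// expr1n.
    apply: (@le_trans _ _ (s ^+ j)%R); last by rewrite lerDr.
    apply: lerXn2r; rewrite ?nnegrE ?sqrtr_ge0//.
    rewrite -(@ler_pXn2r _ 2)// ?nnegrE ?sqrtr_ge0// sqr_sqrtr//.
    by rewrite expr2 ler_peMl// ltW.
  have h2 : (s ^+ j <= j`!%:R * 2 ^+ j * expR (s / 2))%R.
    have y0 : (0 <= s / 2)%R by rewrite divr_ge0.
    have := exprn_le_expR j y0; rewrite expr_div_n ler_pdivrMr ?exprn_gt0//.
    by rewrite mulrAC.
  have h3 : (1 <= expR (s / 2))%R by rewrite -expR0 ler_expR divr_ge0.
  have h4 : (Num.sqrt s ^+ j <= C * expR (s / 2))%R.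
    by apply: (le_trans h1); rewrite /C mulrDl mul1r lerD.
  apply: (@le_trans _ _ (C * expR (s / 2) * expR (- s))%R).
    by rewrite ler_wpM2r ?expR_ge0.
  rewrite -!mulrA -expRD mulVKf// le_eqVlt; apply/orP; left; apply/eqP.
  by congr (_ * expR _)%R; field.
rewrite ge0_integralZl//.
- by rewrite integral_exponential_pdf// mule1 ltry.
- by apply/measurable_EFinP; exact: measurable_exponential_pdf.
- by move=> s _; rewrite lee_fin exponential_pdf_ge0// invr_ge0.
- by rewrite lee_fin mulr_ge0.
Qed.

Lemma half_gamma_gt0 j : 0 < half_gamma j.
Proof.
apply: (@lt_le_trans _ _ (\int[mu]_(s in `[1%R, 2%R]%classic) (expR (- 2))%:E)).
  rewrite integral_cst//= lebesgue_measure_itv/= lte_fin ltr1n.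
  by rewrite -EFinB -EFinM lte_fin mulr_gt0 ?expR_gt0// subr_gt0 ltr1n.
have m1 : measurable_fun setT (fun s => (half_power j s * expR (- s))%:E).
  apply/measurable_EFinP; have := measurable_integrand j 1.
  by under eq_fun do rewrite mulr1.
apply: (@le_trans _ _ (\int[mu]_(s in `[1%R, 2%R]%classic) (half_power j s * expR (- s))%:E)).
  apply: ge0_le_integral => //.
  - exact: measurable_funTS.
  move=> s /=; rewrite in_itv/= => /andP[s1 s2]; rewrite lee_fin.
  rewrite -[leLHS]mul1r; apply: ler_pM => //.
    rewrite /half_power indicE mem_set ?mul1r; last by rewrite /= in_itv/= andbT (le_trans _ s1).
    by rewrite exprn_ege1// -(@ler_pXn2r _ 2)// ?nnegrE ?sqrtr_ge0// sqr_sqrtr ?expr1n// (le_trans _ s1).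
  by rewrite ler_expR lerN2.
apply: ge0_subset_integral => //.
by move=> s _; rewrite lee_fin mulr_ge0 ?half_power_ge0 ?expR_ge0.
Qed.

Lemma integral_half_power (j : nat) (w : R) : (0 < w)%R ->
  (w * Num.sqrt w ^+ j)%:E * \int[mu]_s (half_power j s * expR (- s * w))%:E = half_gamma j.
Proof.
move=> w0; rewrite /half_gamma.
have m1 : measurable_fun setT (fun s => (half_power j s * expR (- s))%:E).
  apply/measurable_EFinP; have := measurable_integrand j 1.
  by under eq_fun do rewrite mulr1.
have h0 s : 0 <= (half_power j s * expR (- s))%:E.
  by rewrite lee_fin mulr_ge0 ?half_power_ge0 ?expR_ge0.
rewrite [RHS](integral_affine 0 (lt0r_neq0 w0) m1 h0) (gtr0_norm w0) EFinM -muleA; congr (_ * _).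
rewrite -ge0_integralZl//.
- apply: eq_integral => s _; rewrite addr0 half_powerM// -EFinM; congr EFin.
  by rewrite mulrA mulNr [(s * w)%R]mulrC.
- by apply/measurable_EFinP; exact: measurable_integrand.
- by move=> s _; rewrite lee_fin mulr_ge0 ?half_power_ge0 ?expR_ge0.
Qed.

Context d (Omega : measurableType d) (P : probability Omega R).

(* With [W = Z^-2], integrating [s^(j/2) W exp (- s W)] over [s > 0] gives
   [Gamma (1 + j/2) Z^j]. *)
Lemma moment_laplace (Z : Omega -> R) (j : nat) :
  measurable_fun setT Z -> (forall w, 0 <= Z w)%R ->
  {ae P, forall w, (0 < Z w)%R} ->
  half_gamma j * \int[P]_w (Z w ^+ j)%:E =
  \int[mu]_s ((half_power j s)%:E * laplace_moment P (fun w => (Z w ^+ 2)^-1)%R s 1).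
Proof.
move=> mZ Z0 Zpos.
pose W w := ((Z w ^+ 2)^-1)%R.
have W0 w : (0 <= W w)%R by rewrite invr_ge0 sqr_ge0.
have mW : measurable_fun setT W.
  by apply: (measurableT_comp (@measurable_invr R)); exact: measurable_funX.
pose F (z : measurableTypeR R * Omega) : \bar R :=
  (half_power j z.1 * (W z.2 * expR (- z.1 * W z.2)))%:E.
have mF : measurable_fun setT F.
  apply/measurable_EFinP; apply: measurable_funM.
    by apply: (measurableT_comp (measurable_half_power j)).
  have mW2 : measurable_fun setT (fun z : measurableTypeR R * Omega => W z.2).
    exact: (measurableT_comp mW).
  apply: measurable_funM => //; apply: measurableT_comp => //.
  by apply: measurable_funM => //; apply: measurableT_comp => //.
have F0 z : 0 <= F z.
  by rewrite lee_fin !mulr_ge0 ?half_power_ge0 ?expR_ge0.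
transitivity (\int[mu]_s \int[P]_w F (s, w)); last first.
  apply: eq_integral => s _; rewrite /F /= /laplace_moment -ge0_integralZl//.
  - apply/measurable_EFinP; apply: measurable_funM; first exact: measurable_funX.
    by apply: measurableT_comp => //; apply: measurable_funM; [exact: measurable_cst|exact: mW].
  - by move=> w _; rewrite lee_fin mulr_ge0 ?expR_ge0 ?(W0 w).
  - by rewrite lee_fin half_power_ge0.
rewrite (@fubini_tonelli _ _ _ _ _ mu P F mF F0).
have hg0 : 0 <= half_gamma j by apply: ltW; exact: half_gamma_gt0.
rewrite -ge0_integralZl//; last 2 first.
- by apply/measurable_EFinP; exact: measurable_funX.
- by move=> w _; rewrite lee_fin exprn_ge0.
apply: ge0_ae_eq_integral_nonmeasurable.
- by move=> w; rewrite mule_ge0// lee_fin exprn_ge0.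
- by move=> w; apply: integral_ge0.
apply: filterS Zpos => w Zw.
have Ww : (0 < W w)%R by rewrite invr_gt0 exprn_gt0.
rewrite -(integral_half_power j Ww).
have sW : Num.sqrt (W w) = (Z w)^-1%R.
  by rewrite /W -exprVn sqrtr_sqr ger0_norm// invr_ge0.
have I0 : 0 <= \int[mu]_s (half_power j s * expR (- s * W w))%:E.
  by apply: integral_ge0 => s _; rewrite lee_fin mulr_ge0 ?half_power_ge0 ?expR_ge0.
rewrite muleAC -EFinM.
have -> : (W w * Num.sqrt (W w) ^+ j * Z w ^+ j = W w)%R.
  by rewrite sW -mulrA -exprMn mulVf ?gt_eqF// expr1n mulr1.
rewrite -ge0_integralZl//.
- by apply: eq_integral => s _; rewrite /F /= -EFinM mulrCA.
- by apply/measurable_EFinP; exact: measurable_integrand.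
- by move=> s _; rewrite lee_fin mulr_ge0 ?half_power_ge0 ?expR_ge0.
- by rewrite lee_fin ltW.
Qed.

(** The Laplace moments of order [1] agree on the half-line, and their integrals against
    [half_power j] are multiples of the positive moments. The conclusion includes [j = 0], which the
    hypothesis on [k] does not. *)
Lemma moments_determined (Z1 Z2 : Omega -> R) (a1 a2 c : R) :
  measurable_fun setT Z1 -> measurable_fun setT Z2 ->
  (forall w, 0 <= Z1 w)%R -> (forall w, 0 <= Z2 w)%R ->
  {ae P, forall w, (0 < Z1 w)%R} -> {ae P, forall w, (0 < Z2 w)%R} ->
  (0 <= a1)%R -> (0 <= a2)%R -> (0 < c)%R ->
  \int[P]_w (expR (c * (Z1 w ^+ 2)^-1))%:E < +oo ->
  \int[P]_w (expR (c * (Z2 w ^+ 2)^-1))%:E < +oo ->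
  (forall k, (1 <= k)%N ->
    a1%:E * \int[P]_w (((Z1 w ^+ 2)^-1) ^+ k)%:E =
    a2%:E * \int[P]_w (((Z2 w ^+ 2)^-1) ^+ k)%:E) ->
  forall j, a1%:E * \int[P]_w (Z1 w ^+ j)%:E = a2%:E * \int[P]_w (Z2 w ^+ j)%:E.
Proof.
move=> mZ1 mZ2 Z10 Z20 Z1p Z2p a10 a20 c0 e1 e2 mom j.
pose W (Z : Omega -> R) w := ((Z w ^+ 2)^-1)%R.
have mW Z : measurable_fun setT Z -> measurable_fun setT (W Z).
  by move=> mZ; apply: (measurableT_comp (@measurable_invr R)); exact: measurable_funX.
have W0 Z w : (0 <= W Z w)%R by rewrite invr_ge0 sqr_ge0.
have L := laplace_determined (mW _ mZ1) (mW _ mZ2) (W0 Z1) (W0 Z2) c0 e1 e2 mom.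
have hg0 := half_gamma_gt0 j; have hgy := half_gamma_lty j.
have hgfin : half_gamma j \is a fin_num by rewrite ge0_fin_numE// ltW.
have L0 Z s : 0 <= laplace_moment P (W Z) s 1.
  by apply: integral_ge0 => w _; rewrite lee_fin mulr_ge0 ?exprn_ge0 ?expR_ge0.
have mL Z : measurable_fun setT Z -> measurable_fun setT
    (fun s => (half_power j s)%:E * laplace_moment P (W Z) s 1).
  move=> mZ; apply: emeasurable_funM.
    by apply/measurable_EFinP; exact: measurable_half_power.
  pose F (z : measurableTypeR R * Omega) : \bar R :=
    (W Z z.2 ^+ 1 * expR (- z.1 * W Z z.2))%:E.
  have mF : measurable_fun setT F.
    apply/measurable_EFinP.
    have mW2 : measurable_fun setT (fun z : measurableTypeR R * Omega => W Z z.2).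
      exact: (measurableT_comp (mW _ mZ)).
    apply: measurable_funM; first exact: measurable_funX.
    apply: measurableT_comp => //.
    by apply: measurable_funM => //; apply: measurableT_comp => //.
  have F0 z : 0 <= F z by rewrite lee_fin mulr_ge0 ?exprn_ge0 ?expR_ge0.
  exact: (@measurable_fun_fubini_tonelli_F _ _ _ _ _ P _ mF F0).
have E (a : R) (Z : Omega -> R) : (0 <= a)%R -> measurable_fun setT Z -> (forall w, 0 <= Z w)%R ->
    {ae P, forall w, (0 < Z w)%R} ->
    half_gamma j * (a%:E * \int[P]_w (Z w ^+ j)%:E) =
    \int[mu]_s ((half_power j s)%:E * (a%:E * laplace_moment P (W Z) s 1)).
  move=> a0 mZ Z0 Zp; rewrite muleCA moment_laplace// -ge0_integralZl//.
  - by apply: eq_integral => s _; rewrite muleCA.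
  - exact: mL.
  - move=> s _; apply: mule_ge0; last exact: L0.
    by rewrite lee_fin half_power_ge0.
suff : half_gamma j * (a1%:E * \int[P]_w (Z1 w ^+ j)%:E) =
       half_gamma j * (a2%:E * \int[P]_w (Z2 w ^+ j)%:E).
  exact: mule_pIl.
rewrite (E a1 Z1 a10 mZ1 Z10 Z1p) (E a2 Z2 a20 mZ2 Z20 Z2p); apply: eq_integral => s _.
have [s0|s0] := leP 0%R s; first by rewrite L.
rewrite /half_power indicE memNset ?mul0r ?mul0e//.
by rewrite /= in_itv/= andbT; apply/negP; rewrite -ltNge.
Qed.

End negative_moments.

Section exponential_series.
Local Open Scope ereal_scope.
Context (R : realType) d (Omega : measurableType d) (P : probability Omega R).

Lemma expR_nneseries (y : R) : (0 <= y)%R ->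
  (expR y)%:E = \sum_(0 <= n <oo) (y ^+ n / n`!%:R)%:E.
Proof.
move=> y0; rewrite /expR -EFin_lim; last exact: is_cvg_series_exp_coeff.
apply: congr_lim; apply/funext => n /=; rewrite /series/= -sumEFin.
exact: eq_bigr.
Qed.

Lemma integral_expR_sq (Z : Omega -> R) (lam : R) : measurable_fun setT Z ->
  (forall w, 0 <= Z w)%R -> (0 <= lam)%R ->
  \int[P]_w (expR (lam * Z w ^+ 2))%:E =
  \sum_(0 <= n <oo) (lam ^+ n / n`!%:R)%:E * \int[P]_w (Z w ^+ (2 * n))%:E.
Proof.
move=> mZ Z0 lam0.
have l0 n : (0 <= lam ^+ n / n`!%:R)%R by rewrite divr_ge0 ?exprn_ge0.
transitivity (\int[P]_w \sum_(0 <= n <oo) ((lam ^+ n / n`!%:R) * Z w ^+ (2 * n))%:E).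
  apply: eq_integral => w _; rewrite expR_nneseries; last by rewrite mulr_ge0 ?sqr_ge0.
  by apply: eq_eseriesr => n _; rewrite exprMn -exprM mulrAC.
rewrite integral_nneseries//.
- apply: eq_eseriesr => n _; rewrite -ge0_integralZl//.
  + by apply/measurable_EFinP; exact: measurable_funX.
  + by move=> w _; rewrite lee_fin exprn_ge0.
  + by rewrite lee_fin; exact: l0.
- by move=> n; apply/measurable_EFinP; apply: measurable_funM => //; exact: measurable_funX.
- by move=> n w _; rewrite lee_fin mulr_ge0 ?exprn_ge0.
Qed.

End exponential_series.

(** * Geometric quantities read off the moments *)

Section moment_invariants.
Local Open Scope ereal_scope.
Context (R : realType).
Context d (Omega : measurableType d) (P : probability Omega R).
Variables (X : R -> Omega -> R * R) (x : R * R).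
Hypothesis hX : planar_brownian_motion P X x.

Lemma mean_sup_sum (v : 'I_3 -> R * R) :
  \int[P]_w (sup_sum X v w)%:E =
  (\sum_m Num.sqrt (sqnorm (v m)))%:E * \int[P]_w path_sup X (1, 0)%R w.
Proof.
transitivity (\int[P]_w \sum_m path_sup X (v m) w).
  apply: ge0_ae_eq_integral_nonmeasurable.
  - by move=> w; rewrite lee_fin sup_sum_ge0.
  - by move=> w; apply: sume_ge0 => m _; exact: path_sup_ge0.
  apply: filterS (chain_sum_ae_lty hX) => w Kw.
  rewrite /sup_sum -sumEFin; apply: eq_bigr => m _; exact: rpath_supE.
rewrite ge0_integral_sum//.
- rewrite -sumEFin ge0_sume_distrl//.
  by apply: eq_bigr => m _; exact: integral_path_sup hX _.
- by move=> m; exact: measurable_path_sup hX _.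
- by move=> m w _; exact: path_sup_ge0.
Qed.

Lemma mean_sup_sum_lty (v : 'I_3 -> R * R) : (\sum_m v m = 0)%R ->
  \int[P]_w (sup_sum X v w)%:E < +oo.
Proof.
move=> sv; pose S := (\sum_m sqnorm (v m))%R.
have s0 m : (0 <= sqnorm (v m))%R by rewrite addr_ge0 ?sqr_ge0.
have S0 : (0 <= S)%R by apply: sumr_ge0.
(* Small enough to stay below the threshold for every [m]; finiteness of the mean then follows from
   [z <= 1 + z ^+ 2] and [y <= expR y]. *)
pose lam := ((4 * (1 + S))^-1)%R.
have lam0 : (0 < lam)%R by rewrite invr_gt0 mulr_gt0// ltr_wpDr.
have lamS m : (lam * sqnorm (v m) < 2^-1)%R.
  have mS : (sqnorm (v m) <= S)%R.
    by rewrite /S (bigD1 m)//= lerDl sumr_ge0.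
  rewrite mulrC ltr_pdivrMr ?mulr_gt0 ?ltr_wpDr//; lra.
have fin := sup_sum_exp_moment_lty hX sv (ltW lam0) lamS.
have mZ := measurable_sup_sum hX v.
have mE := measurable_expR_sup_sum hX lam v.
apply: (@le_lt_trans _ _ (\int[P]_w (1 + lam^-1%:E * (expR (lam * sup_sum X v w ^+ 2))%:E))).
  apply: ge0_le_integral => //.
  - by move=> w _; rewrite lee_fin sup_sum_ge0.
  - exact/measurable_EFinP.
  - by apply: emeasurable_funD => //; exact: emeasurable_funM.
  move=> w _; rewrite -EFinM -EFinD lee_fin; set z := sup_sum X v w.
  have h : (lam * z ^+ 2 <= expR (lam * z ^+ 2))%R.
    by apply: le_trans (expR_ge1Dx _); rewrite lerDr.
  have h2 : (z ^+ 2 <= lam^-1 * expR (lam * z ^+ 2))%R.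
    by rewrite mulrC ler_pdivlMr// mulrC.
  apply: (@le_trans _ _ (1 + z ^+ 2)%R); last by rewrite lerD2l.
  have := sqr_ge0 (z - 1)%R; rewrite sqrrB expr1n mulr1.
  have := sqr_ge0 z; lra.
rewrite ge0_integralD//; last 2 first.
- by move=> w _; rewrite mule_ge0 ?lee_fin ?expR_ge0// invr_ge0 ltW.
- exact: emeasurable_funM.
rewrite integral_cst// mul1e ge0_integralZl//; last first.
- by rewrite lee_fin invr_ge0 ltW.
apply: lte_add_pinfty; first by rewrite (le_lt_trans (probability_le1 P measurableT))// ltry.
by apply: lte_mul_pinfty => //; rewrite lee_fin invr_ge0 ltW.
Qed.

Lemma mean_sup_sum_gt0 (v : 'I_3 -> R * R) (m : 'I_3) : (\sum_m v m = 0)%R ->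
  (0 < sqnorm (v m))%R -> 0 < \int[P]_w (sup_sum X v w)%:E.
Proof.
move=> sv vm.
have I0 : 0 <= \int[P]_w (sup_sum X v w)%:E.
  by apply: integral_ge0 => w _; rewrite lee_fin sup_sum_ge0.
rewrite lt_neqAle I0 andbT; apply/eqP => I.
have mZ := measurable_sup_sum hX v.
have : \int[P]_w `|(sup_sum X v w)%:E| = 0.
  by rewrite I; apply: eq_integral => w _; rewrite gee0_abs// lee_fin sup_sum_ge0.
move=> /ae_eq_integral_abs => /(_ measurableT) H.
have {}H : ae_eq P setT (fun w => (sup_sum X v w)%:E) (cst 0).
  by apply: H; exact/measurable_EFinP.
have : {ae P, forall w, False}.
  move: H (sup_sum_ae_gt0 hX sv vm) => H1 H2; near=> w.
  have h1 : (sup_sum X v w)%:E = 0 by apply: (near H1 w).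
  have h2 : (0 < sup_sum X v w)%R by near: w.
  by case: h1 h2 => ->; rewrite ltxx.
move=> [N [mN PN0 sub]].
have NT : N = setT by apply/seteqP; split => // w _; apply: sub => /=; tauto.
have : P setT = 0 by rewrite -NT.
by move/eqP; rewrite (probability_setT P) onee_eq0.
Unshelve. all: by end_near. Qed.

Lemma sup_sum_invariants (v1 v2 : 'I_3 -> R * R) (m1 m2 : 'I_3) (a1 a2 : R) :
  (\sum_m v1 m = 0)%R -> (\sum_m v2 m = 0)%R ->
  (0 < sqnorm (v1 m1))%R -> (0 < sqnorm (v2 m2))%R -> (0 < a1)%R ->
  (forall j, a1%:E * \int[P]_w (sup_sum X v1 w ^+ j)%:E =
             a2%:E * \int[P]_w (sup_sum X v2 w ^+ j)%:E) ->
  [/\ a1 = a2,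
      (\sum_m Num.sqrt (sqnorm (v1 m)) = \sum_m Num.sqrt (sqnorm (v2 m)))%R,
      (forall m, exists n, (sqnorm (v1 m) <= sqnorm (v2 n))%R) &
      (forall m, exists n, (sqnorm (v2 m) <= sqnorm (v1 n))%R)].
Proof.
move=> sv1 sv2 v1m v2m a10 mom.
have a12 : a1 = a2.
  have E0 v : \int[P]_w (sup_sum X v w ^+ 0)%:E = 1.
    transitivity (\int[P]_w 1%:E); first by apply: eq_integral => w _; rewrite expr0.
    by rewrite integral_cst// mul1e; exact: probability_setT.
  by have := mom 0%N; rewrite !E0 !mule1 => -[].
have {}mom j : \int[P]_w (sup_sum X v1 w ^+ j)%:E = \int[P]_w (sup_sum X v2 w ^+ j)%:E.
  by apply: (@mule_pIl _ a1%:E) => //; rewrite (mom j) a12.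
have expE lam : (0 <= lam)%R -> \int[P]_w (expR (lam * sup_sum X v1 w ^+ 2))%:E =
    \int[P]_w (expR (lam * sup_sum X v2 w ^+ 2))%:E.
  move=> lam0.
  have m1' := measurable_sup_sum hX v1; have m2' := measurable_sup_sum hX v2.
  rewrite (integral_expR_sq P m1' (sup_sum_ge0 X v1) lam0).
  rewrite (integral_expR_sq P m2' (sup_sum_ge0 X v2) lam0).
  by apply: eq_eseriesr => n _; rewrite mom.
have maxE (u u' : 'I_3 -> R * R) m : (\sum_m u m = 0)%R -> (\sum_m u' m = 0)%R ->
    (forall lam, (0 <= lam)%R -> \int[P]_w (expR (lam * sup_sum X u w ^+ 2))%:E =
    \int[P]_w (expR (lam * sup_sum X u' w ^+ 2))%:E) ->
    exists n, (sqnorm (u m) <= sqnorm (u' n))%R.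
  move=> su su' uE; apply: contrapT => /forallNP no.
  have lt n : (sqnorm (u' n) < sqnorm (u m))%R.
    by rewrite ltNge; apply/negP; exact: no.
  have um : (0 < sqnorm (u m))%R.
    by apply: le_lt_trans (lt m); rewrite addr_ge0 ?sqr_ge0.
  (* The critical exponent for [u m]: the moment of [u] diverges there, while that of [u'] would
     converge if all its vectors were shorter. *)
  pose lam := (2^-1 / sqnorm (u m))%R.
  have lam0 : (0 < lam)%R by rewrite divr_gt0.
  have h : (2^-1 <= lam * sqnorm (u m))%R by rewrite divfK// gt_eqF.
  have h' n : (lam * sqnorm (u' n) < 2^-1)%R.
    by rewrite mulrAC ltr_pdivrMr// ltr_pM2l.
  have := sup_sum_exp_moment_lty hX su' (ltW lam0) h'.
  by rewrite -uE ?ltW// (sup_sum_exp_moment_eqy hX su (ltW lam0) h).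
split=> //.
- have := mom 1%N.
  have e1 := mean_sup_sum_gt0 sv1 v1m; have e2 := mean_sup_sum_lty sv1.
  have sp (v : 'I_3 -> R * R) m : (0 < sqnorm (v m))%R ->
      (0 < \sum_m Num.sqrt (sqnorm (v m)))%R.
    move=> vm; rewrite (bigD1 m)//=; apply: ltr_pwDl; first by rewrite sqrtr_gt0.
    by apply: sumr_ge0 => ? _; exact: sqrtr_ge0.
  move: e1 e2; rewrite !mean_sup_sum; set c0 := \int[P]_w _.
  have s1 := sp _ _ v1m; have s2 := sp _ _ v2m.
  have : 0 <= c0 by apply: integral_ge0 => w _; exact: path_sup_ge0.
  (* The mean supremum along one axis can be cancelled because it is nonzero and finite, both
     inferred from the bounds on the mean of the sum. *)
  case: c0 => [c0| |]//= _.
    rewrite -!EFinM lte_fin => h _ [] e.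
    apply: (mulIf _ e); apply: contraTneq h => ->; by rewrite mulr0 ltxx.
  by rewrite gt0_muley ?lte_fin// ltxx.
- by move=> m; exact: maxE _ _ m sv1 sv2 expE.
- by move=> m; exact: maxE _ _ m sv2 sv1 (fun lam lam0 => esym (expE lam lam0)).
Qed.

End moment_invariants.

(** * Triangles *)

Section triangles.
Variable R : realType.
Implicit Types a b c p q z v : R * R.

Definition signed_area2 a b c : R :=
  (b.1 - a.1) * (c.2 - a.2) - (b.2 - a.2) * (c.1 - a.1).

Definition open_triangle a b c : set (R * R) :=
  [set q | exists r s t : R,
    [/\ 0 < r, 0 < s, 0 < t, r + s + t = 1
      & q = r *: a + s *: b + t *: c]].

Lemma open_triangle_swap a b c : open_triangle a b c = open_triangle b a c.
Proof.
apply/seteqP; split => q [r [s [t [r0 s0 t0 e ->]]]]; exists s, r, t;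
  by split=> //; rewrite 1?(addrC s)// (addrC (s *: _)).
Qed.

Lemma open_triangle_rot a b c : open_triangle a b c = open_triangle b c a.
Proof.
apply/seteqP; split => q [r [s [t [r0 s0 t0 e ->]]]].
  by exists s, t, r; split=> //; [rewrite -e; ring|rewrite -addrA addrC].
by exists t, r, s; split=> //; [rewrite -e; ring|rewrite addrC addrA].
Qed.

Lemma signed_area2_swap a b c : signed_area2 b a c = - signed_area2 a b c.
Proof. rewrite /signed_area2; ring. Qed.

Lemma signed_area2_rot a b c : signed_area2 b c a = signed_area2 a b c.
Proof. rewrite /signed_area2; ring. Qed.

Lemma signed_area2_eq0_collinear a b c : signed_area2 a b c = 0 -> collinear a b c.
Proof.
have main p q v : v != 0 -> v.1 * (q.2 - p.2) = v.2 * (q.1 - p.1) -> affine_line p v q.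
  move=> v0 h; have [v1|v1] := eqVneq v.1 0.
    have v2 : v.2 != 0.
      by apply: contraNneq v0 => v2; apply/eqP; exact: injective_projections.
    exists ((q.2 - p.2) / v.2).
    have /eqP := h; rewrite v1 mul0r eq_sym mulf_eq0 (negbTE v2)/= subr_eq0 => /eqP qp.
    apply: injective_projections; rewrite /= /GRing.scale/=.
      by rewrite v1 mulr0 addr0.
    by rewrite divfK// addrC subrK.
  exists ((q.1 - p.1) / v.1); apply: injective_projections; rewrite /= /GRing.scale/=.
    by rewrite divfK// addrC subrK.
  suff -> : (q.1 - p.1) / v.1 * v.2 = q.2 - p.2 by rewrite addrC subrK.
  by apply: (mulfI v1); rewrite h; field.
rewrite /signed_area2 => h.
have self p v : affine_line p v p by exists 0; rewrite scale0r addr0.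
have [ba|ba] := eqVneq (b - a) 0.
  have [ca|ca] := eqVneq (c - a) 0.
    have v0 : (1, 0) != 0 :> R * R.
      by apply/eqP => -[/eqP]; rewrite oner_eq0.
    move/eqP: ba ca; rewrite subr_eq0 => /eqP -> /eqP; rewrite subr_eq0 => /eqP ->.
    by exists a, (1, 0); split.
  exists a, (c - a); split=> //; apply: main => //.
    by move/eqP: ba; rewrite subr_eq0 => /eqP ->; rewrite !subrr !mulr0.
  by rewrite mulrC.
exists a, (b - a); split=> //; apply: main => //.
  by rewrite mulrC.
by move/eqP: h; rewrite subr_eq0 => /eqP.
Qed.

Section barycentric.
Variables a b c : R * R.
Hypothesis D0 : signed_area2 a b c != 0.

(* The barycentric coordinates are [bary_cst m - dot (bary_vec m) z], and
   [bary_vec m] is the side opposite to the vertex [m], turned by a right angle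
   and divided by twice the area. *)
Definition bary_vec (m : 'I_3) : R * R :=
  let n p q := ((q.2 - p.2) / signed_area2 a b c, (p.1 - q.1) / signed_area2 a b c) in
  nth 0 [:: n b c; n c a; n a b] m.

Definition bary_cst (m : 'I_3) : R :=
  let n p q := (p.1 * q.2 - p.2 * q.1) / signed_area2 a b c in
  nth 0 [:: n b c; n c a; n a b] m.

Definition bary_coord (m : 'I_3) (z : R * R) : R := bary_cst m - dot (bary_vec m) z.

Lemma sum_bary_vec : \sum_m bary_vec m = 0.
Proof.
rewrite !big_ord_recl big_ord0 /bary_vec/= addr0.
by apply: injective_projections => /=; rewrite -?mulrDl; ring.
Qed.

Lemma sum_bary_cst : \sum_m bary_cst m = 1.
Proof.
rewrite !big_ord_recl big_ord0 /bary_cst/= addr0 -!mulrDl.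
apply: (canLR (mulfK D0)); rewrite mul1r /signed_area2; ring.
Qed.

Lemma sum_bary_coord z : \sum_m bary_coord m z = 1.
Proof.
rewrite big_split/= sum_bary_cst -[RHS]addr0; congr (_ + _).
rewrite sumrN /dot big_split/= -!mulr_suml.
have [e1 e2] : \sum_m (bary_vec m).1 = 0 /\ \sum_m (bary_vec m).2 = 0.
  by have := sum_bary_vec; rewrite !big_ord_recl !big_ord0 => -[].
by rewrite e1 e2 !mul0r addr0 oppr0.
Qed.

Lemma bary_coordK z : z = bary_coord ord0 z *: a + bary_coord (lift ord0 ord0) z *: b +
  bary_coord (lift ord0 (lift ord0 ord0)) z *: c.
Proof.
move: D0; rewrite /bary_coord /bary_cst /bary_vec /dot /signed_area2 => d0.
by apply: injective_projections => /=; rewrite /GRing.scale/=; field.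
Qed.

Lemma bary_coord_comb r s t : r + s + t = 1 ->
  [/\ bary_coord ord0 (r *: a + s *: b + t *: c) = r,
      bary_coord (lift ord0 ord0) (r *: a + s *: b + t *: c) = s &
      bary_coord (lift ord0 (lift ord0 ord0)) (r *: a + s *: b + t *: c) = t].
Proof.
move=> e; have -> : r = 1 - s - t by rewrite -e; ring.
move: D0; rewrite /bary_coord /bary_cst /bary_vec /dot /signed_area2 => d0.
by split; rewrite /= /GRing.scale/=; field.
Qed.

Lemma open_triangleE :
  open_triangle a b c = [set z | forall m, dot (bary_vec m) z < bary_cst m].
Proof.
apply/seteqP; split => z.
  move=> [r [s [t [r0 s0 t0 e ->]]]].
  have [h0 h1 h2] := bary_coord_comb e.
  by apply/forall_ord3; split; rewrite -subr_gt0 -/(bary_coord _ _) ?h0 ?h1 ?h2.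
move=> /forall_ord3[h0 h1 h2].
exists (bary_coord ord0 z), (bary_coord (lift ord0 ord0) z),
  (bary_coord (lift ord0 (lift ord0 ord0)) z).
split; rewrite ?subr_gt0//; last exact: bary_coordK.
by have := sum_bary_coord z; rewrite !big_ord_recl big_ord0 addr0 addrA.
Qed.

Lemma closed_triangleE :
  closed_triangle a b c = [set z | forall m, dot (bary_vec m) z <= bary_cst m].
Proof.
apply/seteqP; split => z.
  move=> [r [s [t [r0 s0 t0 e ->]]]].
  have [h0 h1 h2] := bary_coord_comb e.
  by apply/forall_ord3; split; rewrite -subr_ge0 -/(bary_coord _ _) ?h0 ?h1 ?h2.
move=> /forall_ord3[h0 h1 h2].
exists (bary_coord ord0 z), (bary_coord (lift ord0 ord0) z),
  (bary_coord (lift ord0 (lift ord0 ord0)) z).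
split; rewrite ?subr_ge0//; last exact: bary_coordK.
by have := sum_bary_coord z; rewrite !big_ord_recl big_ord0 addr0 addrA.
Qed.

Lemma sqnorm_bary_vec :
  [/\ sqnorm (bary_vec ord0) = sqnorm (b - c) / signed_area2 a b c ^+ 2,
      sqnorm (bary_vec (lift ord0 ord0)) = sqnorm (c - a) / signed_area2 a b c ^+ 2 &
      sqnorm (bary_vec (lift ord0 (lift ord0 ord0))) = sqnorm (a - b) / signed_area2 a b c ^+ 2].
Proof.
move: D0; rewrite /sqnorm /bary_vec/=; set D := signed_area2 a b c => d0.
by split; field.
Qed.

Lemma sqnorm_side_gt0 : [/\ 0 < sqnorm (b - c), 0 < sqnorm (c - a) & 0 < sqnorm (a - b)].
Proof.
have h v : v != 0 -> 0 < sqnorm v.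
  move=> v0; rewrite lt_neqAle addr_ge0 ?sqr_ge0// andbT eq_sym.
  apply: contraNneq v0 => /eqP; rewrite paddr_eq0 ?sqr_ge0// !sqrf_eq0.
  by move=> /andP[/eqP v1 /eqP v2]; apply/eqP; exact: injective_projections.
split; apply: h; apply: contraNneq D0 => /eqP; rewrite subr_eq0 => /eqP e;
  rewrite /signed_area2 e; apply/eqP; ring.
Qed.

Lemma interior_closed_triangle : interior (closed_triangle a b c) = open_triangle a b c.
Proof.
rewrite closed_triangleE open_triangleE; apply/seteqP; split => z.
  move=> hz m.
  have hz0 : nbhs z [set y | dot (bary_vec m) y <= bary_cst m].
    by apply: filterS hz => y /=; apply.
  (* Moving along [bary_vec m] lowers the [m]-th coordinate at the rate [sqnorm (bary_vec m)], so at
     an interior point this coordinate cannot be zero. *)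
  pose g (e : R) : R * R := z + e *: bary_vec m.
  have gc : {for 0, continuous g}.
    by apply: cvgD; [exact: cvg_cst|apply: cvgZr_tmp; exact: cvg_id].
  have g0 : g 0 = z by rewrite /g scale0r addr0.
  have : \forall e \near (0:R), dot (bary_vec m) (g e) <= bary_cst m.
    by apply: (gc [set y | dot (bary_vec m) y <= bary_cst m]); rewrite g0.
  move=> /nbhs_ballP[r /= r0 hr].
  have : dot (bary_vec m) (g (r / 2)) <= bary_cst m.
    apply: hr; rewrite /ball/= sub0r normrN gtr0_norm ?divr_gt0//.
    by rewrite ltr_pdivrMr// ltr_pMr// ltr1n.
  apply: lt_le_trans; rewrite /dot /g/= /GRing.scale/=.
  have vm : 0 < sqnorm (bary_vec m).
    have [s0 s1 s2] := sqnorm_side_gt0; have [e0 e1 e2] := sqnorm_bary_vec.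
    have d2 : 0 < signed_area2 a b c ^+ 2 by rewrite exprn_even_gt0.
    by move: m {hz hz0 g gc g0 hr}; apply/forall_ord3; rewrite e0 e1 e2 !divr_gt0.
  rewrite -subr_gt0.
  have -> : (bary_vec m).1 * (z.1 + r / 2 * (bary_vec m).1) +
    (bary_vec m).2 * (z.2 + r / 2 * (bary_vec m).2) -
    ((bary_vec m).1 * z.1 + (bary_vec m).2 * z.2) = r / 2 * sqnorm (bary_vec m).
    by rewrite /sqnorm; ring.
  by rewrite mulr_gt0// divr_gt0.
move=> hz; rewrite /interior/=.
have hm m : \forall y \near z, dot (bary_vec m) y < bary_cst m.
  have c1 : dot (bary_vec m) y @[y --> z] --> dot (bary_vec m) z by exact: continuous_dot.
  exact: (cvgr_lt _ c1).
apply: filterS3 (hm ord0) (hm (lift ord0 ord0)) (hm (lift ord0 (lift ord0 ord0))).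
by move=> y h0 h1 h2; apply/forall_ord3; split; exact: ltW.
Qed.

End barycentric.
End triangles.

(** * Congruence of triangles *)

Section congruence.
Variable R : realType.
Implicit Types a b c p q : R * R.

Lemma sqnorm_distC p q : sqnorm (p - q) = sqnorm (q - p).
Proof. rewrite /sqnorm/=; ring. Qed.

(** The vertices are relabelled so that the opposite sides decrease; the longest side then faces the
    first vertex, which removes the ambiguity of order when two triangles are compared. *)
Lemma triangular_domain_sorted (D : set (R * R)) : triangular_domain D ->
  exists a b c, [/\ signed_area2 a b c != 0, D = open_triangle a b c,
    sqnorm (c - a) <= sqnorm (b - c) & sqnorm (a - b) <= sqnorm (c - a)].
Proof.
move=> [a [b [c [nc DE]]]].
have d0 : signed_area2 a b c != 0.
  by apply/eqP => /signed_area2_eq0_collinear.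
rewrite {}DE interior_closed_triangle// => {nc}.
have swap p q r : signed_area2 p q r != 0 -> signed_area2 q p r != 0.
  by rewrite (signed_area2_swap p) oppr_eq0.
have rot p q r : signed_area2 p q r != 0 -> signed_area2 q r p != 0.
  by rewrite (signed_area2_rot p).
have E1 := sqnorm_distC a b; have E2 := sqnorm_distC b c; have E3 := sqnorm_distC c a.
have ab := open_triangle_swap a b c; have bc := open_triangle_rot a b c.
have ca := open_triangle_rot b c a.
have ba := open_triangle_rot b a c; have ac := open_triangle_rot a c b.
have [h1|h1] := leP (sqnorm (c - a)) (sqnorm (b - c));
have [h2|h2] := leP (sqnorm (a - b)) (sqnorm (c - a));
have [h3|h3] := leP (sqnorm (a - b)) (sqnorm (b - c)).
all: try solve [exfalso; lra].
all: first
  [ by exists a, b, c; split; [|by []|lra|lra]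
  | by exists b, c, a; split; [exact: rot|exact: bc|lra|lra]
  | by exists c, a, b; split; [exact/rot/rot|rewrite bc|lra|lra]
  | by exists b, a, c; split; [exact: swap|exact: ab|lra|lra]
  | by exists a, c, b; split; [exact/rot/swap|rewrite ab|lra|lra]
  | by exists c, b, a; split; [exact/rot/rot/swap|rewrite ab ba|lra|lra]
  ].
Qed.

(* The squared length of a combination with zero total weight only depends on
   the side lengths; hence matching barycentric coordinates is an isometry. *)
Lemma sqnorm_zero_sum_comb (q : 'I_3 -> R) a b c : \sum_m q m = 0 ->
  sqnorm (q ord0 *: a + q (lift ord0 ord0) *: b + q (lift ord0 (lift ord0 ord0)) *: c) =
  - (q (lift ord0 ord0) * q (lift ord0 (lift ord0 ord0)) * sqnorm (b - c) +
     q (lift ord0 (lift ord0 ord0)) * q ord0 * sqnorm (c - a) +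
     q ord0 * q (lift ord0 ord0) * sqnorm (a - b)).
Proof.
rewrite !big_ord_recl big_ord0 addr0.
set r := q ord0; set s := q _; set t := q _ => e.
have -> : r = - s - t by lra.
rewrite /sqnorm /= /GRing.scale/=; ring.
Qed.

(** The isometry keeps barycentric coordinates while the vertices change. It is defined on the whole
    plane, and differences of points are combinations of weight zero, to which
    [sqnorm_zero_sum_comb] applies. *)
Lemma isometric_open_triangle a b c a' b' c' :
  signed_area2 a b c != 0 ->
  sqnorm (b - c) = sqnorm (b' - c') -> sqnorm (c - a) = sqnorm (c' - a') ->
  sqnorm (a - b) = sqnorm (a' - b') ->
  isometric_domains (open_triangle a b c) (open_triangle a' b' c').
Proof.
move=> d0 e1 e2 e3; pose p m := bary_coord a b c m.
pose comb (u v w : R * R) (r : 'I_3 -> R) :=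
  r ord0 *: u + r (lift ord0 ord0) *: v + r (lift ord0 (lift ord0 ord0)) *: w.
have combB u v w r r' : comb u v w r - comb u v w r' = comb u v w (fun m => r m - r' m).
  by rewrite /comb; apply: injective_projections; rewrite /= /GRing.scale/=; ring.
pose f z := comb a' b' c' (p ^~ z).
exists f.
  have distE y z : euclidean_dist y z = Num.sqrt (sqnorm (y - z)) by [].
  move=> y z; rewrite !distE; congr Num.sqrt.
  rewrite /f combB {2}(bary_coordK d0 y) {2}(bary_coordK d0 z).
  rewrite -/(comb a b c (p ^~ y)) -/(comb a b c (p ^~ z)) combB.
  by rewrite !sqnorm_zero_sum_comb ?e1 ?e2 ?e3// sumrB !sum_bary_coord// subrr.
apply/seteqP; split => z.
  move=> [r [s [t [r0 s0 t0 e ->]]]].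
  exists (r *: a + s *: b + t *: c); first by exists r, s, t.
  by have [h0 h1 h2] := bary_coord_comb d0 e; rewrite /f /comb /p h0 h1 h2.
move=> [_ [r [s [t [r0 s0 t0 e ->]]]] <-].
have [h0 h1 h2] := bary_coord_comb d0 e.
by exists r, s, t; split=> //; rewrite /f /comb /p h0 h1 h2.
Qed.

(** Heron's formula for sixteen times the squared area, grouped so that [y] and [z] enter only
    through their sum and difference. *)
Lemma heron a b c (x y z : R) : x ^+ 2 = sqnorm (b - c) -> y ^+ 2 = sqnorm (c - a) ->
  z ^+ 2 = sqnorm (a - b) ->
  4 * signed_area2 a b c ^+ 2 = ((y + z) ^+ 2 - x ^+ 2) * (x ^+ 2 - (y - z) ^+ 2).
Proof.
move=> ex ey ez.
have -> : ((y + z) ^+ 2 - x ^+ 2) * (x ^+ 2 - (y - z) ^+ 2) =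
  2 * (x ^+ 2 * y ^+ 2 + y ^+ 2 * z ^+ 2 + z ^+ 2 * x ^+ 2) -
  ((x ^+ 2) ^+ 2 + (y ^+ 2) ^+ 2 + (z ^+ 2) ^+ 2) by ring.
rewrite ex ey ez /sqnorm /signed_area2/=; ring.
Qed.

(** The first factor depends only on [x] and [y + z] and is nonzero, so the second fixes the square
    of [y - z]; the ordering fixes its sign. *)
Lemma heron_determined (x y z y' z' : R) : z <= y -> z' <= y' -> y + z = y' + z' ->
  0 < ((y + z) ^+ 2 - x ^+ 2) * (x ^+ 2 - (y - z) ^+ 2) ->
  ((y + z) ^+ 2 - x ^+ 2) * (x ^+ 2 - (y - z) ^+ 2) =
  ((y' + z') ^+ 2 - x ^+ 2) * (x ^+ 2 - (y' - z') ^+ 2) ->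
  y = y' /\ z = z'.
Proof.
move=> zy zy' e pos; rewrite -e => h.
have k : (y + z) ^+ 2 - x ^+ 2 != 0.
  by apply: contraTneq pos => ->; rewrite mul0r ltxx.
have /addrI/oppr_inj/eqP := mulfI k h.
rewrite eqrXn2 ?subr_ge0// => /eqP h2.
by split; lra.
Qed.

End congruence.

Lemma bary_vec_det (R : realType) (a b c : R * R) : signed_area2 a b c != 0 ->
  (bary_vec a b c ord0).1 * (bary_vec a b c (lift ord0 ord0)).2 -
  (bary_vec a b c ord0).2 * (bary_vec a b c (lift ord0 ord0)).1 = (signed_area2 a b c)^-1.
Proof. by rewrite /bary_vec /signed_area2/= => d0; field. Qed.

(** * Invariants of triangles with equal spectra *)

Section equal_spectra.
Local Open Scope ereal_scope.
Variables (R : realType) (d : measure_display) (Omega : measurableType d).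
Variables (P : R * R -> probability Omega R) (X : R -> Omega -> R * R).
Hypothesis hX : forall x : R * R, planar_brownian_motion (P x) X x.

Lemma L1_exit_moment_triangle (a b c : R * R) (k : nat) : (signed_area2 a b c != 0)%R ->
  L1_exit_moment P X (open_triangle a b c) k =
  simplex_moment R k * (`|signed_area2 a b c|%R%:E *
    \int[P 0%R]_w (((sup_sum X (bary_vec a b c) w ^+ 2)^-1) ^+ k)%:E).
Proof.
move=> d0; have dE := bary_vec_det d0.
rewrite open_triangleE// (L1_exit_momentE hX (sum_bary_vec a b c) (sum_bary_cst d0)).
  by rewrite dE normfV invrK [_%:E * simplex_moment _ _]muleC muleA.
by rewrite dE invr_eq0.
Qed.

Lemma equal_spectra_invariants (a b c a' b' c' : R * R) :
  (signed_area2 a b c != 0)%R -> (signed_area2 a' b' c' != 0)%R ->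
  (forall k, (1 <= k)%N -> L1_exit_moment P X (open_triangle a b c) k =
                           L1_exit_moment P X (open_triangle a' b' c') k) ->
  let v := bary_vec a b c in let v' := bary_vec a' b' c' in
  [/\ (`|signed_area2 a b c| = `|signed_area2 a' b' c'|)%R,
      (\sum_m Num.sqrt (sqnorm (v m)) = \sum_m Num.sqrt (sqnorm (v' m)))%R,
      (forall m, exists n, (sqnorm (v m) <= sqnorm (v' n))%R) &
      (forall m, exists n, (sqnorm (v' m) <= sqnorm (v n))%R)].
Proof.
move=> d0 d0' h v v'.
have pos (p q r : R * R) : (signed_area2 p q r != 0)%R -> (0 < sqnorm (bary_vec p q r ord0))%R.
  move=> e0; have [-> _ _] := sqnorm_bary_vec e0; have [s0 _ _] := sqnorm_side_gt0 e0.
  by rewrite divr_gt0// exprn_even_gt0.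
have v0 := pos _ _ _ d0; have v0' := pos _ _ _ d0'.
have sv := sum_bary_vec a b c; have sv' := sum_bary_vec a' b' c'.
have [e ep eE] := sup_sum_inv_exp_moment (hX 0%R) sv v0.
have [e' ep' eE'] := sup_sum_inv_exp_moment (hX 0%R) sv' v0'.
(* The exponential moments of the two inverse squares come with separate exponents; both hold at the
   smaller one. *)
have mono (u : 'I_3 -> R * R) (r r' : R) : (r <= r')%R ->
    \int[P 0%R]_w (expR (r' * (sup_sum X u w ^+ 2)^-1))%:E < +oo ->
    \int[P 0%R]_w (expR (r * (sup_sum X u w ^+ 2)^-1))%:E < +oo.
  have mE q : measurable_fun setT (fun w => (expR (q * (sup_sum X u w ^+ 2)^-1))%:E).
    apply/measurable_EFinP; apply: measurableT_comp => //; apply: measurable_funM => //.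
    apply: (measurableT_comp (@measurable_invr R)); apply: measurable_funX.
    exact: measurable_sup_sum (hX 0%R) _.
  move=> rr'; apply: le_lt_trans; apply: ge0_le_integral => //; rewrite ?mE//.
  by move=> w _; rewrite lee_fin ler_expR ler_wpM2r// invr_ge0 sqr_ge0.
apply: (@sup_sum_invariants _ _ _ (P 0%R) X 0%R (hX 0%R) v v' ord0 ord0) => //.
  by rewrite normr_gt0.
move=> j; apply: (@moments_determined _ _ _ (P 0%R) _ _ _ _ (Num.min e e')).
- exact: measurable_sup_sum (hX 0%R) _.
- exact: measurable_sup_sum (hX 0%R) _.
- exact: sup_sum_ge0.
- exact: sup_sum_ge0.
- exact (sup_sum_ae_gt0 (hX 0%R) sv v0).
- exact (sup_sum_ae_gt0 (hX 0%R) sv' v0').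
- exact: normr_ge0.
- exact: normr_ge0.
- by rewrite lt_min ep ep'.
- by apply: mono eE; rewrite ge_min lexx.
- by apply: mono eE'; rewrite ge_min lexx orbT.
move=> k k1; have := h k k1; rewrite !L1_exit_moment_triangle//.
apply: mule_pIl; last exact: simplex_moment_gt0.
by rewrite ge0_fin_numE ?simplex_moment_lty// ltW// simplex_moment_gt0.
Qed.

End equal_spectra.

Theorem corollary1p3 (R : realType) (d : measure_display)
    (Omega : measurableType d) (P : R * R -> probability Omega R)
    (X : R -> Omega -> R * R)
    (hX : forall x : R * R, planar_brownian_motion (P x) X x)
    (D1 D2 : set (R * R)) (hD1 : triangular_domain D1)
    (hD2 : triangular_domain D2)
    (hspec : forall k : nat, (1 <= k)%N ->
       L1_exit_moment P X D1 k = L1_exit_moment P X D2 k) :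
  isometric_domains D1 D2.
Proof.
have [a [b [c [d0 E1 s1 t1]]]] := triangular_domain_sorted hD1.
have [a' [b' [c' [d0' E2 s2 t2]]]] := triangular_domain_sorted hD2.
move: hspec; rewrite {}E1 {}E2 {D1 D2 hD1 hD2} => hspec.
have [dE sumE max1 max2] := equal_spectra_invariants hX d0 d0' hspec.
have d2E : signed_area2 a b c ^+ 2 = signed_area2 a' b' c' ^+ 2.
  by rewrite -real_normK ?num_real// dE real_normK ?num_real.
have d2 : 0 < signed_area2 a b c ^+ 2 by rewrite exprn_even_gt0.
have [x0 y0 z0] := sqnorm_bary_vec d0; have [x0' y0' z0'] := sqnorm_bary_vec d0'.
(* By the ordering of the sides, index [ord0] carries the longest of the three vectors. *)
have top (p q r : R * R) m : signed_area2 p q r != 0 ->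
    sqnorm (r - p) <= sqnorm (q - r) -> sqnorm (p - q) <= sqnorm (r - p) ->
    sqnorm (bary_vec p q r m) <= sqnorm (bary_vec p q r ord0).
  move=> e0 h1 h2; have [f0 f1 f2] := sqnorm_bary_vec e0.
  have e2 : 0 < signed_area2 p q r ^+ 2 by rewrite exprn_even_gt0.
  move: m; apply/forall_ord3; rewrite f0 f1 f2 !ler_pM2r ?invr_gt0//.
  by split=> //; exact: le_trans h2 h1.
have xE : sqnorm (b - c) = sqnorm (b' - c').
  have : sqnorm (bary_vec a b c ord0) = sqnorm (bary_vec a' b' c' ord0).
    apply/eqP; rewrite eq_le.
    have [n hn] := max1 ord0; have [n' hn'] := max2 ord0.
    by rewrite (le_trans hn (top _ _ _ _ d0' s2 t2)) (le_trans hn' (top _ _ _ _ d0 s1 t1)).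
  by rewrite x0 x0' -d2E => /mulIf; apply; rewrite invr_eq0 gt_eqF.
pose S := Num.sqrt (signed_area2 a b c ^+ 2).
have S0 : S != 0 by rewrite gt_eqF// sqrtr_gt0.
(* Each vector has length side over twice the area, so equal sums and equal areas give equal
   perimeters; the common longest side is then cancelled. *)
have sumsE : Num.sqrt (sqnorm (c - a)) + Num.sqrt (sqnorm (a - b)) =
    Num.sqrt (sqnorm (c' - a')) + Num.sqrt (sqnorm (a' - b')).
  have sq (u : R) : 0 <= u -> Num.sqrt (u / signed_area2 a b c ^+ 2) = Num.sqrt u / S.
    by move=> u0; rewrite sqrtrM// sqrtrV// ltW.
  move: sumE; rewrite !big_ord_recl !big_ord0 !addr0 x0 y0 z0 x0' y0' z0' -d2E xE.
  move=> /addrI; rewrite !sq ?addr_ge0 ?sqr_ge0// -!mulrDl => /mulIf; apply.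
  by rewrite invr_eq0.
have sqr (p q : R * R) : Num.sqrt (sqnorm (p - q)) ^+ 2 = sqnorm (p - q).
  by rewrite sqr_sqrtr// addr_ge0 ?sqr_ge0.
have H1 := heron (sqr b c) (sqr c a) (sqr a b).
have H2 := heron (sqr b' c') (sqr c' a') (sqr a' b').
have mono (u u' : R) : u <= u' -> Num.sqrt u <= Num.sqrt u' by exact: ler_wsqrtr.
have [yE zE] : Num.sqrt (sqnorm (c - a)) = Num.sqrt (sqnorm (c' - a')) /\
    Num.sqrt (sqnorm (a - b)) = Num.sqrt (sqnorm (a' - b')).
  apply: (@heron_determined _ (Num.sqrt (sqnorm (b - c)))); rewrite ?mono//.
    by rewrite -H1 mulr_gt0.
  by rewrite -H1 d2E H2 xE.
by apply: isometric_open_triangle => //; rewrite -sqr ?yE ?zE sqr.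
Qed.
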